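(* Let $X$ be a semi-locally contractible and paracompact topological space, let $\mathcal{U}=\{U_i\}_i$ be an ordered good open cover of $X$ with Čech nerve $N\mathcal{U}$, and let $\iota:N\mathcal{U}\to X$ be a homotopy equivalence that respects $\mathcal{U}$. Then, for every $k\in\mathbb{N}$, the composition $$\mathrm{H}^k_{\mathrm{sin}}(X,\mathbb{Z})\;\longrightarrow\;\mathrm{H}^k_{\mathrm{sin}}(X,\underline{\mathbb{Z}})\;\xrightarrow{\ \sim\ }\;\check{\mathrm{H}}^k_{\mathcal{U}}(X,\underline{\mathbb{Z}})$$ of the sheafification map with the isomorphism induced by sheaf cohomology is given by $$[\alpha]\;\longmapsto\;(-1)^k\Big[\big(\alpha(\iota\circ(x_{i_0}\cdots x_{i_k}))\big)_{i_0<\cdots<i_k}\Big],$$ where $(x_{i_0}\cdots x_{i_k}):\Delta^k\hookrightarrow N\mathcal{U}$ is the $k$-simplex of the simplicial complex $N\mathcal{U}$ corresponding to the non-empty intersection $U_{i_0}\cap\cdots\cap U_{i_k}$.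
   Context: **Spaces and covers.** A topological space $X$ is semi-locally contractible if every open $U\subseteq X$ has an open cover $\{W_j\}_j$ such that each inclusion $W_j\hookrightarrow U$ is homotopic to a constant map. A good open cover is an open cover $\mathcal{U}=\{U_i\}_i$ such that every non-empty finite intersection of the $U_i$ is contractible. It is ordered if its index set is totally ordered. Bold $\boldsymbol{i}=\{i_0<\cdots<i_k\}$ denotes a non-empty finite set of distinct indices with $U_{\boldsymbol{i}}:=U_{i_0}\cap\cdots\cap U_{i_k}\neq\emptyset$, and $|\boldsymbol{i}|:=k$. **Nerve.** $N\mathcal{U}$ is the (geometric realization of the) simplicial complex with one vertex $x_i$ for each $U_i$ and one $k$-simplex for each $\boldsymbol{i}$ with $|\boldsymbol{i}|=k$. This simplex, with its vertices ordered as $x_{i_0},\dots,x_{i_k}$ for $i_0<\cdots<i_k$, is parametrized by $(x_{i_0}\cdots x_{i_k}):\Delta^k\hookrightarrow N\mathcal{U}$. A homotopy equivalence $\iota:N\mathcal{U}\to X$ respects $\mathcal{U}$ if for every simplex $(x_{i_0}\cdots x_{i_m})$ of $N\mathcal{U}$ the image of $\iota\circ(x_{i_0}\cdots x_{i_m})$ is contained in $U_{i_0}\cup\cdots\cup U_{i_m}$. **Cohomologies.** $\mathrm{H}^k_{\mathrm{sin}}(X,\mathbb{Z})$ is ordinary singular cohomology, computed by the singular cochains $C^*_{\mathrm{sin}}(X)$. $\tilde C^*_{\mathrm{sin}}$ is the complex of sheaves obtained by sheafifying the presheaves $U\mapsto C^*_{\mathrm{sin}}(U)$; it is an acyclic resolution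 of the constant sheaf $\underline{\mathbb{Z}}$, with differential $\tilde\delta$, and $\mathrm{H}^k_{\mathrm{sin}}(X,\underline{\mathbb{Z}}):=\mathrm{H}^k(\tilde C^*_{\mathrm{sin}}(X))$. The sheafification map $\mathrm{H}^k_{\mathrm{sin}}(X,\mathbb{Z})\to\mathrm{H}^k_{\mathrm{sin}}(X,\underline{\mathbb{Z}})$ is induced by $C^*_{\mathrm{sin}}(X)\to\tilde C^*_{\mathrm{sin}}(X)$. $\check{\mathrm{H}}^k_{\mathcal{U}}(X,\underline{\mathbb{Z}})$ is the cohomology of the Čech complex $\check C^k_{\mathcal{U}}(X)=\prod_{|\boldsymbol{i}|=k}\underline{\mathbb{Z}}(U_{\boldsymbol{i}})$ with differential $(\check\delta c)_{\{i_0<\cdots<i_{k+1}\}}=\sum_{l=0}^{k+1}(-1)^l\,c_{\{i_0,\dots,\widehat{i_l},\dots,i_{k+1}\}}|_{U_{\boldsymbol{i}}}$. Integers are regarded as constant sections in $\underline{\mathbb{Z}}(U_{\boldsymbol{i}})\cong\mathbb{Z}$. **Isomorphism induced by sheaf cohomology.** It is the composition $\mathrm{H}^k_{\mathrm{sin}}(X,\underline{\mathbb{Z}})\xrightarrow{\sim}\mathrm{H}^k(X,\underline{\mathbb{Z}})\xleftarrow{\sim}\check{\mathrm{H}}^k_{\mathcal{U}}(X,\underline{\mathbb{Z}})$ (second arrow inverted) of the canonical isomorphisms comparing acyclic resolutions of $\underline{\mathbb{Z}}$ with an injective one. Concretely, let $E^*=\bigoplus_{a+b=*}\prod_{|\boldsymbol{i}|=a}\tilde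 C^b_{\mathrm{sin}}(U_{\boldsymbol{i}})$ be the total complex with differential acting on $\prod_{|\boldsymbol{i}|=a}\tilde C^b_{\mathrm{sin}}(U_{\boldsymbol{i}})$ by $\check\delta+(-1)^a\tilde\delta$. Let $\phi:\tilde C^*_{\mathrm{sin}}(X)\to E^*$ be restriction to $\prod_i\tilde C^*_{\mathrm{sin}}(U_i)$ and let $\psi:\check C^*_{\mathcal{U}}(X)\to E^*$ be the inclusion of locally constant functions as $0$-cochains. Both are quasi-isomorphisms, and the isomorphism induced by sheaf cohomology is $\overline{\psi}^{-1}\circ\overline{\phi}$ on cohomology.
   Formalization: The singular differential is taken as δα = −α∘∂; with the usual δα = α∘∂ and the given total differential, the composition is [α] ↦ [α(ι∘(x_{i_0}…x_{i_k}))] without (−1)^k, so the stated sign fails for odd k (e.g. the circle, k = 1). *)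

(* Defs.v *)
From HB Require Import structures.
From mathcomp Require Import all_boot all_order all_algebra.
From mathcomp Require Import all_classical reals topology normedtype.

Set Implicit Arguments.
Unset Strict Implicit.
Unset Printing Implicit Defensive.

Import Order.TTheory GRing.Theory Num.Theory.
Import numFieldNormedType.Exports.

Local Open Scope classical_set_scope.
Local Open Scope ring_scope.
Local Open Scope quotient_scope.

Definition dprod (I : Type) (M : I -> zmodType) : Type := forall i, M i.

Section DProd.
Variables (I : Type) (M : I -> zmodType).
Implicit Types f g h : dprod M.

HB.instance Definition _ := gen_eqMixin (dprod M).
HB.instance Definition _ := gen_choiceMixin (dprod M).

Lemma dprodP f g : (forall i, f i = g i) -> f = g.
Proof. exact: functional_extensionality_dep. Qed.

Fact dprod_addA : associative (fun f g : dprod M => (fun i => f i + g i) : dprod M).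
Proof. by move=> f g h; apply: dprodP => i; rewrite addrA. Qed.
Fact dprod_addC : commutative (fun f g : dprod M => (fun i => f i + g i) : dprod M).
Proof. by move=> f g; apply: dprodP => i; rewrite addrC. Qed.
Fact dprod_add0 : left_id ((fun=> 0) : dprod M)
  (fun f g : dprod M => (fun i => f i + g i) : dprod M).
Proof. by move=> f; apply: dprodP => i; rewrite add0r. Qed.
Fact dprod_addN : left_inverse ((fun=> 0) : dprod M)
  (fun f : dprod M => (fun i => - f i) : dprod M)
  (fun f g : dprod M => (fun i => f i + g i) : dprod M).
Proof. by move=> f; apply: dprodP => i; rewrite addNr. Qed.

HB.instance Definition _ := GRing.isZmodule.Build (dprod M)
  dprod_addA dprod_addC dprod_add0 dprod_addN.

Lemma dprodD f g i : (f + g) i = f i + g i. Proof. by []. Qed.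
Lemma dprodN f i : (- f) i = - f i. Proof. by []. Qed.
Lemma dprod0 i : (0 : dprod M) i = 0. Proof. by []. Qed.
End DProd.

Record cochain_complex := CochainComplex {
  cc :> nat -> zmodType;
  dif : forall k, {additive cc k -> cc k.+1};
  dif_dif : forall k x, dif k.+1 (dif k x) = 0 }.
Arguments dif C {k} : rename.

Section Cohomology.
Variables (C : cochain_complex) (k : nat).

Definition is_cocycle : {pred C k} := [pred x | dif C x == 0].

Fact is_cocycle_zmod : zmod_closed is_cocycle.
Proof.
split=> [|x y]; rewrite !inE ?raddf0 // => /eqP hx /eqP hy.
by rewrite raddfB hx hy subr0.
Qed.
HB.instance Definition _ := GRing.isZmodClosed.Build (C k) is_cocycle is_cocycle_zmod.

Record cocycle := Cocycle { cocycle_val : C k; cocycleP : cocycle_val \in is_cocycle }.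
HB.instance Definition _ := [isSub for cocycle_val].
HB.instance Definition _ := [Choice of cocycle by <:].
HB.instance Definition _ := [SubChoice_isSubZmodule of cocycle by <:].
End Cohomology.

Definition coboundary (C : cochain_complex) (k : nat) : C k -> Prop :=
  match k return C k -> Prop with
  | 0 => fun x => x = 0
  | k'.+1 => fun x => exists y : C k', x = dif C y
  end.

Section CohomologyGroup.
Variables (C : cochain_complex) (k : nat).

Definition is_coboundary : {pred cocycle C k} :=
  [pred z | `[< coboundary (cocycle_val z) >]].

Lemma is_coboundaryP z : reflect (coboundary (cocycle_val z)) (z \in is_coboundary).
Proof. exact: asboolP. Qed.

Fact is_coboundary_zmod : zmod_closed is_coboundary.
Proof.
split=> [|x y].
  apply/is_coboundaryP; case: (k) => [|k'] //=; by exists 0; rewrite raddf0.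
move=> /is_coboundaryP hx /is_coboundaryP hy; apply/is_coboundaryP.
move: x y hx hy.
case: (k) => [|k'] x y /=; first by move=> -> ->; rewrite subr0.
by move=> [a ->] [b ->]; exists (a - b); rewrite raddfB.
Qed.
HB.instance Definition _ :=
  GRing.isZmodClosed.Build (cocycle C k) is_coboundary is_coboundary_zmod.

Definition cohomology : zmodType := Quotient.quot is_coboundary.

Definition cohomology_class (z : cocycle C k) : cohomology :=
  \pi_(Quotient.quot is_coboundary) z.
End CohomologyGroup.

Record chain_map (C D : cochain_complex) := ChainMap {
  cm :> forall k, {additive C k -> D k};
  cm_dif : forall k x, cm k.+1 (dif C x) = dif D (cm k x) }.

Section InducedMap.
Variables (C D : cochain_complex) (f : chain_map C D) (k : nat).

Fact cocycle_map_subproof (z : cocycle C k) : f k (cocycle_val z) \in @is_cocycle D k.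
Proof.
have := cocycleP z; rewrite !inE -cm_dif => /eqP ->; exact/eqP/raddf0.
Qed.

Definition cocycle_map (z : cocycle C k) : cocycle D k :=
  Cocycle (cocycle_map_subproof z).

Definition cohomology_map (h : cohomology C k) : cohomology D k :=
  cohomology_class (cocycle_map (repr h)).
End InducedMap.

Lemma cohomology_mapE C D (f : chain_map C D) k (z : cocycle C k) :
  cohomology_map f (cohomology_class z) = cohomology_class (cocycle_map f z).
Proof.
apply/eqP; rewrite /cohomology_map /cohomology_class -Quotient.idealrBE.
have : repr (\pi_(Quotient.quot (@is_coboundary C k)) z) - z
    \in @is_coboundary C k by rewrite Quotient.idealrBE reprK.
set y := repr _; move: y => y /is_coboundaryP h; apply/is_coboundaryP.
move: z y h; case: (k) => [|k'] z y /=.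
  by rewrite -raddfB => ->; rewrite raddf0.
by move=> [a ha]; exists (f _ a); rewrite -cm_dif -ha raddfB.
Qed.

Lemma alternating_sum2 (M : zmodType) n (x : 'I_n.+1 -> 'I_n -> M) :
  (forall i j : 'I_n, (i <= j)%N ->
     x (lift ord0 j) i = x (widen_ord (leqnSn n) i) j) ->
  \sum_(j < n.+1) (\sum_(i < n) x j i *~ (-1) ^+ i) *~ (-1) ^+ j = 0.
Proof.
move=> hx.
pose F (j : 'I_n.+1) (i : 'I_n) := x j i *~ ((-1) ^+ i * (-1) ^+ j).
transitivity (\sum_(j < n.+1) (\sum_(i < n | (i < j)%N) F j i +
                               \sum_(i < n | ~~ (i < j)%N) F j i)).
  apply: eq_bigr => j _; rewrite -(bigID (fun i : 'I_n => (i < j)%N) xpredT).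
  by rewrite /= mulrz_suml; apply: eq_bigr => i _; rewrite /F mulrzA.
rewrite big_split /= [X in X + _]big_ord_recl [X in _ + X]big_ord_recr /=.
rewrite [X in X + _ + _]big1 ?add0r; last by move=> i; rewrite ltn0.
rewrite [X in _ + (_ + X)]big1 ?addr0; last by move=> i; rewrite ltn_ord.
rewrite (exchange_big_dep xpredT) //= -big_split big1 //= => i _.
rewrite (eq_bigl (fun j : 'I_n => (i <= j)%N)); last first.
  by move=> j /=; rewrite /bump /= add1n ltnS.
rewrite [X in _ + X](eq_bigl (fun j : 'I_n => (i <= j)%N)); last first.
  by move=> j /=; rewrite -leqNgt.
rewrite -big_split big1 //= => j ij; rewrite /F hx //= /bump /= add1n exprS.
by rewrite mulN1r mulrN mulrNz mulrC addNr.
Qed.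

Record double_complex := DoubleComplex {
  dc :> nat -> nat -> zmodType;
  dh : forall a b, {additive dc a b -> dc a.+1 b};
  dv : forall a b, {additive dc a b -> dc a b.+1};
  dh_dh : forall a b x, dh a.+1 b (dh a b x) = 0;
  dv_dv : forall a b x, dv a b.+1 (dv a b x) = 0;
  dh_dv : forall a b x, dh a b.+1 (dv a b x) = dv a.+1 b (dh a b x) }.
Arguments dh K {a b} : rename.
Arguments dv K {a b} : rename.

Record antidiagonal (n : nat) :=
  Antidiagonal { ad1 : nat; ad2 : nat; ad_eq : (ad1 + ad2)%N = n }.

Section TotalComplex.
Variable K : double_complex.

(* Each antidiagonal is finite, so the product below is the direct sum. *)
Definition tot (n : nat) : zmodType :=
  dprod (fun p : antidiagonal n => K (ad1 p) (ad2 p)).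

Fact tot_eq_h n a b : (a.+1 + b)%N = n.+1 -> (a + b)%N = n.
Proof. by case. Qed.
Fact tot_eq_v n a b : (a + b.+1)%N = n.+1 -> (a + b)%N = n.
Proof. by rewrite addnS => -[]. Qed.

Definition tot_h n (f : tot n) (a b : nat) : (a + b)%N = n.+1 -> K a b :=
  match a return (a + b)%N = n.+1 -> K a b with
  | 0 => fun _ => 0
  | a'.+1 => fun e => dh K (f (Antidiagonal (tot_eq_h e)))
  end.

Definition tot_v n (f : tot n) (a b : nat) : (a + b)%N = n.+1 -> K a b :=
  match b return (a + b)%N = n.+1 -> K a b with
  | 0 => fun _ => 0
  | b'.+1 => fun e => dv K (f (Antidiagonal (tot_eq_v e)))
  end.

Definition tot_dif n (f : tot n) : tot n.+1 :=
  fun p => tot_h f (ad_eq p) + tot_v f (ad_eq p) *~ (-1) ^+ ad1 p.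

Fact tot_dif_zmod n : zmod_morphism (@tot_dif n).
Proof.
move=> f g; apply: dprodP => -[a b e].
have hh : tot_h (f - g) e = tot_h f e - tot_h g e.
  by case: a e => [|a] e /=; rewrite ?subr0 // -raddfB.
have hv : tot_v (f - g) e = tot_v f e - tot_v g e.
  by case: b e {hh} => [|b] e /=; rewrite ?subr0 // -raddfB.
rewrite /tot_dif dprodD dprodN /= hh hv mulrzBl opprD addrACA //.
Qed.
HB.instance Definition _ n :=
  GRing.isZmodMorphism.Build (tot n) (tot n.+1) (@tot_dif n) (@tot_dif_zmod n).

Fact tot_dif_dif n (f : tot n) : tot_dif (tot_dif f) = 0.
Proof.
apply: dprodP => -[a b e]; rewrite dprod0 /tot_dif /=.
case: a e => [|a] e /=; rewrite ?add0r ?expr0 ?mulr1z.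
  case: b e => [|b] e //=; rewrite ?expr0 ?mulr1z add0r.
  case: b e => [|b] e /=; rewrite ?raddf0 //.
  by rewrite dv_dv.
rewrite raddfD raddfMz /=.
have -> : dh K (tot_h f (tot_eq_h e)) = 0.
  by case: a e => [|a] e /=; rewrite ?raddf0 ?dh_dh.
rewrite add0r; case: b e => [|b] e /=; first by rewrite raddf0 !mul0rz addr0.
rewrite raddfD raddfMz /=.
have -> : dv K (tot_v f (tot_eq_v e)) = 0.
  by case: b e => [|b] e /=; rewrite ?raddf0 ?dv_dv.
rewrite mul0rz addr0 dh_dv.
set u := f _; set v := f _; have -> : v = u.
  by rewrite /u /v; congr (f (Antidiagonal _)); exact: Prop_irrelevance.
by rewrite exprS mulN1r mulrNz subrr.
Qed.

Definition total_complex : cochain_complex :=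
  @CochainComplex tot (fun n => tot_dif (n := n)) tot_dif_dif.
End TotalComplex.

(* [aug_v] (resp. [aug_h]) is the chain map to the total complex induced by an
   augmentation into the part [a = 0] (resp. [b = 0]) of the double complex. *)
Section Augmentation.
Variables (K : double_complex) (C : cochain_complex).

Definition cast_deg m n (e : m = n) : C n -> C m :=
  match e in _ = n return C n -> C m with erefl => id end.

Fact cast_deg_zmod m n (e : m = n) : zmod_morphism (cast_deg e).
Proof. by case: n / e. Qed.
HB.instance Definition _ m n (e : m = n) :=
  GRing.isZmodMorphism.Build (C n) (C m) (cast_deg e) (cast_deg_zmod e).

Lemma cast_deg_dif m n (e : m = n) (e' : m.+1 = n.+1) (x : C n) :
  cast_deg e' (dif C x) = dif C (cast_deg e x).
Proof. by case: n / e e' x => e' x; rewrite (Prop_irrelevance e' erefl). Qed.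

Section Vertical.
Variable eps : forall b, {additive C b -> K 0 b}.
Hypothesis eps_dif : forall b x, eps b.+1 (dif C x) = dv K (eps b x).
Hypothesis dh_eps : forall b x, dh K (eps b x) = 0.

Definition aug_v_fun n (x : C n) : tot K n := fun p =>
  match p with Antidiagonal a b e =>
    match a return (a + b)%N = n -> K a b with
    | 0 => fun e => eps b (cast_deg e x)
    | a'.+1 => fun _ => 0
    end e
  end.

Fact aug_v_zmod n : zmod_morphism (@aug_v_fun n).
Proof.
move=> x y; apply: dprodP => -[[|a] b e]; rewrite dprodD dprodN /= ?subr0 //.
by rewrite !raddfB.
Qed.
HB.instance Definition _ n :=
  GRing.isZmodMorphism.Build (C n) (tot K n) (@aug_v_fun n) (@aug_v_zmod n).

Fact aug_v_dif n (x : C n) : aug_v_fun (dif C x) = tot_dif (aug_v_fun x).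
Proof.
apply: dprodP => -[[|a] b e]; rewrite /tot_dif /=.
  rewrite add0r expr0 mulr1z; case: b e => [|b] e //=.
  by rewrite -eps_dif -cast_deg_dif.
have -> : tot_v (aug_v_fun x) e = 0 by case: b e => [|b] e //=; rewrite raddf0.
by rewrite mul0rz addr0; case: a e => [|a] e /=; rewrite ?dh_eps ?raddf0.
Qed.

Definition aug_v : chain_map C (total_complex K) :=
  @ChainMap C (total_complex K) (fun n => aug_v_fun (n := n)) aug_v_dif.
End Vertical.

Section Horizontal.
Variable eps : forall a, {additive C a -> K a 0}.
Hypothesis eps_dif : forall a x, eps a.+1 (dif C x) = dh K (eps a x).
Hypothesis dv_eps : forall a x, dv K (eps a x) = 0.

Fact aug_h_eq a n : (a + 0)%N = n -> a = n.
Proof. by rewrite addn0. Qed.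

Definition aug_h_fun n (x : C n) : tot K n := fun p =>
  match p with Antidiagonal a b e =>
    match b return (a + b)%N = n -> K a b with
    | 0 => fun e => eps a (cast_deg (aug_h_eq e) x)
    | b'.+1 => fun _ => 0
    end e
  end.

Fact aug_h_zmod n : zmod_morphism (@aug_h_fun n).
Proof.
move=> x y; apply: dprodP => -[a [|b] e]; rewrite dprodD dprodN /= ?subr0 //.
by rewrite !raddfB.
Qed.
HB.instance Definition _ n :=
  GRing.isZmodMorphism.Build (C n) (tot K n) (@aug_h_fun n) (@aug_h_zmod n).

Fact aug_h_dif n (x : C n) : aug_h_fun (dif C x) = tot_dif (aug_h_fun x).
Proof.
apply: dprodP => -[a [|b] e]; rewrite /tot_dif /=.
  rewrite mul0rz addr0; case: a e => [|a] e /=; first by exfalso; move: e; rewrite addn0.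
  by rewrite (cast_deg_dif (aug_h_eq (tot_eq_h e))) eps_dif.
have -> : tot_h (aug_h_fun x) e = 0 by case: a e => [|a] e //=; rewrite raddf0.
rewrite add0r; case: b e => [|b] e /=; rewrite ?dv_eps ?raddf0 mul0rz //.
Qed.

Definition aug_h : chain_map C (total_complex K) :=
  @ChainMap C (total_complex K) (fun n => aug_h_fun (n := n)) aug_h_dif.
End Horizontal.
End Augmentation.

Record opens (X : topologicalType) :=
  Opens { opens_set :> set X; opens_open : open opens_set }.

Section Opens.
Variable X : topologicalType.
Definition opensT : opens X := Opens openT.
Definition opensI (U V : opens X) : opens X :=
  Opens (openI (opens_open U) (opens_open V)).
Lemma opens_subT (U : opens X) : U `<=` opensT. Proof. by []. Qed.
Lemma opensIl (U V : opens X) : opensI U V `<=` U. Proof. by move=> y []. Qed.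
Lemma opensIr (U V : opens X) : opensI U V `<=` V. Proof. by move=> y []. Qed.

Definition incl (U V : set X) (h : V `<=` U) (x : set_type V) : set_type U :=
  exist _ (val x) (mem_set (h _ (set_mem (valP x)))).

Lemma incl_val (U V : set X) (h : V `<=` U) (x : set_type V) :
  val (incl h x) = val x.
Proof. by []. Qed.
End Opens.

Record presheaf (X : topologicalType) := Presheaf {
  sections :> opens X -> zmodType;
  res : forall U V : opens X, V `<=` U -> {additive sections U -> sections V};
  res_id : forall (U : opens X) (h : U `<=` U) s, res h s = s;
  res_res : forall (U V W : opens X) (hVU : V `<=` U) (hWV : W `<=` V)
    (hWU : W `<=` U) s, res hWV (res hVU s) = res hWU s }.
Arguments res {X} F {U V} h : rename.

Record presheaf_map (X : topologicalType) (F G : presheaf X) := PresheafMap {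
  pm :> forall U, {additive F U -> G U};
  pm_res : forall (U V : opens X) (h : V `<=` U) s,
    pm V (res F h s) = res G h (pm U s) }.

Record presheaf_complex (X : topologicalType) := PresheafComplex {
  pc :> nat -> presheaf X;
  pc_dif : forall k, presheaf_map (pc k) (pc k.+1);
  pc_dif_dif : forall k U s, pc_dif k.+1 U (pc_dif k U s) = 0 }.
Arguments pc_dif {X} P k : rename.

Definition sections_complex (X : topologicalType) (P : presheaf_complex X)
    (U : opens X) : cochain_complex :=
  @CochainComplex (fun k => P k U) (fun k => pc_dif P k U)
    (fun k s => pc_dif_dif s).

Section Stalk.
Variables (X : topologicalType) (F : presheaf X) (x : X).

Record germ_rep := GermRep {
  gr_dom : opens X;
  gr_in : opens_set gr_dom x;
  gr_sec : F gr_dom }.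
HB.instance Definition _ := gen_eqMixin germ_rep.
HB.instance Definition _ := gen_choiceMixin germ_rep.

Definition germ_rel (s t : germ_rep) : bool :=
  `[< exists (W : opens X) (hs : W `<=` gr_dom s) (ht : W `<=` gr_dom t),
      opens_set W x /\ res F hs (gr_sec s) = res F ht (gr_sec t) >].

Fact germ_rel_equiv : equiv_class_of germ_rel.
Proof.
split=> [s|s t|s t u].
- apply/asboolP; exists (gr_dom s), (@subset_refl _ _), (@subset_refl _ _).
  by split=> //; exact: gr_in.
- by apply/asboolP/asboolP => -[W [hs [ht [Wx e]]]]; exists W, ht, hs.
- move=> /asboolP[W [hs [ht [Wx e]]]] /asboolP[W' [hs' [ht' [Wx' e']]]].
  have hW : opensI W W' `<=` W by move=> y [].
  have hW' : opensI W W' `<=` W' by move=> y [].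
  apply/asboolP; exists (opensI W W'), (subset_trans hW hs), (subset_trans hW' ht').
  split=> //; rewrite -(res_res hs hW) e -(res_res ht' hW') -e'.
  rewrite (res_res _ _ (subset_trans hW ht)) (res_res _ _ (subset_trans hW' hs')).
  by congr (res F _ _); exact: Prop_irrelevance.
Qed.

Canonical germ_rel_equiv_rel := EquivRelPack germ_rel_equiv.
Canonical germ_rel_encModRel := defaultEncModRel germ_rel.

Definition stalk : Type := {eq_quot germ_rel}.
HB.instance Definition _ := Choice.on stalk.
HB.instance Definition _ : EqQuotient germ_rep germ_rel stalk := EqQuotient.on stalk.

Lemma stalk_eq (s t : germ_rep) (W : opens X)
    (hs : W `<=` gr_dom s) (ht : W `<=` gr_dom t) :
  opens_set W x -> res F hs (gr_sec s) = res F ht (gr_sec t) ->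
  \pi_stalk s = \pi_stalk t.
Proof. by move=> Wx e; apply/eqmodP/asboolP; exists W, hs, ht. Qed.

Lemma stalk_eqP (s t : germ_rep) : \pi_stalk s = \pi_stalk t ->
  exists (W : opens X) (hs : W `<=` gr_dom s) (ht : W `<=` gr_dom t),
      opens_set W x /\ res F hs (gr_sec s) = res F ht (gr_sec t).
Proof. by move=> /eqmodP/asboolP. Qed.

Definition rep0 : germ_rep := @GermRep (opensT X) I 0.
Definition repN (s : germ_rep) : germ_rep := GermRep (gr_in s) (- gr_sec s).
Definition repD (s t : germ_rep) : germ_rep :=
  @GermRep (opensI (gr_dom s) (gr_dom t)) (conj (gr_in s) (gr_in t))
    (res F (@opensIl _ _ _) (gr_sec s) + res F (@opensIr _ _ _) (gr_sec t)).

Definition stalk0 : stalk := \pi_stalk rep0.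
Definition stalkN (g : stalk) : stalk := \pi_stalk (repN (repr g)).
Definition stalkD (g h : stalk) : stalk := \pi_stalk (repD (repr g) (repr h)).

Lemma stalkN_pi s : stalkN (\pi_stalk s) = \pi_stalk (repN s).
Proof.
have /stalk_eqP[W [hs [ht [Wx e]]]] := reprK (\pi_stalk s).
apply: (@stalk_eq (repN (repr (\pi_stalk s))) (repN s) W hs ht Wx).
by rewrite /= !raddfN; congr (- _).
Qed.

Lemma stalkD_pi s t : stalkD (\pi_stalk s) (\pi_stalk t) = \pi_stalk (repD s t).
Proof.
have /stalk_eqP[W [hs [ht [Wx e]]]] := reprK (\pi_stalk s).
have /stalk_eqP[W' [hs' [ht' [Wx' e']]]] := reprK (\pi_stalk t).
have hW : opensI W W' `<=` W by move=> y [].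
have hW' : opensI W W' `<=` W' by move=> y [].
have h1 : opensI W W' `<=`
    gr_dom (repD (repr (\pi_stalk s)) (repr (\pi_stalk t))).
  by move=> y [/hs ? /hs' ?]; split.
have h2 : opensI W W' `<=` gr_dom (repD s t) by move=> y [/ht ? /ht' ?]; split.
apply: (@stalk_eq (repD _ _) (repD s t) (opensI W W') h1 h2) => //.
rewrite /= !raddfD /=; congr (_ + _).
  rewrite !(res_res _ _ (subset_trans hW hs)) !(res_res _ _ (subset_trans hW ht)).
  by rewrite -(res_res hs hW) e (res_res _ _ (subset_trans hW ht)).
rewrite !(res_res _ _ (subset_trans hW' hs')) !(res_res _ _ (subset_trans hW' ht')).
by rewrite -(res_res hs' hW') e' (res_res _ _ (subset_trans hW' ht')).
Qed.

Lemma stalk_ind (P : stalk -> Prop) : (forall s, P (\pi_stalk s)) -> forall g, P g.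
Proof. by move=> h g; rewrite -[g]reprK. Qed.

Fact stalkDA : associative stalkD.
Proof.
elim/stalk_ind => s; elim/stalk_ind => t; elim/stalk_ind => u.
rewrite !stalkD_pi.
pose W := opensI (gr_dom s) (opensI (gr_dom t) (gr_dom u)).
have hW : W `<=` gr_dom (repD (repD s t) u) by move=> y [? [? ?]]; split.
have hs : W `<=` gr_dom s by move=> y [].
have ht : W `<=` gr_dom t by move=> y [? []].
have hu : W `<=` gr_dom u by move=> y [? []].
have hst : W `<=` opensI (gr_dom s) (gr_dom t) by move=> y [? []].
have htu : W `<=` opensI (gr_dom t) (gr_dom u) by move=> y [? []].
have hW' : W `<=` gr_dom (repD s (repD t u)) by [].
apply: (@stalk_eq (repD s (repD t u)) (repD (repD s t) u) W hW' hW); first by split; [exact: gr_in | split; exact: gr_in].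
rewrite /= !raddfD /= (res_res _ _ hs) (res_res _ _ htu) (res_res _ _ htu).
rewrite !(res_res _ _ ht) !(res_res _ _ hu) !(res_res _ _ hst).
by rewrite !(res_res _ _ hs) !(res_res _ _ ht) addrA.
Qed.

Fact stalkDC : commutative stalkD.
Proof.
elim/stalk_ind => s; elim/stalk_ind => t; rewrite !stalkD_pi.
have h : gr_dom (repD s t) `<=` gr_dom (repD t s) by move=> y [].
apply: (@stalk_eq (repD s t) (repD t s) _ (@subset_refl _ _) h); first exact: gr_in.
have hs : opensI (gr_dom s) (gr_dom t) `<=` gr_dom s by move=> y [].
have ht : opensI (gr_dom s) (gr_dom t) `<=` gr_dom t by move=> y [].
by rewrite /= !raddfD /= !(res_res _ _ hs) !(res_res _ _ ht) addrC.
Qed.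

Fact stalk0D : left_id stalk0 stalkD.
Proof.
elim/stalk_ind => s; rewrite stalkD_pi.
have h : gr_dom s `<=` gr_dom (repD rep0 s) by move=> y; split.
apply: (@stalk_eq (repD rep0 s) s _ h (@subset_refl _ _)); first exact: gr_in.
by rewrite /= !raddfD /= !raddf0 add0r (res_res _ _ (@subset_refl _ _)).
Qed.

Fact stalkND : left_inverse stalk0 stalkN stalkD.
Proof.
elim/stalk_ind => s; rewrite stalkN_pi stalkD_pi.
have h : gr_dom s `<=` gr_dom (repD (repN s) s) by move=> y; split.
apply: (@stalk_eq (repD (repN s) s) rep0 _ h (@subsetT _ _)); first exact: gr_in.
rewrite /= !raddfD /= !(res_res _ _ (@subset_refl _ _)).
by rewrite raddfN addNr raddf0.
Qed.

HB.instance Definition _ := GRing.isZmodule.Build stalk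
  stalkDA stalkDC stalk0D stalkND.
End Stalk.

Section Germ.
Variables (X : topologicalType) (F : presheaf X).

Definition germ (U : opens X) (x : set_type U) (s : F U) : stalk F (val x) :=
  \pi_(stalk F (val x)) (GermRep (set_mem (valP x)) s).

Lemma germ_res (U V : opens X) (h : V `<=` U) (x : set_type V) (s : F U) :
  germ x (res F h s) = germ (incl h x) s.
Proof.
apply: (@stalk_eq _ F (val x) (GermRep (set_mem (valP x)) (res F h s))
  (GermRep (set_mem (valP (incl h x))) s) V (@subset_refl _ _) h).
  exact: set_mem (valP x).
by rewrite /= res_id.
Qed.

Fact germ_zmod (U : opens X) (x : set_type U) : zmod_morphism (@germ U x).
Proof.
have hD (s t : F U) : germ x (s + t) = germ x s + germ x t.
  rewrite [RHS]stalkD_pi.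
  have h : U `<=` opensI U U by move=> y; split.
  pose r u := @GermRep _ F (val x) U (set_mem (valP x)) u.
  apply: (@stalk_eq _ F (val x) (r (s + t)) (repD (r s) (r t)) U
    (@subset_refl _ _) h).
    exact: set_mem (valP x).
  by rewrite /= !raddfD /= !(res_res _ _ (@subset_refl _ _)).
have hN (s : F U) : germ x (- s) = - germ x s by rewrite [RHS]stalkN_pi.
by move=> s t; rewrite hD hN.
Qed.
HB.instance Definition _ (U : opens X) (x : set_type U) :=
  GRing.isZmodMorphism.Build (F U) (stalk F (val x)) (@germ U x) (germ_zmod x).

Lemma germ_surj (x : X) (g : stalk F x) :
  exists (U : opens X) (Ux : opens_set U x) (s : F U),
    g = germ (exist _ x (mem_set Ux)) s.
Proof.
elim/stalk_ind: g => -[U Ux s]; exists U, Ux, s.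
by congr (\pi_(stalk F x) (GermRep _ s)); exact: Prop_irrelevance.
Qed.
End Germ.

Section Sheafification.
Variables (X : topologicalType) (F : presheaf X).

Definition is_sheaf_section (U : opens X) :
    {pred dprod (fun x : set_type U => stalk F (val x))} :=
  [pred s | `[< forall x : set_type U,
    exists (V : opens X) (hVU : V `<=` U) (t : F V), opens_set V (val x) /\
      forall y : set_type V, s (incl hVU y) = germ y t >]].

Lemma is_sheaf_sectionP (U : opens X) (s : dprod (fun x : set_type U => stalk F (val x))) :
  reflect (forall x : set_type U,
    exists (V : opens X) (hVU : V `<=` U) (t : F V), opens_set V (val x) /\
      forall y : set_type V, s (incl hVU y) = germ y t)
  (s \in @is_sheaf_section U).
Proof. exact: asboolP. Qed.

Lemma dprod_irr (U : opens X) (s : dprod (fun x : set_type U => stalk F (val x)))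
    (x : X) (p q : x \in (U : set X)) :
  s (exist _ x p) = s (exist _ x q) :> stalk F x.
Proof. by rewrite (bool_irrelevance p q). Qed.

Fact is_sheaf_section_zmod (U : opens X) : zmod_closed (@is_sheaf_section U).
Proof.
split=> [|s t /is_sheaf_sectionP hs /is_sheaf_sectionP ht]; apply/is_sheaf_sectionP => x.
  exists U, (@subset_refl _ _), 0; split; first exact: set_mem (valP x).
  by move=> y; rewrite raddf0.
have [V [hV [s' [Vx es]]]] := hs x; have [W [hW [t' [Wx et]]]] := ht x.
have h : opensI V W `<=` U by move=> y [/hV].
have h1 : opensI V W `<=` V by move=> y [].
have h2 : opensI V W `<=` W by move=> y [].
exists (opensI V W), h, (res F h1 s' - res F h2 t'); split=> // y.
rewrite raddfB /= !germ_res -es -et dprodD dprodN.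
by congr (_ - _); exact: dprod_irr.
Qed.
HB.instance Definition _ (U : opens X) := GRing.isZmodClosed.Build
  (dprod (fun x : set_type U => stalk F (val x))) (@is_sheaf_section U)
  (@is_sheaf_section_zmod U).

Record sheaf_section (U : opens X) := SheafSection {
  ss_val : dprod (fun x : set_type U => stalk F (val x));
  ss_valP : ss_val \in @is_sheaf_section U }.
HB.instance Definition _ U := [isSub for @ss_val U].
HB.instance Definition _ U := [Choice of sheaf_section U by <:].
HB.instance Definition _ U := [SubChoice_isSubZmodule of sheaf_section U by <:].

Lemma sheaf_sectionP U (s t : sheaf_section U) :
  (forall x, ss_val s x = ss_val t x) -> s = t.
Proof. by move=> h; apply: val_inj; apply: dprodP. Qed.

Fact sheaf_res_subproof (U V : opens X) (h : V `<=` U) (s : sheaf_section U) :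
  ((fun x => ss_val s (incl h x)) : dprod (fun x : set_type V => stalk F (val x)))
    \in @is_sheaf_section V.
Proof.
apply/is_sheaf_sectionP => x; have /is_sheaf_sectionP hs := ss_valP s.
have [W [hW [t [Wx e]]]] := hs (incl h x).
have h1 : opensI V W `<=` V by move=> y [].
have h2 : opensI V W `<=` W by move=> y [].
exists (opensI V W), h1, (res F h2 t); split.
  by split=> //; exact: set_mem (valP x).
by move=> y; rewrite germ_res -e; exact: (dprod_irr (ss_val s)).
Qed.

Definition sheaf_res (U V : opens X) (h : V `<=` U) (s : sheaf_section U) :
  sheaf_section V := SheafSection (sheaf_res_subproof h s).

Fact sheaf_res_zmod (U V : opens X) (h : V `<=` U) : zmod_morphism (sheaf_res h).
Proof. by move=> s t; apply: sheaf_sectionP. Qed.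
HB.instance Definition _ (U V : opens X) (h : V `<=` U) :=
  GRing.isZmodMorphism.Build (sheaf_section U) (sheaf_section V)
    (sheaf_res h) (sheaf_res_zmod h).

Fact sheaf_res_id (U : opens X) (h : U `<=` U) s : sheaf_res h s = s.
Proof.
by apply: sheaf_sectionP => -[x p]; exact: (dprod_irr (ss_val s)).
Qed.

Fact sheaf_res_res (U V W : opens X) (hVU : V `<=` U) (hWV : W `<=` V)
  (hWU : W `<=` U) s : sheaf_res hWV (sheaf_res hVU s) = sheaf_res hWU s.
Proof.
by apply: sheaf_sectionP => -[x p]; exact: (dprod_irr (ss_val s)).
Qed.

Definition sheafify : presheaf X :=
  @Presheaf X (fun U => sheaf_section U) (fun U V h => sheaf_res h)
    sheaf_res_id sheaf_res_res.

Fact sheaf_unit_subproof (U : opens X) (s : F U) :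
  ((fun x => germ x s) : dprod (fun x : set_type U => stalk F (val x)))
    \in @is_sheaf_section U.
Proof.
apply/is_sheaf_sectionP => x; exists U, (@subset_refl _ _), s.
split=> [|[y p]]; first exact: set_mem (valP x).
exact: (dprod_irr ((fun x => germ x s) : dprod (fun x : set_type U => stalk F (val x)))).
Qed.

Definition sheaf_unit_fun (U : opens X) (s : F U) : sheafify U :=
  SheafSection (sheaf_unit_subproof s).

Fact sheaf_unit_zmod (U : opens X) : zmod_morphism (@sheaf_unit_fun U).
Proof. by move=> s t; apply: sheaf_sectionP => x; rewrite /= raddfB. Qed.
HB.instance Definition _ (U : opens X) :=
  GRing.isZmodMorphism.Build (F U) (sheafify U)
    (@sheaf_unit_fun U) (@sheaf_unit_zmod U).

Fact sheaf_unit_res (U V : opens X) (h : V `<=` U) (s : F U) :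
  sheaf_unit_fun (res F h s) = res sheafify h (sheaf_unit_fun s).
Proof. by apply: sheaf_sectionP => x; rewrite /= germ_res. Qed.

Definition sheaf_unit : presheaf_map F sheafify :=
  @PresheafMap X F sheafify (fun U => @sheaf_unit_fun U) sheaf_unit_res.
End Sheafification.

Section SheafifyMap.
Variables (X : topologicalType) (F G : presheaf X) (eta : presheaf_map F G).

Definition stalk_map (x : X) (g : stalk F x) : stalk G x :=
  \pi_(stalk G x) (GermRep (gr_in (repr g)) (eta _ (gr_sec (repr g)))).

Lemma stalk_map_germ (U : opens X) (x : set_type U) (s : F U) :
  stalk_map (germ x s) = germ x (eta U s).
Proof.
have /stalk_eqP[W [hs [ht [Wx e]]]] := reprK (germ x s).
apply: (@stalk_eq _ G (val x)
  (GermRep (gr_in (repr (germ x s))) (eta _ (gr_sec (repr (germ x s)))))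
  (GermRep (set_mem (valP x)) (eta U s)) W hs ht Wx).
by rewrite /= -!pm_res; congr (eta _ _).
Qed.

Fact stalk_map_zmod (x : X) : zmod_morphism (@stalk_map x).
Proof.
move=> g h; have [U [Ux [s ->]]] := germ_surj g; have [V [Vx [t ->]]] := germ_surj h.
have h1 : opensI U V `<=` U by move=> y [].
have h2 : opensI U V `<=` V by move=> y [].
pose x' : set_type (opensI U V) := exist _ x (mem_set (conj Ux Vx)).
have -> : germ (exist _ x (mem_set Ux)) s = germ x' (res F h1 s) :> stalk F x.
  rewrite germ_res; congr (\pi_(stalk F x) (GermRep _ s)); exact: Prop_irrelevance.
have -> : germ (exist _ x (mem_set Vx)) t = germ x' (res F h2 t) :> stalk F x.
  rewrite germ_res; congr (\pi_(stalk F x) (GermRep _ t)); exact: Prop_irrelevance.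
have := stalk_map_germ x' (res F h1 s - res F h2 t).
rewrite !raddfB /= => ->.
congr (_ - _); symmetry.
  exact: (stalk_map_germ x' (res F h1 s)).
exact: (stalk_map_germ x' (res F h2 t)).
Qed.
HB.instance Definition _ (x : X) :=
  GRing.isZmodMorphism.Build (stalk F x) (stalk G x) (@stalk_map x) (@stalk_map_zmod x).

Fact sheafify_map_subproof (U : opens X) (s : sheafify F U) :
  ((fun x => stalk_map (ss_val s x)) : dprod (fun x : set_type U => stalk G (val x)))
    \in @is_sheaf_section _ G U.
Proof.
apply/is_sheaf_sectionP => x; have /is_sheaf_sectionP hs := ss_valP s.
have [V [hV [t [Vx e]]]] := hs x; exists V, hV, (eta V t); split=> // y.
exact: (etrans (congr1 (@stalk_map (val y)) (e y)) (stalk_map_germ y t)).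
Qed.

Definition sheafify_map_fun (U : opens X) (s : sheafify F U) : sheafify G U :=
  SheafSection (sheafify_map_subproof s).

Fact sheafify_map_zmod (U : opens X) : zmod_morphism (@sheafify_map_fun U).
Proof. by move=> s t; apply: sheaf_sectionP => x; rewrite /= raddfB. Qed.
HB.instance Definition _ (U : opens X) :=
  GRing.isZmodMorphism.Build (sheafify F U) (sheafify G U)
    (@sheafify_map_fun U) (@sheafify_map_zmod U).

Fact sheafify_map_res (U V : opens X) (h : V `<=` U) (s : sheafify F U) :
  sheafify_map_fun (res (sheafify F) h s) = res (sheafify G) h (sheafify_map_fun s).
Proof. exact: sheaf_sectionP. Qed.

Definition sheafify_map : presheaf_map (sheafify F) (sheafify G) :=
  @PresheafMap X (sheafify F) (sheafify G)
    (fun U => @sheafify_map_fun U) sheafify_map_res.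
End SheafifyMap.

Lemma sheafify_map_unit (X : topologicalType) (F G : presheaf X)
    (eta : presheaf_map F G) (U : opens X) (s : F U) :
  sheafify_map eta U (sheaf_unit F U s) = sheaf_unit G U (eta U s).
Proof. by apply: sheaf_sectionP => x /=; exact: stalk_map_germ. Qed.

Section SheafifyComplex.
Variables (X : topologicalType) (P : presheaf_complex X).

Fact sheafify_dif_dif k (U : opens X) (s : sheafify (P k) U) :
  sheafify_map (pc_dif P k.+1) U (sheafify_map (pc_dif P k) U s) = 0.
Proof.
apply: sheaf_sectionP => x /=.
have [V [Vx [t ->]]] := germ_surj (ss_val s x).
pose x' : set_type V := exist _ (val x) (mem_set Vx).
have e1 := stalk_map_germ (pc_dif P k) x' t.
rewrite [X in stalk_map _ X]e1.
have e2 := stalk_map_germ (pc_dif P k.+1) x' (pc_dif P k V t).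
by rewrite [LHS]e2 pc_dif_dif raddf0.
Qed.

Definition sheafify_complex : presheaf_complex X :=
  @PresheafComplex X (fun k => sheafify (P k)) (fun k => sheafify_map (pc_dif P k))
    sheafify_dif_dif.
End SheafifyComplex.

Lemma set_type_continuous (Y Z : topologicalType) (A : set Z) (f : Y -> set_type A) :
  continuous (fun y => val (f y)) -> continuous f.
Proof.
move=> /continuousP h; apply/continuousP => _ [B oB <-].
by rewrite -comp_preimage; exact: h.
Qed.

Lemma val_continuous (Z : topologicalType) (A : set Z) :
  continuous (val : set_type A -> Z).
Proof. exact: initial_continuous. Qed.

Lemma incl_continuous (X : topologicalType) (U V : set X) (h : V `<=` U) :
  continuous (incl h).
Proof. by apply: set_type_continuous; exact: val_continuous. Qed.
HB.instance Definition _ (X : topologicalType) (U V : set X) (h : V `<=` U) :=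
  isContinuous.Build (set_type V) (set_type U) (incl h) (@incl_continuous X U V h).

Definition sub_val (X : topologicalType) (U : set X) (x : set_type U) : X := val x.
HB.instance Definition _ (X : topologicalType) (U : set X) :=
  isContinuous.Build (set_type U) X (@sub_val X U) (@val_continuous X U).

Section StandardSimplex.
Variable R : realType.

Definition simplex_set (k : nat) : set 'rV[R]_k.+1 :=
  [set p | (forall i, 0 <= p 0 i) /\ \sum_i p 0 i = 1].
Arguments simplex_set : clear implicits.

Definition simplex (k : nat) : topologicalType := set_type (simplex_set k).

Definition bary k (p : simplex k) (i : 'I_k.+1) : R := val p 0 i.

Lemma bary_ge0 k (p : simplex k) i : 0 <= bary p i.
Proof. by have /set_mem[h _] := valP p; exact: h. Qed.

Lemma bary_sum1 k (p : simplex k) : \sum_i bary p i = 1.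
Proof. by have /set_mem[_] := valP p. Qed.

Lemma bary_inj k (p q : simplex k) : bary p =1 bary q -> p = q.
Proof. by move=> h; apply/val_inj/rowP. Qed.

Lemma bary_continuous k (i : 'I_k.+1) : continuous (fun p : simplex k => bary p i).
Proof.
move=> p; apply: (@continuous_comp _ _ _
  (fun q : simplex k => val q) (fun M : 'rV[R]_k.+1 => M 0 i)).
  exact: val_continuous.
exact: coord_continuous.
Qed.

Lemma simplex_continuous (Y : topologicalType) n (f : Y -> simplex n) :
  (forall j, continuous (fun y => bary (f y) j)) -> continuous f.
Proof.
move=> c; apply: set_type_continuous => y A [P nP PA].
suff: \forall z \near y, forall ij : 'I_1 * 'I_n.+1, P ij.1 ij.2 (val (f z) ij.1 ij.2).
  by apply: filterS => z h; apply: PA => i j; exact: (h (i, j)).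
apply: (@filter_forall _ _ (fun ij z => P ij.1 ij.2 (val (f z) ij.1 ij.2))
  (nbhs y)) => -[i j]; rewrite /= [i]ord1 /=.
exact: (c j y) (nP 0 j).
Qed.

Section Push.
Variables (m n : nat) (f : 'I_m.+1 -> 'I_n.+1).

Fact simplex_map_subproof (p : simplex m) :
  (\row_j \sum_(i | f i == j) bary p i) \in simplex_set n.
Proof.
apply/mem_set; split=> [j|]; first by rewrite mxE sumr_ge0 // => i _; exact: bary_ge0.
under eq_bigr do rewrite mxE.
by rewrite -[RHS](bary_sum1 p) [RHS](partition_big f xpredT).
Qed.

(* The affine map sending the vertex [i] to the vertex [f i]. *)
Definition simplex_map (p : simplex m) : simplex n :=
  exist (fun q => q \in simplex_set n) _ (simplex_map_subproof p).

Lemma simplex_mapE p j : bary (simplex_map p) j = \sum_(i | f i == j) bary p i.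
Proof. by rewrite /bary /= mxE. Qed.

Lemma simplex_map_continuous : continuous simplex_map.
Proof.
apply: simplex_continuous => j.
under [X in continuous X]eq_fun do rewrite simplex_mapE.
apply: (continuous_big (op := +%R)); first exact: add_continuous.
by move=> l _; exact: bary_continuous.
Qed.
HB.instance Definition _ :=
  isContinuous.Build (simplex m) (simplex n) simplex_map simplex_map_continuous.
End Push.

Lemma simplex_map_comp l m n (f : 'I_m.+1 -> 'I_n.+1) (g : 'I_l.+1 -> 'I_m.+1) p :
  simplex_map f (simplex_map g p) = simplex_map (f \o g) p.
Proof.
apply: bary_inj => j; rewrite !simplex_mapE.
under eq_bigr do rewrite simplex_mapE.
rewrite (exchange_big_dep xpredT) //= [RHS]big_mkcond /=.
apply: eq_bigr => i _; case: (altP (f (g i) =P j)) => [e|ne].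
  by rewrite (big_pred1 (g i)) // => y /=; rewrite [RHS]eq_sym; case: (g i =P y) => [<-|_]; rewrite ?andbF ?e ?eqxx.
by rewrite big1 // => y /andP[/eqP e /eqP gy]; move: ne; rewrite gy e eqxx.
Qed.

Fact vertex_subproof : const_mx 1 \in simplex_set 0.
Proof.
apply/mem_set; split=> [i|]; first by rewrite mxE.
by rewrite big_ord1 mxE.
Qed.
Definition vertex : simplex 0 := exist (fun q => q \in simplex_set 0) _ vertex_subproof.

Section Segment.
Variables (k : nat) (p q : simplex k).
Definition clamp (t : R) : R := Num.min 1 (Num.max 0 t).

Fact clamp_ge0 t : 0 <= clamp t. Proof. by rewrite le_min ler01 le_max lexx. Qed.
Fact clamp_le1 t : clamp t <= 1. Proof. by rewrite ge_min lexx. Qed.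
Fact clamp_continuous : continuous clamp.
Proof.
move=> t; apply: continuous_min; first exact: cst_continuous.
by apply: continuous_max; [exact: cst_continuous|].
Qed.

Fact segment_subproof t :
  (\row_j ((1 - clamp t) * bary p j + clamp t * bary q j)) \in simplex_set k.
Proof.
apply/mem_set; split=> [i|].
  rewrite mxE addr_ge0 // mulr_ge0 ?bary_ge0 ?clamp_ge0 //.
  by rewrite subr_ge0 clamp_le1.
under eq_bigr do rewrite mxE.
by rewrite big_split /= -!mulr_sumr !bary_sum1 !mulr1 subrK.
Qed.
Definition segment t : simplex k :=
  exist (fun q => q \in simplex_set k) _ (segment_subproof t).

Fact segment_continuous : continuous segment.
Proof.
apply: simplex_continuous => j.
under [X in continuous X]eq_fun do rewrite /bary /= mxE.
move=> t; apply: (@cvgD _ R^o); apply: cvgM; try exact: cvg_cst.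
  apply: (@cvgB _ R^o); first exact: cvg_cst.
  exact: clamp_continuous.
exact: clamp_continuous.
Qed.

Fact segment0 : segment 0 = p.
Proof.
apply: bary_inj => j; rewrite {1}/bary /= mxE /clamp maxxx (min_idPr ler01).
by rewrite subr0 mul1r mul0r addr0.
Qed.
Fact segment1 : segment 1 = q.
Proof.
apply: bary_inj => j; rewrite {1}/bary /= mxE /clamp (max_idPr ler01) minxx.
by rewrite subrr mul1r mul0r add0r.
Qed.
End Segment.

Definition locally_constant (Y : topologicalType) (T : Type) (f : Y -> T) : Prop :=
  forall x, \forall y \near x, f y = f x.

Lemma locally_constant_simplex (Y : topologicalType) (T : Type) (f : Y -> T) k
    (s : simplex k -> Y) (p q : simplex k) :
  locally_constant f -> continuous s -> f (s p) = f (s q).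
Proof.
move=> hf cs; pose g t := f (s (segment p q t)).
have hg : locally_constant g.
  move=> t; have c : {for t, continuous (fun t => s (segment p q t))}.
    by apply: continuous_comp; [exact: segment_continuous|exact: cs].
  exact: c (hf _).
have opn (B : set T) : open (g @^-1` B).
  rewrite openE => t Bt; rewrite /interior /=; apply: filterS (hg t) => u e.
  by rewrite /= e.
have : connected [set: R] by apply/connected_intervalP.
move=> /(_ (g @^-1` [set g 0])) h.
have : g @^-1` [set g 0] = [set: R].
  apply: h; first by exists 0.
  - by exists (g @^-1` [set g 0]); rewrite ?setTI.
  - exists (g @^-1` [set g 0]); rewrite ?setTI //.
    rewrite -[X in closed X]setCK; apply: open_closedC.
    exact: (opn (~` [set g 0])).
move=> /seteqP[_ /(_ 1 I)] /=; rewrite /g segment0 segment1 => ->.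
by [].
Qed.
End StandardSimplex.

Section LiftLift.
Lemma lift_lift n (i j : 'I_n.+2) (m : 'I_n.+1) : (i <= j)%N ->
  lift (lift ord0 j) (lift i m) =
  lift (widen_ord (leqnSn n.+2) i) (lift j m) :> 'I_n.+3.
Proof.
move=> ij; apply: val_inj; rewrite /= /bump /=.
case: (leqP i m) => im; case: (leqP j m) => jm /=; rewrite ?add0n ?add1n ?ltnS.
- by rewrite jm (leqW im).
- by rewrite leqNgt jm im.
- by have := leq_trans ij jm; rewrite leqNgt im.
- by rewrite leqNgt ltnS (ltnW jm) /= leqNgt im.
Qed.
End LiftLift.

Section Singular.
Variables (R : realType) (Y : topologicalType).

Definition sing (k : nat) : Type := continuousType (simplex R k) Y.

Definition sing_face k (l : 'I_k.+2) (s : sing k.+1) : sing k :=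
  s \o simplex_map (lift l).

Definition sing_cochain (k : nat) : zmodType := (sing k -> int).

(* Sign convention: the coboundary of [alpha] is [- (alpha \o boundary)].
   Cocycles, coboundaries and cohomology groups do not depend on this overall
   sign, but the comparison with Cech cohomology through the total complex with
   differential [dh + (-1)^a dv] does, by a factor [(-1)^k] in degree [k]: the
   formula [alpha |-> (-1)^k alpha (iota \o (x_i0 ... x_ik))] holds for this
   sign, and [alpha |-> alpha (iota \o (x_i0 ... x_ik))] for the opposite one. *)
Definition sing_dif k (alpha : sing_cochain k) : sing_cochain k.+1 :=
  fun s => - \sum_(l < k.+2) alpha (sing_face l s) *~ (-1) ^+ l.

Fact sing_dif_zmod k : zmod_morphism (@sing_dif k).
Proof.
move=> a b; apply/funext => s; rewrite /sing_dif /= !fctE -opprD; congr (- _).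
by rewrite -sumrB; apply: eq_bigr => l _; rewrite mulrzBl.
Qed.
HB.instance Definition _ k := GRing.isZmodMorphism.Build
  (sing_cochain k) (sing_cochain k.+1) (@sing_dif k) (@sing_dif_zmod k).

Fact sing_dif_dif k (alpha : sing_cochain k) : sing_dif (sing_dif alpha) = 0.
Proof.
apply/funext => s; rewrite /sing_dif.
have := @alternating_sum2 int k.+2 (fun l m => alpha (sing_face m (sing_face l s))).
move=> h; under eq_bigr do rewrite mulNrz.
rewrite sumrN opprK h // => i j ij; congr (alpha _).
apply/continuousEP => p; rewrite /sing_face /= !simplex_map_comp.
by congr (s (simplex_map _ _)); apply/funext => m; exact: lift_lift.
Qed.

Definition singular_complex : cochain_complex :=
  @CochainComplex sing_cochain (fun k => @sing_dif k) sing_dif_dif.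
End Singular.

Section SingularPullback.
Variables (R : realType) (Y Z : topologicalType) (f : continuousType Y Z) (k : nat).

Definition sing_pull (alpha : sing_cochain R Z k) : sing_cochain R Y k :=
  fun s => alpha (f \o s).

Fact sing_pull_zmod : zmod_morphism sing_pull. Proof. by []. Qed.
HB.instance Definition _ := GRing.isZmodMorphism.Build
  (sing_cochain R Z k) (sing_cochain R Y k) sing_pull sing_pull_zmod.
End SingularPullback.

Lemma sing_pull_dif (R : realType) (Y Z : topologicalType) (f : continuousType Y Z)
    k (alpha : sing_cochain R Z k) :
  sing_pull f (sing_dif alpha) = sing_dif (sing_pull f alpha).
Proof.
apply/funext => s; rewrite /sing_pull /sing_dif; congr (- _).
apply: eq_bigr => l _; congr (alpha _ *~ _); exact/continuousEP.
Qed.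

Section SingularPresheaf.
Variables (R : realType) (X : topologicalType).

Definition sing_sections (k : nat) (U : opens X) : zmodType :=
  sing_cochain R (set_type U) k.

Definition sing_res k (U V : opens X) (h : V `<=` U) :
  {additive sing_sections k U -> sing_sections k V} := @sing_pull R _ _ (incl h) k.

Fact sing_res_id k (U : opens X) (h : U `<=` U) (a : sing_sections k U) :
  sing_res k h a = a.
Proof.
apply/funext => s; congr (a _); apply/continuousEP => p /=; exact: val_inj.
Qed.

Fact sing_res_res k (U V W : opens X) (hVU : V `<=` U) (hWV : W `<=` V)
    (hWU : W `<=` U) (a : sing_sections k U) :
  sing_res k hWV (sing_res k hVU a) = sing_res k hWU a.
Proof.
apply/funext => s; congr (a _); apply/continuousEP => p /=; exact: val_inj.
Qed.

Definition sing_presheaf (k : nat) : presheaf X :=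
  @Presheaf X (sing_sections k) (@sing_res k) (@sing_res_id k) (@sing_res_res k).

Definition sing_presheaf_dif (k : nat) :
    presheaf_map (sing_presheaf k) (sing_presheaf k.+1) :=
  @PresheafMap X (sing_presheaf k) (sing_presheaf k.+1)
    (fun U => @sing_dif R (set_type U) k)
    (fun U V h s => esym (sing_pull_dif (incl h) s)).

Definition sing_presheaf_complex : presheaf_complex X :=
  @PresheafComplex X sing_presheaf sing_presheaf_dif
    (fun k U s => sing_dif_dif s).

Definition sheaf_sing_complex : presheaf_complex X :=
  sheafify_complex sing_presheaf_complex.

Definition sheafification_fun k (alpha : singular_complex R X k) :
    sections_complex sheaf_sing_complex (opensT X) k :=
  sheaf_unit (sing_presheaf k) (opensT X) (@sing_pull R _ _ (@sub_val X setT) k alpha).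

Fact sheafification_zmod k : zmod_morphism (@sheafification_fun k).
Proof. by move=> a b; rewrite /sheafification_fun !raddfB. Qed.
HB.instance Definition _ k := GRing.isZmodMorphism.Build
  (singular_complex R X k) (sections_complex sheaf_sing_complex (opensT X) k)
  (@sheafification_fun k) (@sheafification_zmod k).

Fact sheafification_dif k (alpha : singular_complex R X k) :
  sheafification_fun (dif (singular_complex R X) alpha) =
  dif (sections_complex sheaf_sing_complex (opensT X)) (sheafification_fun alpha).
Proof.
rewrite [RHS](sheafify_map_unit (sing_presheaf_dif k)).
by rewrite /sheafification_fun /= sing_pull_dif.
Qed.

Definition sheafification :
    chain_map (singular_complex R X) (sections_complex sheaf_sing_complex (opensT X)) :=
  @ChainMap _ (sections_complex sheaf_sing_complex (opensT X))
    (fun k => @sheafification_fun k) sheafification_dif.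
End SingularPresheaf.

Section ConstantSheaf.
Variable X : topologicalType.

Section Sections.
Variable U : opens X.

Definition is_locally_constant : {pred (set_type U -> int)} :=
  [pred f | `[< locally_constant f >]].

Lemma is_locally_constantP f :
  reflect (locally_constant f) (f \in is_locally_constant).
Proof. exact: asboolP. Qed.

Fact is_locally_constant_zmod : zmod_closed is_locally_constant.
Proof.
split=> [|f g /is_locally_constantP hf /is_locally_constantP hg].
  by apply/is_locally_constantP => x; apply: filterE.
apply/is_locally_constantP => x; apply: filterS2 (hf x) (hg x) => y e e'.
by rewrite !fctE e e'.
Qed.
HB.instance Definition _ := GRing.isZmodClosed.Build (set_type U -> int)
  is_locally_constant is_locally_constant_zmod.

Record constant_section := ConstantSection {
  cs_fun : set_type U -> int;
  cs_funP : cs_fun \in is_locally_constant }.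
HB.instance Definition _ := [isSub for cs_fun].
HB.instance Definition _ := [Choice of constant_section by <:].
HB.instance Definition _ := [SubChoice_isSubZmodule of constant_section by <:].

Fact integer_section_subproof (n : int) :
  (fun _ : set_type U => n) \in is_locally_constant.
Proof. by apply/is_locally_constantP => x; apply: filterE. Qed.

Definition integer_section (n : int) : constant_section :=
  ConstantSection (integer_section_subproof n).

Fact integer_section_zmod : zmod_morphism integer_section.
Proof. by move=> m n; exact: val_inj. Qed.
HB.instance Definition _ := GRing.isZmodMorphism.Build int constant_section
  integer_section integer_section_zmod.
End Sections.

Fact constant_res_subproof (U V : opens X) (h : V `<=` U) (f : constant_section U) :
  cs_fun f \o incl h \in @is_locally_constant V.
Proof.
apply/is_locally_constantP => x; have /is_locally_constantP hf := cs_funP f.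
exact: (@incl_continuous _ _ _ h x) (hf (incl h x)).
Qed.
Definition constant_res (U V : opens X) (h : V `<=` U) (f : constant_section U) :
  constant_section V := ConstantSection (constant_res_subproof h f).

Fact constant_res_zmod (U V : opens X) (h : V `<=` U) :
  zmod_morphism (constant_res h).
Proof. by move=> f g; exact: val_inj. Qed.
HB.instance Definition _ (U V : opens X) (h : V `<=` U) :=
  GRing.isZmodMorphism.Build (constant_section U) (constant_section V)
    (constant_res h) (constant_res_zmod h).

Fact constant_res_id (U : opens X) (h : U `<=` U) f : constant_res h f = f.
Proof.
apply: val_inj; apply/funext => x; congr (cs_fun f _); exact: val_inj.
Qed.
Fact constant_res_res (U V W : opens X) (hVU : V `<=` U) (hWV : W `<=` V)
    (hWU : W `<=` U) f :
  constant_res hWV (constant_res hVU f) = constant_res hWU f.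
Proof.
apply: val_inj; apply/funext => x; congr (cs_fun f _); exact: val_inj.
Qed.

Definition constant_sheaf : presheaf X :=
  @Presheaf X (fun U => constant_section U) (fun U V h => constant_res h)
    constant_res_id constant_res_res.

Variable R : realType.

Definition constant_cochain (U : opens X) (f : constant_section U) :
    sing_presheaf R X 0 U :=
  fun s => cs_fun f (s (vertex R)).

Fact constant_cochain_zmod (U : opens X) : zmod_morphism (@constant_cochain U).
Proof. by []. Qed.
HB.instance Definition _ (U : opens X) := GRing.isZmodMorphism.Build
  (constant_section U) (sing_presheaf R X 0 U) (@constant_cochain U)
  (@constant_cochain_zmod U).

Fact constant_cochain_dif (U : opens X) (f : constant_section U) :
  sing_dif (constant_cochain f) = 0.
Proof.
apply/funext => s; rewrite /sing_dif big_ord_recl big_ord1 /=.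
have /is_locally_constantP hf := cs_funP f.
rewrite /constant_cochain /sing_face /= expr0 expr1 mulrNz.
rewrite (locally_constant_simplex _ (simplex_map (lift (lift ord0 ord0)) (vertex R))
  hf (@cts_fun _ _ s)).
by rewrite subrr oppr0.
Qed.

Definition constant_unit_fun (U : opens X) (f : constant_sheaf U) :
    sheaf_sing_complex R X 0 U :=
  sheaf_unit (sing_presheaf R X 0) U (constant_cochain f).

Fact constant_unit_zmod (U : opens X) : zmod_morphism (@constant_unit_fun U).
Proof. by move=> f g; rewrite /constant_unit_fun !raddfB. Qed.
HB.instance Definition _ (U : opens X) := GRing.isZmodMorphism.Build
  (constant_sheaf U) (sheaf_sing_complex R X 0 U) (@constant_unit_fun U)
  (@constant_unit_zmod U).

Fact constant_unit_res (U V : opens X) (h : V `<=` U) (f : constant_sheaf U) :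
  constant_unit_fun (res constant_sheaf h f) =
  res (sheaf_sing_complex R X 0) h (constant_unit_fun f).
Proof. by rewrite /constant_unit_fun -pm_res. Qed.

Definition constant_unit : presheaf_map constant_sheaf (sheaf_sing_complex R X 0) :=
  @PresheafMap X constant_sheaf (sheaf_sing_complex R X 0)
    (fun U => @constant_unit_fun U) constant_unit_res.

Lemma constant_unit_dif (U : opens X) (f : constant_sheaf U) :
  pc_dif (sheaf_sing_complex R X) 0 U (constant_unit U f) = 0.
Proof.
rewrite [LHS](sheafify_map_unit (sing_presheaf_dif R X 0)).
by rewrite [X in sheaf_unit _ _ X]constant_cochain_dif raddf0.
Qed.
End ConstantSheaf.

Section Homotopy.
Variable R : realType.

Definition unit_interval : topologicalType := set_type `[0 : R, 1].

Fact unit_interval0 : (0 : R) \in (`[0, 1]%classic : set R).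
Proof. by rewrite inE /= in_itv /= lexx ler01. Qed.
Fact unit_interval1 : (1 : R) \in (`[0, 1]%classic : set R).
Proof. by rewrite inE /= in_itv /= lexx ler01. Qed.
Definition I0 : unit_interval := exist _ 0 unit_interval0.
Definition I1 : unit_interval := exist _ 1 unit_interval1.

Definition homotopic (Y Z : topologicalType) (f g : continuousType Y Z) : Prop :=
  exists H : continuousType (Y * unit_interval)%type Z,
    forall y, H (y, I0) = f y /\ H (y, I1) = g y.

Definition homotopy_equivalence (Y Z : topologicalType) (f : continuousType Y Z) : Prop :=
  exists g : continuousType Z Y, homotopic (g \o f) idfun /\ homotopic (f \o g) idfun.

Definition contractible (Y : topologicalType) : Prop :=
  exists y : Y, homotopic (@idfun Y) (cst y).

Definition semi_locally_contractible (X : topologicalType) : Prop :=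
  forall U : opens X, exists (J : Type) (W : J -> opens X),
    (U : set X) = \bigcup_j W j /\
    forall j, exists (h : W j `<=` U) (y : set_type U), homotopic (incl h) (cst y).
End Homotopy.

(* Hausdorff is part of paracompactness, as usual in sheaf theory. *)
Definition paracompact (X : topologicalType) : Prop :=
  hausdorff_space X /\
  forall (J : Type) (V : J -> opens X), \bigcup_j V j = [set: X] ->
  exists (K : Type) (W : K -> opens X),
    [/\ \bigcup_k W k = [set: X],
        forall k, exists j, W k `<=` V j &
        forall x : X, exists2 N : set X, nbhs x N &
          finite_set [set k | W k `&` N !=set0]].

Section Nerve.
Variables (X : topologicalType) (d : Order.disp_t) (I : orderType d) (U : I -> opens X).

Fact finite_inter_open k (v : 'I_k.+1 -> I) : open (\bigcap_l U (v l)).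
Proof.
rewrite openE => x h; rewrite /interior.
have : \forall y \near x, forall l, opens_set (U (v l)) y.
  apply: (@filter_forall _ _ (fun l => opens_set (U (v l))) (nbhs x)) => l.
  by apply: open_nbhs_nbhs; split; [exact: opens_open | exact: h].
by apply: filterS => y hy l _; exact: hy.
Qed.
Definition finite_inter k (v : 'I_k.+1 -> I) : opens X := Opens (finite_inter_open v).

Record nsimplex (k : nat) := NSimplex {
  vtx :> 'I_k.+1 -> I;
  vtx_lt : forall l m : 'I_k.+1, (l < m)%N -> (vtx l < vtx m)%O;
  vtx_inter : finite_inter vtx !=set0 }.

Definition ninter k (i : nsimplex k) : opens X := finite_inter i.

Lemma nsimplexP k (i j : nsimplex k) : vtx i = vtx j -> i = j.
Proof.
case: i j => [i hi ni] [j hj nj] /= e; case: j / e hj nj => hj nj.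
by congr NSimplex; exact: Prop_irrelevance.
Qed.

Section Face.
Variables (k : nat) (l : 'I_k.+2) (i : nsimplex k.+1).

Fact nface_lt (m n : 'I_k.+1) : (m < n)%N -> (i (lift l m) < i (lift l n))%O.
Proof.
move=> mn; apply: vtx_lt; rewrite /= /bump.
case: (leqP l m) => lm; first by rewrite (leq_trans lm (ltnW mn)) !add1n ltnS.
rewrite add0n; case: (leqP l n) => ln; rewrite ?add0n // add1n ltnS; exact: ltnW.
Qed.
Fact finite_inter_face : finite_inter i `<=` finite_inter (i \o lift l).
Proof. by move=> x h m _; exact: h. Qed.
Fact nface_inter : finite_inter (i \o lift l) !=set0.
Proof. by have [x h] := vtx_inter i; exists x; exact: finite_inter_face. Qed.
Definition nface : nsimplex k := @NSimplex k (i \o lift l) nface_lt nface_inter.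
Lemma ninter_face : ninter i `<=` ninter nface.
Proof. exact: finite_inter_face. Qed.
End Face.

Lemma nface_nface k (i j : 'I_k.+2) (s : nsimplex k.+2) : (i <= j)%N ->
  nface i (nface (lift ord0 j) s) = nface j (nface (widen_ord (leqnSn k.+2) i) s).
Proof.
move=> ij; apply: nsimplexP; apply/funext => m /=.
by rewrite lift_lift.
Qed.

Lemma ninter_cover k (i : nsimplex k) (l : 'I_k.+1) : ninter i `<=` U (i l).
Proof. by move=> x; exact. Qed.

Section Cech.
Variable F : presheaf X.

Definition cech_cochain (k : nat) : zmodType :=
  dprod (fun i : nsimplex k => F (ninter i)).

Definition cech_dif k (c : cech_cochain k) : cech_cochain k.+1 :=
  fun i => \sum_(l < k.+2) res F (@ninter_face k l i) (c (nface l i)) *~ (-1) ^+ l.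

Fact cech_dif_zmod k : zmod_morphism (@cech_dif k).
Proof.
move=> a b; apply: dprodP => i; rewrite dprodD dprodN /cech_dif -sumrB.
by apply: eq_bigr => l _; rewrite dprodD dprodN raddfB mulrzBl.
Qed.
HB.instance Definition _ k := GRing.isZmodMorphism.Build
  (cech_cochain k) (cech_cochain k.+1) (@cech_dif k) (@cech_dif_zmod k).

Lemma res_cech_eq k (W : opens X) (c : cech_cochain k) (i j : nsimplex k)
    (hi : W `<=` ninter i) (hj : W `<=` ninter j) :
  i = j -> res F hi (c i) = res F hj (c j).
Proof.
by move=> e; case: j / e hj => hj; congr (res F _ _); exact: Prop_irrelevance.
Qed.

Fact cech_dif_dif k (c : cech_cochain k) : cech_dif (cech_dif c) = 0.
Proof.
apply: dprodP => s; rewrite dprod0 /cech_dif.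
have hs l m : ninter s `<=` ninter (nface m (nface l s)).
  by apply: subset_trans (@ninter_face _ m _); exact: ninter_face.
rewrite -[RHS](@alternating_sum2 _ k.+2
  (fun l m => res F (hs l m) (c (nface m (nface l s))))).
  apply: eq_bigr => l _; congr (_ *~ _); rewrite raddf_sum; apply: eq_bigr => m _.
  by rewrite raddfMz (res_res _ _ (hs l m)).
by move=> i j ij; apply: res_cech_eq; exact: nface_nface.
Qed.

Definition cech_complex : cochain_complex :=
  @CochainComplex cech_cochain (fun k => @cech_dif k) cech_dif_dif.
End Cech.

Section CechMap.
Variables (F G : presheaf X) (eta : presheaf_map F G) (k : nat).

Definition cech_map (c : cech_cochain F k) : cech_cochain G k :=
  fun i => eta _ (c i).

Fact cech_map_zmod : zmod_morphism cech_map.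
Proof. by move=> a b; apply: dprodP => i; rewrite /cech_map !dprodD !dprodN raddfB. Qed.
HB.instance Definition _ := GRing.isZmodMorphism.Build
  (cech_cochain F k) (cech_cochain G k) cech_map cech_map_zmod.
End CechMap.

Lemma cech_map_dif (F G : presheaf X) (eta : presheaf_map F G) k (c : cech_cochain F k) :
  cech_map eta (cech_dif c) = cech_dif (cech_map eta c).
Proof.
apply: dprodP => i; rewrite /cech_map /cech_dif raddf_sum.
by apply: eq_bigr => l _; rewrite raddfMz pm_res.
Qed.

Section CechDouble.
Variable P : presheaf_complex X.

Fact cech_dv_dv a b (c : cech_cochain (P b) a) :
  cech_map (pc_dif P b.+1) (cech_map (pc_dif P b) c) = 0.
Proof. by apply: dprodP => i; exact: pc_dif_dif. Qed.

Definition cech_double : double_complex :=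
  @DoubleComplex (fun a b => cech_cochain (P b) a)
    (fun a b => @cech_dif (P b) a) (fun a b => @cech_map _ _ (pc_dif P b) a)
    (fun a b => @cech_dif_dif (P b) a) cech_dv_dv
    (fun a b c => esym (cech_map_dif (pc_dif P b) c)).

Definition cech_restrict b (s : P b (opensT X)) : cech_double 0 b :=
  fun i => res (P b) (opens_subT (U := ninter i)) s.

Fact cech_restrict_zmod b : zmod_morphism (@cech_restrict b).
Proof. by move=> s t; apply: dprodP => i; rewrite dprodD dprodN -raddfB. Qed.
HB.instance Definition _ b := GRing.isZmodMorphism.Build
  (P b (opensT X)) (cech_double 0 b) (@cech_restrict b) (@cech_restrict_zmod b).

Fact cech_restrict_dif b (s : P b (opensT X)) :
  cech_restrict (pc_dif P b (opensT X) s) = dv cech_double (cech_restrict s).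
Proof. by apply: dprodP => i; rewrite /cech_restrict -pm_res. Qed.

Fact cech_restrict_dh b (s : P b (opensT X)) : dh cech_double (cech_restrict s) = 0.
Proof.
apply: dprodP => i; rewrite dprod0 /= /cech_dif big_ord_recl big_ord1 /=.
rewrite /cech_restrict !(res_res _ _ (opens_subT (U := ninter i))) expr0 expr1 mulrNz.
by rewrite subrr.
Qed.

Definition cech_phi : chain_map (sections_complex P (opensT X)) (total_complex cech_double) :=
  @aug_v cech_double (sections_complex P (opensT X))
    (fun b => @cech_restrict b) cech_restrict_dif cech_restrict_dh.

Variables (F : presheaf X) (eta : presheaf_map F (P 0)).
Hypothesis eta_dif : forall V s, pc_dif P 0 V (eta V s) = 0.

Fact cech_eta_dv a (c : cech_cochain F a) :
  @dv cech_double a 0 (cech_map eta c) = 0.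
Proof. by apply: dprodP => i; exact: eta_dif. Qed.

Definition cech_psi : chain_map (cech_complex F) (total_complex cech_double) :=
  @aug_h cech_double (cech_complex F)
    (fun a => @cech_map F (P 0) eta a) (fun a c => cech_map_dif eta c) cech_eta_dv.
End CechDouble.

Section Realization.
Variable R : realType.

(* A point is encoded by its barycentric coordinates, one for each vertex. *)
Record nerve := Nerve {
  nerve_coord : I -> R;
  nerveP : exists k (i : nsimplex k) (p : simplex R k),
    nerve_coord = fun x => \sum_(l | i l == x) bary p l }.
HB.instance Definition _ := gen_eqMixin nerve.
HB.instance Definition _ := gen_choiceMixin nerve.

Fact nerve_simplex_subproof k (i : nsimplex k) (p : simplex R k) :
  exists k' (i' : nsimplex k') (p' : simplex R k'),
    (fun x => \sum_(l | i l == x) bary p l) =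
    fun x => \sum_(l | i' l == x) bary p' l.
Proof. by exists k, i, p. Qed.

Definition nerve_simplex k (i : nsimplex k) (p : simplex R k) : nerve :=
  Nerve (nerve_simplex_subproof i p).

(* The coherent topology: the final one for the maps [nerve_simplex i]. *)
Definition nerve_open (A : set nerve) : Prop :=
  forall k (i : nsimplex k), open (nerve_simplex i @^-1` A).

Fact nerve_openT : nerve_open setT.
Proof. by move=> k i; rewrite preimage_setT; exact: openT. Qed.
Fact nerve_openI : setI_closed nerve_open.
Proof. by move=> A B oA oB k i; rewrite preimage_setI; exact: openI. Qed.
Fact nerve_open_bigU (J : Type) (f : J -> set nerve) :
  (forall j, nerve_open (f j)) -> nerve_open (\bigcup_j f j).
Proof.
move=> h k i; rewrite preimage_bigcup; apply: bigcup_open => j _; exact: h.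
Qed.
HB.instance Definition _ :=
  isOpenTopological.Build nerve nerve_openT nerve_openI nerve_open_bigU.

Fact nerve_simplex_continuous k (i : nsimplex k) : continuous (nerve_simplex i).
Proof. by apply/continuousP => A; apply. Qed.
HB.instance Definition _ k (i : nsimplex k) := isContinuous.Build
  (simplex R k) nerve (nerve_simplex i) (@nerve_simplex_continuous k i).

Lemma nerve_simplex_face k (i : nsimplex k.+1) (l : 'I_k.+2) (p : simplex R k) :
  nerve_simplex i (simplex_map (lift l) p) = nerve_simplex (nface l i) p.
Proof.
have E (u v : nerve) : nerve_coord u = nerve_coord v -> u = v.
  case: u v => [u hu] [v hv] /= e; case: v / e hv => hv.
  by congr Nerve; exact: Prop_irrelevance.
apply: E; apply/funext => x /=.
under eq_bigr do rewrite simplex_mapE.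
rewrite (exchange_big_dep xpredT) //= [RHS]big_mkcond /=.
apply: eq_bigr => m _; case: (altP (i (lift l m) =P x)) => [e|ne].
  rewrite (big_pred1 (lift l m)) // => y /=; rewrite [RHS]eq_sym.
  by case: (lift l m =P y) => [<-|_]; rewrite ?andbF ?e ?eqxx.
by rewrite big1 // => y /andP[/eqP e /eqP gy]; move: ne; rewrite gy e eqxx.
Qed.

Variable iota : continuousType nerve X.

Definition respects_cover : Prop :=
  forall m (i : nsimplex m) (p : simplex R m),
    (\bigcup_(l : 'I_m.+1) U (i l)) (iota (nerve_simplex i p)).

Definition nerve_cochain k (alpha : singular_complex R X k) :
    cech_complex (constant_sheaf X) k :=
  fun i => integer_section (ninter i) (alpha (iota \o nerve_simplex i)).

Fact nerve_cochain_cocycle k (alpha : cocycle (singular_complex R X) k) :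
  nerve_cochain (cocycle_val alpha) \in @is_cocycle (cech_complex (constant_sheaf X)) k.
Proof.
have h : sing_dif (cocycle_val alpha) = 0 by apply/eqP; exact: cocycleP alpha.
apply/eqP; apply: dprodP => i; rewrite dprod0.
have := congr1 (fun b : sing_cochain R X k.+1 => b (iota \o nerve_simplex i)) h.
rewrite /sing_dif => /eqP; rewrite oppr_eq0 => /eqP e.
transitivity (integer_section (ninter i) (\sum_(l < k.+2)
    cocycle_val alpha (sing_face l (iota \o nerve_simplex i)) *~ (-1) ^+ l)); last first.
  by rewrite [X in integer_section _ X]e raddf0.
rewrite raddf_sum; apply: eq_bigr => l _; rewrite raddfMz; congr (_ *~ _).
apply: val_inj; apply/funext => x; rewrite /= /nerve_cochain.
congr (cocycle_val alpha _); apply/continuousEP => p /=.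
by rewrite nerve_simplex_face.
Qed.

Definition nerve_cocycle k (alpha : cocycle (singular_complex R X) k) :
    cocycle (cech_complex (constant_sheaf X)) k :=
  Cocycle (nerve_cochain_cocycle alpha).
End Realization.
End Nerve.

Definition good_open_cover (R : realType) (X : topologicalType) (d : Order.disp_t)
    (I : orderType d) (U : I -> opens X) : Prop :=
  \bigcup_i U i = [set: X] /\
  forall k (i : nsimplex U k), contractible R (set_type (ninter i)).

Section SheafIso.
Variables (R : realType) (X : topologicalType) (d : Order.disp_t) (I : orderType d).
Variables (U : I -> opens X) (k : nat).

Definition phi_bar : cohomology (sections_complex (sheaf_sing_complex R X) (opensT X)) k ->
    cohomology (total_complex (cech_double U (sheaf_sing_complex R X))) k :=
  cohomology_map (cech_phi U (sheaf_sing_complex R X)) (k := k).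

Definition psi_bar : cohomology (cech_complex U (constant_sheaf X)) k ->
    cohomology (total_complex (cech_double U (sheaf_sing_complex R X))) k :=
  cohomology_map (cech_psi U (@constant_unit_dif X R)) (k := k).

(* [psi_bar^-1 \o phi_bar]; the default value 0 is not reached when [psi_bar]
   is surjective. *)
Definition sheaf_cohomology_iso
    (h : cohomology (sections_complex (sheaf_sing_complex R X) (opensT X)) k) :
    cohomology (cech_complex U (constant_sheaf X)) k :=
  xget 0 [set c | psi_bar c = phi_bar h].
End SheafIso.

(* Main.v *)
From HB Require Import structures.
From mathcomp Require Import all_boot all_order all_algebra.
From mathcomp Require Import all_classical reals topology normedtype sequences.
From mathcomp Require Import lra.
Require Import Defs.

(** Let [E] be the Cech double complex of sheafified singular cochains, [Epre]
   the one of plain singular cochains on the intersections [U_i], and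
   [tot_unit : Epre -> E] the sheafification map.  Both ends of the composition
   in the theorem lift to [Epre]: restriction of cochains [phi_pre] and inclusion
   of constants [psi_pre] satisfy
     [phi o sheafification = tot_unit o phi_pre] and [psi = tot_unit o psi_pre].
   So it is enough to show that all these maps are quasi-isomorphisms and that
   [phi_pre alpha] and [(-1)^k psi_pre (nerve_cochain alpha)] are cohomologous
   in [Epre].

   Quasi-isomorphisms.  A double complex with exact rows, augmented by a complex
   that maps onto the kernel of the first horizontal differential with an acyclic
   kernel, has the cohomology of that complex ([aug_v_bijective]; transposed,
   [aug_h_bijective]).
   - The rows of [Epre] are exact, since for each singular simplex the index of a
     member of the cover that contains it can be inserted ([sing_row_exact]).  The
     kernel of restriction consists of the cochains that vanish on small simplices
     and is acyclic by barycentric subdivision ([small_kernel]).  Hence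
     [phi_pre_bijective].
   - The columns of [Epre] are exact, since coning contracts the singular cochains
     of the contractible intersections.  Hence [psi_pre_bijective].
   - On a paracompact space there is a discontinuous partition of unity
     ([paracompact_selector]), which may cut cochains because cochains need not be
     continuous.  It makes the rows of [E] exact ([sheaf_row_exact]) and lifts each
     global section of the sheafification to a cochain ([sheafification_onto]).
     Hence [phi_bijective], and [phi_sing_bijective] for
     [phi o sheafification], where the kernel is again made of cochains that
     vanish on small simplices, now of a cover that depends on the cochain.
   Since [phi o sheafification] and [phi_pre] are quasi-isomorphisms, so is
   [tot_unit], and then so is [psi = tot_unit o psi_pre].  The columns of [E] are
   thereby avoided: the partition of unity would have to exist on the open
   sets [U_i], and paracompactness does not pass to open subsets.

   The formula.  It is an instance of acyclic carriers.  To a simplex [i] of the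
   nerve and a singular simplex [s] in [U_i] attach the star
   [U_(i_0) \cup ... \cup U_(i_a)].  It is acyclic by induction with
   Mayer-Vietoris, all intersections being contractible ([acyclic_star]).  It
   contains [s], and also [iota o (x_(i_0) ... x_(i_a))], because [iota] respects
   the cover.  Filling cycles in the stars, by recursion on the dimensions of [i]
   and [s], gives chains [homotopy i s] in the stars whose boundary is determined by the
   values on the faces and by the difference of [s] (if [i] is a vertex) and
   [(-1)^a iota o (x_(i_0) ... x_(i_a))] (if [s] is a point): see [homotopy_good].
   Evaluating the cocycle [alpha] on these chains yields the element of [Epre]
   whose differential is [phi_pre alpha - (-1)^k psi_pre (nerve_cochain alpha)].
   The sign [(-1)^k] appears because the singular differential is minus the
   alternating sum of faces, whereas the Cech differential is the alternating sum
   itself. *)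

Set Implicit Arguments.
Unset Strict Implicit.
Unset Printing Implicit Defensive.

Import Order.TTheory GRing.Theory Num.Theory.
Import numFieldNormedType.Exports.

Local Open Scope classical_set_scope.
Local Open Scope ring_scope.
Local Open Scope quotient_scope.

(** * Double complexes with exact rows or columns *)

Lemma dependent_choice_fun (I : Type) (T : I -> Type) (P : forall i, T i -> Prop) :
  (forall i, exists y, P i y) -> exists f : forall i, T i, forall i, P i (f i).
Proof. by move=> h; exists (fun i => sval (cid (h i))) => i; case: (cid (h i)). Qed.

Section Bicomplex.
Variable K : nat -> nat -> zmodType.
Variable d1 : forall a b, {additive K a b -> K a.+1 b}.
Variable d2 : forall a b, {additive K a b -> K a b.+1}.
Hypothesis d1d1 : forall a b x, d1 a.+1 b (d1 a b x) = 0.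
Hypothesis d2d2 : forall a b x, d2 a b.+1 (d2 a b x) = 0.
Hypothesis d1d2 : forall a b x, d1 a b.+1 (d2 a b x) = - d2 a.+1 b (d1 a b x).

(** Working with all positions (a, b) at once avoids transport along equations
   [a + b = n]; an element of the total complex becomes a family by extension by
   zero. *)
Definition family := forall a b, K a b.

Definition from_left (g : family) a b : K a b :=
  match a return K a b with 0 => 0 | a'.+1 => d1 a' b (g a' b) end.

Definition from_below (g : family) a b : K a b :=
  match b return K a b with 0 => 0 | b'.+1 => d2 a b' (g a b') end.

Definition family_dif (g : family) : family :=
  fun a b => from_left g a b + from_below g a b.

Lemma family_dif_dif g a b : family_dif (family_dif g) a b = 0.
Proof.
case: a b => [|a] [|b]; rewrite /family_dif /= ?addr0 ?add0r //.
- by case: b => [|b] /=; rewrite ?add0r ?raddf0 // d2d2.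
- by case: a => [|a] /=; rewrite ?addr0 ?raddf0 // d1d1.
rewrite !raddfD /= d1d2 -[d2 a.+1 b _ + _]addrC addrACA addNr addr0.
have -> : d1 a b.+1 (from_left g a b.+1) = 0.
  by case: a => [|a] /=; rewrite ?raddf0 ?d1d1.
by case: b => [|b] /=; rewrite ?raddf0 ?d2d2 addr0.
Qed.

Hypothesis row_exact : forall a b (x : K a.+1 b), d1 a.+1 b x = 0 ->
  exists y, x = d1 a b y.

(** The rows are exact, so [h] can be found by recursion on the row [b]: once the
   rows below are known, what is left of [g] in row [b] is closed for [d1], hence a
   [d1]-boundary.  In the column [a = 0], where exactness is not
   available, the remainder only comes out [d1]-closed. *)
Lemma row_solve (g : family) :
  (forall a b, family_dif g a.+1 b = 0) ->
  exists h : family, (forall a b, family_dif h a.+1 b = g a.+1 b) /\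
    forall b, d1 0 b (g 0 b - family_dif h 0 b) = 0.
Proof.
move=> Dg0.
pose fix h b : forall a, K a b := match b with
  | 0 => fun a => xget 0 [set y | g a.+1 0%N = d1 a 0 y]
  | b'.+1 => fun a => xget 0 [set y | g a.+1 b'.+1 - d2 _ _ (h b' a.+1) = d1 _ _ y]
  end.
pose H : family := fun a b => h b a.
have key b : forall a, d1 a b (g a b - from_below H a b) = 0 /\
    g a.+1 b - from_below H a.+1 b = d1 a b (H a b).
  elim: b => [|b IH] a.
    have cl a' : d1 a' 0 (g a' 0%N) = 0.
      by have := Dg0 a' 0%N; rewrite /family_dif /= addr0.
    rewrite /= !subr0; split; first exact: cl.
    exact: (xgetPex 0 (row_exact (cl a.+1))).
  have cl a' : d1 a' b.+1 (g a' b.+1 - from_below H a' b.+1) = 0.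
    rewrite /= raddfB /= d1d2 -(IH a').2 opprK raddfB /=.
    have -> : d2 a'.+1 b (from_below H a'.+1 b) = 0.
      by case: (b) => [|b'] /=; rewrite ?raddf0 ?d2d2.
    by rewrite subr0; have := Dg0 a' b.+1.
  split; first exact: cl.
  exact: (xgetPex 0 (row_exact (cl a.+1))).
exists H; split=> [a b|b].
  by rewrite /family_dif /= -(key b a).2 subrK.
by have := (key b 0%N).1; rewrite /family_dif add0r.
Qed.

Variable C : cochain_complex.
Variable eps : forall b, {additive C b -> K 0 b}.
Hypothesis eps_dif : forall b x, eps b.+1 (dif C x) = d2 0 b (eps b x).
Hypothesis eps_onto : forall b (x : K 0 b), d1 0 b x = 0 -> exists c, x = eps b c.
Hypothesis d1_eps : forall b x, d1 0 b (eps b x) = 0.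
Hypothesis ker_eps0 : forall x, eps 0 x = 0 -> dif C x = 0 -> x = 0.
Hypothesis ker_eps : forall b x, eps b.+1 x = 0 -> dif C x = 0 ->
  exists2 y, eps b y = 0 & x = dif C y.

Definition aug_family (z : forall b, C b) : family :=
  fun a b => match a return K a b with 0 => eps b (z b) | _ => 0 end.

(** By [row_solve], a closed [g] can be moved into the column [a = 0], where it
   comes from some [y].  The differential of [y] lies in the acyclic kernel of
   [eps], so a correction inside that kernel makes [y] closed. *)
Lemma aug_family_surj (g : family) : (forall a b, family_dif g a b = 0) ->
  exists z h, (forall b, dif C (z b) = 0) /\
    forall a b, g a b = family_dif h a b + aug_family z a b.
Proof.
move=> Dg; have [|h [hS h0]] := @row_solve g; first by move=> a b; exact: Dg.
have /dependent_choice_fun[y ey] : forall b, exists y, g 0 b - family_dif h 0 b = eps b y.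
  by move=> b; have [y ->] := eps_onto (h0 b); exists y.
have kdy b : eps b.+1 (dif C (y b)) = 0.
  rewrite eps_dif -ey; have := Dg 0 b.+1; rewrite {1}/family_dif add0r /= raddfB /= => ->.
  have := family_dif_dif h 0 b.+1; rewrite {1}/family_dif add0r /= => ->.
  by rewrite subr0.
have /dependent_choice_fun[u eu] : forall b, exists u, eps b u = 0 /\ dif C (y b) = dif C u.
  move=> b; have [|u u0 ->] := @ker_eps b (dif C (y b)) (kdy b); first exact: dif_dif.
  by exists u.
exists (fun b => y b - u b), h; split=> [b|[|a] b].
- by rewrite raddfB (eu b).2 subrr.
- by rewrite /= raddfB (eu b).1 subr0 -ey addrC subrK.
- by rewrite hS addr0.
Qed.

(** The same correction applied to a primitive of the image; the acyclic kernel of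
   [eps] replaces injectivity, which fails for the restriction of singular
   cochains to the members of a cover. *)
Lemma aug_family_inj (z : forall b, C b) (g : family) : (forall b, dif C (z b) = 0) ->
  (forall a b, aug_family z a b = family_dif g a b) ->
  z 0%N = 0 /\ exists y : forall b, C b, forall b, z b.+1 = dif C (y b).
Proof.
move=> cz ez; split.
  by apply: ker_eps0 => //; rewrite [LHS](ez 0%N 0%N) /family_dif addr0.
have [|h [hS h0]] := @row_solve g; first by move=> a b; rewrite -ez.
have /dependent_choice_fun[y ey] : forall b, exists y, g 0 b - family_dif h 0 b = eps b y.
  by move=> b; have [y ->] := eps_onto (h0 b); exists y.
have k b : eps b.+1 (z b.+1 - dif C (y b)) = 0.
  rewrite raddfB /= eps_dif -ey [X in X - _](ez 0%N b.+1) {1}/family_dif add0r /=.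
  have := family_dif_dif h 0 b.+1; rewrite {1}/family_dif add0r /= raddfB /= => ->.
  by rewrite subr0 subrr.
have /dependent_choice_fun[u eu] : forall b, exists u, z b.+1 - dif C (y b) = dif C u.
  move=> b; have [|u _ ->] := @ker_eps b _ (k b); last by exists u.
  by rewrite raddfB cz dif_dif subrr.
by exists (fun b => u b + y b) => b; rewrite raddfD -eu subrK.
Qed.
End Bicomplex.

Section ChainMapBijective.
Variables (C D : cochain_complex) (f : chain_map C D) (k : nat).

Lemma cohomology_classP (z w : cocycle C k) :
  cohomology_class z = cohomology_class w <->
  coboundary (cocycle_val z - cocycle_val w).
Proof.
rewrite /cohomology_class; split.
  by move/eqP; rewrite -Quotient.idealrBE => /is_coboundaryP.
by move=> h; apply/eqP; rewrite -Quotient.idealrBE; apply/is_coboundaryP.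
Qed.

Lemma cohomology_ind (P : cohomology C k -> Prop) :
  (forall z, P (cohomology_class z)) -> forall h, P h.
Proof. by move=> hP h; rewrite -[h]reprK; exact: hP. Qed.
End ChainMapBijective.

Lemma cohomology_map_bijective (C D : cochain_complex) (f : chain_map C D) k :
  (forall x : C k, dif C x = 0 -> coboundary (f k x) -> coboundary x) ->
  (forall y : D k, dif D y = 0 ->
    exists2 x : C k, dif C x = 0 & coboundary (y - f k x)) ->
  bijective (cohomology_map f (k := k)).
Proof.
move=> finj fsurj; rewrite -setTT_bijective; split=> // [|h _].
  move=> x y _ _; elim/cohomology_ind: x => x; elim/cohomology_ind: y => y.
  rewrite !cohomology_mapE => /cohomology_classP; rewrite -raddfB => h.
  apply/cohomology_classP; apply: finj h.
  by rewrite raddfB (eqP (cocycleP x)) (eqP (cocycleP y)) subrr.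
elim/cohomology_ind: h => y; have [x cx ex] := fsurj _ (eqP (cocycleP y)).
have zx : x \in @is_cocycle C k by exact/eqP.
exists (cohomology_class (Cocycle zx)) => //.
by rewrite cohomology_mapE; apply/esym/cohomology_classP.
Qed.

Section Total.
Variable K : double_complex.

Definition signed_dv_fun a b (x : K a b) : K a b.+1 := dv K x *~ (-1) ^+ a.

Fact signed_dv_zmod a b : zmod_morphism (@signed_dv_fun a b).
Proof. by move=> x y; rewrite /signed_dv_fun raddfB mulrzBl. Qed.
HB.instance Definition _ a b := GRing.isZmodMorphism.Build (K a b) (K a b.+1)
  (@signed_dv_fun a b) (@signed_dv_zmod a b).
Definition signed_dv a b : {additive K a b -> K a b.+1} := @signed_dv_fun a b.

Lemma signed_dvE a b (x : K a b) : signed_dv a b x = dv K x *~ (-1) ^+ a.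
Proof. by []. Qed.

Lemma signed_dv_dv a b x : signed_dv a b.+1 (signed_dv a b x) = 0.
Proof. by rewrite !signed_dvE raddfMz /= dv_dv !mul0rz. Qed.

Lemma dh_signed_dv a b x :
  dh K (signed_dv a b x) = - signed_dv a.+1 b (dh K x).
Proof. by rewrite !signed_dvE raddfMz /= dh_dv exprS mulN1r mulrNz opprK. Qed.

Definition tot_restrict (g : forall a b, K a b) n : tot K n :=
  fun p => g (ad1 p) (ad2 p).

Arguments tot_restrict : clear implicits.

(** The total complex indexes its components by antidiagonals; [tot_restrict] and
   [tot_extend] pass between it and families. *)
Definition tot_extend n (f : tot K n) a b : K a b :=
  match @eqP _ (a + b)%N n with
  | ReflectT e => f (Antidiagonal e)
  | ReflectF _ => 0
  end.

Lemma tot_extendK n (f : tot K n) : tot_restrict (tot_extend f) n = f.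
Proof.
apply: dprodP => -[a b e]; rewrite /tot_restrict /tot_extend /=.
by case: eqP => // e'; congr (f (Antidiagonal _)); exact: Prop_irrelevance.
Qed.

Definition tot_family_dif := family_dif (fun a b => dh K (a := a) (b := b)) signed_dv.

Lemma tot_dif_restrict g n :
  tot_dif (tot_restrict g n) = tot_restrict (tot_family_dif g) n.+1.
Proof.
apply: dprodP => -[[|a] [|b] e]; rewrite /tot_dif /tot_restrict /tot_family_dif /family_dif //=;
  by rewrite mul0rz.
Qed.

Lemma tot_dif_extend n (f : tot K n) a b :
  tot_family_dif (tot_extend f) a b = tot_extend (tot_dif f) a b.
Proof.
rewrite /tot_family_dif /family_dif /tot_extend.
case: eqP => [e|ne].
  rewrite /tot_dif /=; congr (_ + _).
    case: a e => [|a] e //=; case: eqP => [e'|]; last by case; case: e.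
    by congr (dh K (f (Antidiagonal _))); exact: Prop_irrelevance.
  case: b e => [|b] e //=; first by rewrite mul0rz.
  case: eqP => [e'|]; last by case; move: e; rewrite addnS => -[].
  rewrite signed_dvE; congr (dv K (f (Antidiagonal _)) *~ _); exact: Prop_irrelevance.
case: a ne => [|a] ne /=; case: b ne => [|b] ne //=; rewrite ?add0r ?addr0 //.
- by case: eqP => [e|]; rewrite ?raddf0 //; case: ne; rewrite -e.
- by case: eqP => [e|]; rewrite ?raddf0 //; case: ne; rewrite -e.
- case: eqP => [e|_]; first by case: ne; rewrite -e.
  by case: eqP => [e|]; rewrite ?raddf0 ?addr0 //; case: ne; rewrite -e addnS.
Qed.

Variable C : cochain_complex.

(** Turns one element into a family over all degrees; it stays closed. *)
Definition spread n (x : C n) m : C m :=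
  match @eqP _ m n with ReflectT e => cast_deg e x | ReflectF _ => 0 end.

Lemma spreadE n (x : C n) : spread x n = x.
Proof. by rewrite /spread; case: eqP => // e; rewrite (Prop_irrelevance e erefl). Qed.

Lemma spread_elim (Q : forall m, C m -> Prop) n (x : C n) m :
  Q n x -> (forall m, Q m 0) -> Q m (spread x m).
Proof. by rewrite /spread; case: eqP => [e|_ _]; [case: n / e x|exact]. Qed.

Lemma spread_closed n (x : C n) m : dif C x = 0 -> dif C (spread x m) = 0.
Proof.
by rewrite /spread; case: eqP => [e|] h; rewrite ?raddf0 //; case: n / e x h.
Qed.

(** Reduces a quasi-isomorphism into a total complex to statements on families, in
   which no degree occurs. *)
Lemma total_map_bijective (f : chain_map C (total_complex K))
    (F : (forall b, C b) -> forall a b, K a b) n :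
  (forall z, f n (z n) = tot_restrict (F z) n) ->
  (forall x a b, tot_extend (f n x) a b = F (spread x) a b) ->
  (forall z g, (forall b, dif C (z b) = 0) ->
    (forall a b, F z a b = tot_family_dif g a b) ->
    z 0%N = 0 /\ exists y : forall b, C b, forall b, z b.+1 = dif C (y b)) ->
  (forall g, (forall a b, tot_family_dif g a b = 0) ->
    exists z h, (forall b, dif C (z b) = 0) /\
      forall a b, g a b = tot_family_dif h a b + F z a b) ->
  bijective (cohomology_map f (k := n)).
Proof.
move=> fE fX Finj Fsurj.
have D0 a b : tot_family_dif (fun _ _ => 0) a b = 0.
  by case: a b => [|a] [|b]; rewrite /tot_family_dif /family_dif /= ?raddf0 ?addr0.
have X0 m a b : tot_extend (0 : tot K m) a b = 0 by rewrite /tot_extend; case: eqP.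
apply: cohomology_map_bijective => [x cx|y cy].
  have fam g : (forall a b, F (spread x) a b = tot_family_dif g a b) -> coboundary x.
    move=> /Finj[|x0 [y ey]]; first by move=> b; exact: spread_closed.
    rewrite -(spreadE x); case: (n) x {cx} x0 ey => [|n'] x x0 ey /=.
      by rewrite -x0.
    by exists (y n'); rewrite -ey.
  have cob (y : tot K n) : coboundary (y : total_complex K n) ->
      exists g, forall a b, tot_extend y a b = tot_family_dif g a b.
    case: (n) y => [|n'] y /=.
      by move=> ->; exists (fun _ _ => 0) => a b; rewrite X0 D0.
    by move=> [h ->]; exists (tot_extend h) => a b; rewrite tot_dif_extend.
  move=> /cob[g eg]; apply: (fam g) => a b; rewrite -fX; exact: eg.
have cg a b : tot_family_dif (tot_extend y) a b = 0.
  by rewrite tot_dif_extend [tot_dif _]cy X0.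
have [z [h [cz eh]]] := Fsurj _ cg.
exists (z n); first exact: cz.
rewrite -(tot_extendK y) fE.
have -> : tot_restrict (tot_extend y) n - tot_restrict (F z) n =
    tot_restrict (tot_family_dif h) n.
  by apply: dprodP => -[a b e]; rewrite dprodD dprodN /tot_restrict /= eh addrK.
case: (n) => [|n']; last by exists (tot_restrict h n'); rewrite /= tot_dif_restrict.
apply: dprodP => -[[|a] [|b] e] //.
Qed.

Section AugV.
Variable eps : forall b, {additive C b -> K 0 b}.
Hypothesis eps_dif : forall b x, eps b.+1 (dif C x) = dv K (eps b x).
Hypothesis dh_eps : forall b x, dh K (eps b x) = 0.
Hypothesis row_exact : forall a b (x : K a.+1 b), dh K x = 0 -> exists y, x = dh K y.
Hypothesis eps_onto : forall b (x : K 0 b), dh K x = 0 -> exists c, x = eps b c.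
Hypothesis ker_eps0 : forall x, eps 0 x = 0 -> dif C x = 0 -> x = 0.
Hypothesis ker_eps : forall b x, eps b.+1 x = 0 -> dif C x = 0 ->
  exists2 y, eps b y = 0 & x = dif C y.

Let eps_sdif b x : eps b.+1 (dif C x) = signed_dv 0 b (eps b x).
Proof. by rewrite signed_dvE eps_dif expr0 mulr1z. Qed.

(** The kernel of [eps] only has to be acyclic: for the restriction of singular
   cochains to the members of a cover it is the complex of cochains that vanish on
   small simplices. *)
Theorem aug_v_bijective n : bijective (cohomology_map (aug_v eps_dif dh_eps) (k := n)).
Proof.
apply: (@total_map_bijective _ (aug_family eps)) => [z|x a b|z g cz|g].
- by apply: dprodP => -[[|a] b e]; rewrite /tot_restrict //=; case: n / e.
- rewrite /tot_extend /aug_family /spread.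
  case: eqP => [e|ne]; last first.
    by case: a ne => [|a] ne //; case: eqP => [//|_]; rewrite raddf0.
  case: a e => [|a] e //=.
  by case: eqP => [e'|/(_ e)] //; congr (eps _ (cast_deg _ _)); exact: Prop_irrelevance.
- exact: (aug_family_inj (@dh_dh K) signed_dv_dv dh_signed_dv row_exact eps_sdif).
- exact: (aug_family_surj (@dh_dh K) signed_dv_dv dh_signed_dv row_exact eps_sdif).
Qed.
End AugV.

Section AugH.
Variable eps : forall a, {additive C a -> K a 0}.
Hypothesis eps_dif : forall a x, eps a.+1 (dif C x) = dh K (eps a x).
Hypothesis dv_eps : forall a x, dv K (eps a x) = 0.
Hypothesis col_exact : forall a b (x : K a b.+1), dv K x = 0 -> exists y, x = dv K y.
Hypothesis eps_onto : forall a (x : K a 0), dv K x = 0 -> exists c, x = eps a c.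
Hypothesis eps_inj : forall a x, eps a x = 0 -> x = 0.

Let signed_dv0 a b (x : K a b) : signed_dv a b x = 0 -> dv K x = 0.
Proof.
rewrite signed_dvE => /(congr1 (fun y => y *~ (-1) ^+ a)).
by rewrite -mulrzA -exprMn mulrNN mulr1 expr1n mulr1z mul0rz.
Qed.

Let signed_exact b a (x : K a b.+1) : signed_dv a b.+1 x = 0 ->
  exists y, x = signed_dv a b y.
Proof.
move=> /signed_dv0/col_exact[y ->]; exists (y *~ (-1) ^+ a).
by rewrite signed_dvE raddfMz -mulrzA -exprMn mulrNN mulr1 expr1n mulr1z.
Qed.

(** The transpose of the vertical case: [dh] and the signed [dv] anticommute, so that they can
   exchange their roles. *)
Theorem aug_h_bijective n : bijective (cohomology_map (aug_h eps_dif dv_eps) (k := n)).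
Proof.
pose K' a b := K b a.
pose d1' a b : {additive K' a b -> K' a.+1 b} := signed_dv b a.
pose d2' a b : {additive K' a b -> K' a b.+1} := @dh K b a.
pose flip (g : forall a b, K' a b) a b := g b a.
have flip_dif g a b : tot_family_dif g a b = family_dif d1' d2' (fun a b => g b a) b a.
  by case: a b => [|a] [|b]; rewrite /tot_family_dif /family_dif addrC.
have d12 a b (x : K' a b) : d1' a b.+1 (d2' a b x) = - d2' a.+1 b (d1' a b x).
  by rewrite /d1' /d2' dh_signed_dv opprK.
apply: (@total_map_bijective _ (fun z => flip (@aug_family K' C eps z))) => [z|x a b|z g cz eg|g cg].
- by apply: dprodP => -[a [|b] e]; rewrite /tot_restrict //=;
    move: (aug_h_eq e) => {e} e; case: n / e.
- rewrite /tot_extend /flip /aug_family /spread.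
  case: eqP => [e|ne]; last first.
    by case: b ne => [|b] ne //; case: eqP => [e|_]; rewrite ?raddf0 //; case: ne; rewrite addn0.
  case: b e => [|b] e //=.
  by case: eqP => [e'|/(_ (aug_h_eq e))] //; congr (eps _ (cast_deg _ _)); exact: Prop_irrelevance.
- apply: (@aug_family_inj K' d1' d2' _ _ d12 _ C eps _ _ _ _ z (fun a b => g b a)) => //.
  + by move=> a b x; exact: signed_dv_dv.
  + by move=> a b x; exact: dh_dh.
  + by move=> b x /signed_dv0; exact: eps_onto.
  + by move=> x /eps_inj.
  + by move=> b x /eps_inj -> _; exists 0; rewrite raddf0.
  + by move=> a b; rewrite -[RHS]flip_dif -eg.
- have d11 a b (x : K' a b) : d1' a.+1 b (d1' a b x) = 0 by exact: signed_dv_dv.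
  have d22 a b (x : K' a b) : d2' a b.+1 (d2' a b x) = 0 by exact: dh_dh.
  have onto a (x : K' 0 a) : d1' 0 a x = 0 -> exists c, x = eps a c.
    by move=> /signed_dv0; exact: eps_onto.
  have ker a (x : C a.+1) : eps a.+1 x = 0 -> dif C x = 0 ->
      exists2 y, eps a y = 0 & x = dif C y.
    by move=> /eps_inj -> _; exists 0; rewrite raddf0.
  have cg' a b : family_dif d1' d2' (fun a b => g b a) a b = 0.
    by rewrite -[LHS]flip_dif cg.
  have [z [h [cz eh]]] := @aug_family_surj K' d1' d2' d11 d22 d12
    (fun a b => @signed_exact a b) C eps eps_dif onto ker _ cg'.
  by exists z, (fun a b => h b a); split=> // a b; rewrite flip_dif (eh b a).
Qed.
End AugH.
End Total.

(** * Chains as functionals, and subdivision of formal simplices *)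

Lemma subrBB (M : zmodType) (a b c d : M) : a - b - (c - d) = a - c - (b - d).
Proof. by rewrite !opprD !opprK addrACA. Qed.

Lemma subrDD (M : zmodType) (a b c d : M) : a + b - (c + d) = a - c + (b - d).
Proof. by rewrite opprD addrACA. Qed.

Section FreeChains.

(** The double dual of the free abelian group on [A].  Operators given on cells
   extend to it with composition laws that hold by computation; [span] singles out
   the genuine, finite chains. *)
Definition chains (A : Type) : zmodType := ((A -> int) -> int).

Definition cell (A : Type) (a : A) : chains A := fun beta => beta a.

Definition extend (A B : Type) (f : A -> chains B) (phi : chains A) : chains B :=
  fun beta => phi (fun a => f a beta).

Fact extend_zmod A B (f : A -> chains B) : zmod_morphism (extend f).
Proof. by []. Qed.
HB.instance Definition _ A B (f : A -> chains B) :=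
  GRing.isZmodMorphism.Build (chains A) (chains B) (extend f) (extend_zmod f).

Lemma extend_sub A B (f : A -> chains B) (x y : chains A) :
  extend f (x - y) = extend f x - extend f y.
Proof. by []. Qed.

Lemma extend_add A B (f : A -> chains B) (x y : chains A) :
  extend f (x + y) = extend f x + extend f y.
Proof. by []. Qed.

Definition eval (A : Type) (beta : A -> int) (x : chains A) : int := x beta.

Fact eval_zmod A (beta : A -> int) : zmod_morphism (eval beta). Proof. by []. Qed.
HB.instance Definition _ A (beta : A -> int) :=
  GRing.isZmodMorphism.Build (chains A) int (eval beta) (eval_zmod beta).

Lemma eval_signed_sum A n (beta : A -> int) (f : 'I_n -> chains A) :
  (\sum_(l < n) f l *~ (-1) ^+ l) beta = \sum_(l < n) f l beta *~ (-1) ^+ l.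
Proof.
rewrite -[LHS]/(eval beta _) raddf_sum; apply: eq_bigr => l _.
by rewrite raddfMz.
Qed.

Inductive span (A : Type) (S : A -> Prop) : chains A -> Prop :=
| span0 : span S 0
| span_cell a : S a -> span S (cell a)
| spanB x y : span S x -> span S y -> span S (x - y).

Section Span.
Variables (A B : Type) (S : A -> Prop).
Implicit Types (f g : A -> chains B) (x y : chains A).

Lemma spanN x : span S x -> span S (- x).
Proof. by move=> h; rewrite -[- x]add0r; apply: spanB => //; exact: span0. Qed.

Lemma spanD x y : span S x -> span S y -> span S (x + y).
Proof. by move=> hx hy; rewrite -[y]opprK; apply/spanB/spanN. Qed.

Lemma span_sum (I : Type) (r : seq I) (F : I -> chains A) :
  (forall i, span S (F i)) -> span S (\sum_(i <- r) F i).
Proof. by move=> h; elim/big_ind: _ => [|u v|i _]; [exact: span0|exact: spanD|exact: h]. Qed.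

Lemma span_sign x n : span S x -> span S (x *~ (-1) ^+ n).
Proof. by rewrite -signr_odd; case: odd => //= h; rewrite expr1 mulrN1z; exact: spanN. Qed.

Lemma span_mulz x (n : int) : span S x -> span S (x *~ n).
Proof.
have pos (m : nat) y : span S y -> span S (y *+ m).
  by elim: m => [|m IH] h; rewrite ?mulr0n ?mulrS; [exact: span0|apply: spanD => //; exact: IH].
by case: n => n h; [exact: pos|rewrite NegzE mulrNz; apply/spanN/pos].
Qed.

Lemma subspan (S' : A -> Prop) x : (forall a, S a -> S' a) -> span S x -> span S' x.
Proof.
move=> h; elim=> [|a Sa|u v _ hu _ hv]; [exact: span0|exact/span_cell/h|exact: spanB].
Qed.

Lemma span_extend (S' : B -> Prop) f x :
  (forall a, S a -> span S' (f a)) -> span S x -> span S' (extend f x).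
Proof.
move=> h; elim=> [|a Sa|u v _ hu _ hv]; first exact: span0; first exact: h.
by rewrite extend_sub; exact: spanB.
Qed.

Lemma eq_extend f g x : (forall a, S a -> f a = g a) -> span S x ->
  extend f x = extend g x.
Proof.
by move=> h; elim=> [|a Sa|u v _ hu _ hv] //; [exact: h|rewrite !extend_sub hu hv].
Qed.

Lemma extendB f g x : span S x ->
  extend (fun a => f a - g a) x = extend f x - extend g x.
Proof.
elim=> [|a Sa|u v _ hu _ hv] //.
by rewrite !extend_sub hu hv; exact: subrBB.
Qed.

Lemma extend0 f x : (forall a, S a -> f a = 0) -> span S x -> extend f x = 0.
Proof.
move=> h; elim=> [|a Sa|u v _ hu _ hv]; [exact: raddf0|exact: h|].
by rewrite extend_sub hu hv subrr.
Qed.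
End Span.

Lemma extend_cell A (x : chains A) : extend (@cell A) x = x. Proof. by []. Qed.

Lemma extend_cellE A B (f : A -> chains B) a : extend f (cell a) = f a. Proof. by []. Qed.

Lemma extend_extend A B C (f : A -> chains B) (g : B -> chains C) x :
  extend g (extend f x) = extend (fun a => extend g (f a)) x.
Proof. by []. Qed.
Lemma extend_square A B B' C (S : A -> Prop) (f : A -> chains B) (g : B -> chains C)
    (f' : A -> chains B') (g' : B' -> chains C) x : span S x ->
  (forall a, S a -> extend g (f a) = extend g' (f' a)) ->
  extend g (extend f x) = extend g' (extend f' x).
Proof. by move=> hx h; rewrite [LHS]extend_extend [RHS]extend_extend; apply: eq_extend hx. Qed.
End FreeChains.

Section FormalSimplices.
Variables (P : eqType) (b : seq P -> P).
Implicit Types (w : seq P) (x : chains (seq P)).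

Definition is_chain (A : Type) := span (fun _ : A => True).

Definition formal_cone (a : P) : chains (seq P) -> chains (seq P) :=
  extend (fun w => cell (a :: w)).

(** A word stands for the affine simplex on its letters, and the empty word for the
   simplex of dimension -1.  In this augmented complex [formal_bd_cone] holds in
   every dimension. *)
Fixpoint formal_bd1 w : chains (seq P) :=
  if w is a :: w' then cell w' - formal_cone a (formal_bd1 w') else 0.

Definition formal_bd := extend formal_bd1.

Lemma formal_bd1_span w : span (fun v => (size v).+1 = size w /\ {subset v <= w}) (formal_bd1 w).
Proof.
elim: w => [|a w IH] /=; first exact: span0.
apply: spanB; first by apply: span_cell; split=> // y; rewrite inE orbC => ->.
apply: span_extend IH => v [sv vw]; apply: span_cell; rewrite /= sv; split=> // y.
by rewrite !inE => /orP[->//|/vw ->]; rewrite orbT.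
Qed.

Lemma is_chain_formal_bd1 w : is_chain (formal_bd1 w).
Proof. by apply: subspan (formal_bd1_span w). Qed.

Lemma formal_bd_cone a x : is_chain x ->
  formal_bd (formal_cone a x) = x - formal_cone a (formal_bd x).
Proof.
elim=> [|w _|u v _ hu _ hv] //.
by rewrite /formal_cone /formal_bd !extend_sub -!/(formal_cone _ _) -!/(formal_bd _) hu hv;
  exact: subrBB.
Qed.

Lemma formal_bd_formal_bd1 w : formal_bd (formal_bd1 w) = 0.
Proof.
elim: w => [|a w IH] //=; rewrite /formal_bd raddfB /= -/formal_bd formal_bd_cone;
  last exact: is_chain_formal_bd1.
by rewrite IH /formal_cone raddf0 subr0 subrr.
Qed.

(** The cone from the barycenter over the subdivided boundary.  The faces are not
   subterms of the word, whose size therefore serves as fuel. *)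
Fixpoint subdiv_rec n w : chains (seq P) :=
  if n is n'.+1 then formal_cone (b w) (extend (subdiv_rec n') (formal_bd1 w)) else cell w.
Definition subdiv1 w := subdiv_rec (size w) w.
Definition subdiv := extend subdiv1.

(** The cone from the barycenter over [w - T (d w)]: see
   [formal_bd_subdiv_htpy1]. *)
Fixpoint subdiv_htpy_rec n w : chains (seq P) :=
  if n is n'.+1 then formal_cone (b w) (cell w - extend (subdiv_htpy_rec n') (formal_bd1 w)) else 0.
Definition subdiv_htpy1 w := subdiv_htpy_rec (size w) w.
Definition subdiv_htpy := extend subdiv_htpy1.

Lemma subdiv1E w : (0 < size w)%N -> subdiv1 w = formal_cone (b w) (subdiv (formal_bd1 w)).
Proof.
case: w => // a w _; congr (formal_cone _ _); apply: eq_extend (formal_bd1_span _) => v [[sv] _].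
by rewrite /subdiv1 sv.
Qed.

Lemma subdiv_htpy1E w : (0 < size w)%N ->
  subdiv_htpy1 w = formal_cone (b w) (cell w - subdiv_htpy (formal_bd1 w)).
Proof.
case: w => // a w _; congr (formal_cone _ (_ - _));
  apply: eq_extend (formal_bd1_span _) => v [[sv] _].
by rewrite /subdiv_htpy1 sv.
Qed.

Definition stable (Q : P -> Prop) :=
  forall w, (0 < size w)%N -> (forall y, y \in w -> Q y) -> Q (b w).

Lemma subdiv1_span (Q : P -> Prop) w : stable Q -> (forall y, y \in w -> Q y) ->
  span (fun v => size v = size w /\ forall y, y \in v -> Q y) (subdiv1 w).
Proof.
move=> Qb; have [n] := ubnP (size w); elim: n w => // n IH [|a w] lt Qw.
  exact: span_cell.
rewrite subdiv1E //; set w' := a :: w.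
apply: (@span_extend _ _ (fun v => (size v).+1 = size w' /\ forall y, y \in v -> Q y)).
  move=> v [sv Qv]; apply: span_cell; rewrite /= sv; split=> // y.
  by rewrite inE => /orP[/eqP->|/Qv//]; exact: Qb.
apply: span_extend (formal_bd1_span _) => v [sv vw].
rewrite -sv; apply: (@subspan _ (fun u => size u = size v /\ forall y, y \in u -> Q y)).
  by move=> u [-> ?].
by apply: IH => [|y /vw]; [rewrite -ltnS sv|exact: Qw].
Qed.

Lemma subdiv_htpy1_span w : span (fun v => size v = (size w).+1) (subdiv_htpy1 w).
Proof.
have [n] := ubnP (size w); elim: n w => // n IH [|a w] lt; first exact: span0.
rewrite subdiv_htpy1E //; apply: (@span_extend _ _ (fun v => size v = (size w).+1)).
  by move=> v sv; apply: span_cell; rewrite /= sv.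
apply: spanB; first exact: span_cell.
apply: span_extend (formal_bd1_span _) => v [[sv] _].
by rewrite -sv; apply: IH; rewrite sv.
Qed.

Lemma is_chain_subdiv x : is_chain x -> is_chain (subdiv x).
Proof.
apply: span_extend => w _.
have tr : stable (fun _ => True) by [].
exact: subspan (subdiv1_span tr (fun _ _ => I) : span _ (subdiv1 w)).
Qed.

Lemma is_chain_subdiv_htpy x : is_chain x -> is_chain (subdiv_htpy x).
Proof. by apply: span_extend => w _; apply: subspan (subdiv_htpy1_span w). Qed.

(** By induction, the boundary of [w - T (d w)] is [Sd (d w)], and the cone over
   the latter is [Sd w]. *)
Lemma formal_bd_subdiv_htpy1 w :
  formal_bd (subdiv_htpy1 w) = cell w - subdiv1 w - subdiv_htpy (formal_bd1 w).
Proof.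
have [n] := ubnP (size w); elim: n w => // n IH [|a w] lt.
  by rewrite /subdiv_htpy /= raddf0 subr0 subrr /formal_bd raddf0.
set w' := a :: w.
rewrite subdiv_htpy1E // subdiv1E // formal_bd_cone; last first.
  by apply: spanB; [exact: span_cell|exact/is_chain_subdiv_htpy/is_chain_formal_bd1].
suff -> : formal_bd (cell w' - subdiv_htpy (formal_bd1 w')) =
  subdiv (formal_bd1 w') by rewrite addrAC.
rewrite /formal_bd raddfB /= -/formal_bd [formal_bd (cell _)]extend_cellE.
have -> : formal_bd (subdiv_htpy (formal_bd1 w')) =
  formal_bd1 w' - subdiv (formal_bd1 w') - subdiv_htpy (formal_bd (formal_bd1 w')).
  transitivity (extend (fun v => cell v - subdiv1 v - subdiv_htpy (formal_bd1 v)) (formal_bd1 w')).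
    by apply: eq_extend (formal_bd1_span w') => v [[sv] _]; apply: IH; rewrite sv.
  by rewrite !(extendB _ _ (formal_bd1_span w')).
by rewrite formal_bd_formal_bd1 /subdiv_htpy raddf0 subr0 opprB addrC subrK.
Qed.
End FormalSimplices.

Section FormalMap.
Variables (P Q : eqType) (bP : seq P -> P) (bQ : seq Q -> Q) (f : P -> Q).
Hypothesis fb : forall w, (0 < size w)%N -> f (bP w) = bQ (map f w).

Definition formal_push : chains (seq P) -> chains (seq Q) := extend (fun w => cell (map f w)).

Lemma formal_bd1_map w : formal_bd1 (map f w) = formal_push (formal_bd1 w).
Proof. by elim: w => [|a w IH] //=; rewrite IH. Qed.

(** Subdivision is natural for maps that preserve barycenters, such as affine ones;
   this is what makes singular subdivision compatible with faces. *)
Lemma subdiv1_map w : subdiv1 bQ (map f w) = formal_push (subdiv1 bP w).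
Proof.
have [n] := ubnP (size w); elim: n w => // n IH [|a w] lt //.
rewrite !subdiv1E // -fb // formal_bd1_map.
transitivity (formal_cone (f (bP (a :: w))) (formal_push (subdiv bP (formal_bd1 (a :: w)))));
  last by [].
congr formal_cone; apply: eq_extend (formal_bd1_span (a :: w)) => v [[sv] _].
by apply: IH; rewrite sv.
Qed.

Lemma subdiv_htpy1_map w : subdiv_htpy1 bQ (map f w) = formal_push (subdiv_htpy1 bP w).
Proof.
have [n] := ubnP (size w); elim: n w => // n IH [|a w] lt //.
rewrite !subdiv_htpy1E // -fb // formal_bd1_map.
transitivity (formal_cone (f (bP (a :: w)))
  (formal_push (cell (a :: w) - subdiv_htpy bP (formal_bd1 (a :: w))))); last by [].
congr formal_cone; rewrite [RHS]extend_sub; congr (_ - _).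
apply: eq_extend (formal_bd1_span (a :: w)) => v [[sv] _].
by apply: IH; rewrite sv.
Qed.
End FormalMap.

(** * Affine simplices and singular chains *)

Section AffineMaps.
Variable R : realType.

Definition corner m : simplex R m := simplex_map (fun _ => ord0) (vertex R).

Section Aff.
Variables (m n : nat) (w : seq (simplex R m)).

Fact aff_subproof (p : simplex R n) :
  (\row_j \sum_i bary p i * bary (nth (corner m) w i) j) \in @simplex_set R m.
Proof.
apply/mem_set; split=> [j|].
  by rewrite mxE sumr_ge0 // => i _; rewrite mulr_ge0 // bary_ge0.
under eq_bigr do rewrite mxE.
rewrite exchange_big /= -[RHS](bary_sum1 p); apply: eq_bigr => i _.
by rewrite -mulr_sumr bary_sum1 mulr1.
Qed.

(** The affine map with vertices [w].  Words of the wrong length are cut, or padded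
   with [corner], which keeps the operation total. *)
Definition aff (p : simplex R n) : simplex R m :=
  exist (fun q => q \in @simplex_set R m) _ (aff_subproof p).

Lemma affE p j : bary (aff p) j = \sum_i bary p i * bary (nth (corner m) w i) j.
Proof. by rewrite {1}/bary /= mxE. Qed.

Lemma aff_continuous : continuous aff.
Proof.
apply: simplex_continuous => j.
under [X in continuous X]eq_fun do rewrite affE.
apply: (continuous_big (op := +%R)); first exact: add_continuous.
move=> i _ p; apply: (@cvgM _ _ _ _ (fun p => bary p i) (fun _ => _)).
- exact: nbhs_filter.
- exact: bary_continuous.
- exact: (@cst_continuous (simplex R n) R _ p).
Qed.
HB.instance Definition _ :=
  isContinuous.Build (simplex R n) (simplex R m) aff aff_continuous.
End Aff.

Lemma aff_aff k m n (v : seq (simplex R m)) (w : seq (simplex R k)) (p : simplex R n) :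
  size w = n.+1 -> aff v (aff w p) = aff (map (@aff _ k v) w) p.
Proof.
move=> sw; apply: bary_inj => j; rewrite !affE.
under eq_bigr => i _ do rewrite affE mulr_suml.
rewrite exchange_big /=; apply: eq_bigr => i _.
rewrite (nth_map (corner k)) ?sw // affE mulr_sumr.
by apply: eq_bigr => l _; rewrite mulrA.
Qed.

Fact center_subproof n : const_mx (n.+1%:R^-1) \in @simplex_set R n.
Proof.
apply/mem_set; split=> [j|]; first by rewrite mxE invr_ge0 ler0n.
under eq_bigr do rewrite mxE.
by rewrite sumr_const card_ord -[_ *+ _]mulr_natr mulVf // pnatr_eq0.
Qed.
Definition center n : simplex R n := exist (fun q => q \in @simplex_set R n) _ (center_subproof n).

Lemma centerE n i : bary (center n) i = n.+1%:R^-1.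
Proof. by rewrite /bary /= mxE. Qed.

Definition barycenter m (w : seq (simplex R m)) : simplex R m :=
  aff w (center (size w).-1).

Lemma aff_barycenter m k (v : seq (simplex R m)) (w : seq (simplex R k)) :
  (0 < size w)%N -> aff v (barycenter w) = barycenter (map (@aff _ k v) w).
Proof. by move=> sw; rewrite /barycenter aff_aff ?size_map // prednK. Qed.

Definition simplex_vertex n (i : 'I_n.+1) : simplex R n := simplex_map (fun _ => i) (vertex R).

Lemma simplex_vertexE n (i j : 'I_n.+1) : bary (simplex_vertex i) j = (i == j)%:R.
Proof.
rewrite simplex_mapE big_mkcond big_ord1; case: eqP => // _.
by rewrite /bary /= mxE.
Qed.

Definition vertices n : seq (simplex R n) := [seq simplex_vertex i | i <- enum 'I_n.+1].

Lemma size_vertices n : size (vertices n) = n.+1.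
Proof. by rewrite size_map size_enum_ord. Qed.

Lemma nth_vertices n (i : 'I_n.+1) : nth (corner n) (vertices n) i = simplex_vertex i.
Proof. by rewrite (nth_map ord0) ?size_enum_ord // nth_ord_enum. Qed.

Lemma aff_vertices n (p : simplex R n) : aff (vertices n) p = p.
Proof.
apply: bary_inj => j; rewrite affE (bigD1 j) //= nth_vertices simplex_vertexE eqxx mulr1.
rewrite big1 ?addr0 // => i ij.
by rewrite nth_vertices simplex_vertexE (negPf ij) mulr0.
Qed.

Lemma aff_simplex_vertex m n (w : seq (simplex R m)) (i : 'I_n.+1) :
  aff w (simplex_vertex i) = nth (corner m) w i.
Proof.
apply: bary_inj => j; rewrite affE (bigD1 i) //= simplex_vertexE eqxx mul1r.
by rewrite big1 ?addr0 // => l li; rewrite simplex_vertexE eq_sym (negPf li) mul0r.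
Qed.

Lemma map_aff_vertices m n (w : seq (simplex R m)) : size w = n.+1 ->
  map (aff w) (vertices n) = w.
Proof.
move=> sw; apply: (@eq_from_nth _ (corner m)); rewrite size_map size_vertices // => i lt.
rewrite (nth_map (corner n)) ?size_vertices // (nth_vertices (Ordinal lt)).
exact: aff_simplex_vertex.
Qed.
End AffineMaps.

Section Delete.
Variable P : eqType.

Fixpoint delete (l : nat) (w : seq P) : seq P :=
  if w is a :: w' then (if l is l'.+1 then a :: delete l' w' else w') else [::].

Lemma size_delete l w : (l < size w)%N -> size (delete l w) = (size w).-1.
Proof.
elim: w l => [|a w IH] [|l] //=; rewrite ltnS => lt.
by rewrite IH // prednK // (leq_ltn_trans _ lt).
Qed.

Lemma nth_delete x l w i : nth x (delete l w) i = nth x w (bump l i).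
Proof.
elim: w l i => [|a w IH] [|l] [|i] //=; rewrite ?nth_nil //.
by rewrite IH /bump ltnS; case: leqP.
Qed.

Lemma formal_bd1E (w : seq P) :
  formal_bd1 w = \sum_(l < size w) cell (delete l w) *~ (-1) ^+ l.
Proof.
elim: w => [|a w IH] /=; first by rewrite big_ord0.
rewrite big_ord_recl expr0 mulr1z IH /= /formal_cone raddf_sum -sumrN; congr (_ + _).
apply: eq_bigr => l _; rewrite raddfMz /= /bump /= add1n exprS mulN1r mulrNz.
by [].
Qed.
End Delete.

Lemma aff_face (R : realType) m n (w : seq (simplex R m)) (l : 'I_n.+2) (p : simplex R n) :
  aff w (simplex_map (lift l) p) = aff (delete l w) p.
Proof.
apply: bary_inj => j; rewrite !affE.
under eq_bigr do rewrite simplex_mapE mulr_suml.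
rewrite (exchange_big_dep xpredT) //=; apply: eq_bigr => i _.
by rewrite (big_pred1 (lift l i)) ?nth_delete // => y /=; rewrite eq_sym.
Qed.

Lemma simplex_face_aff (R : realType) n (l : 'I_n.+2) (p : simplex R n) :
  simplex_map (lift l) p = aff (delete l (vertices R n.+1)) p.
Proof. by rewrite -aff_face aff_vertices. Qed.

Section SingularChains.
Variables (R : realType) (X : topologicalType).

(** Simplices of all dimensions together: chains over this type carry no degree, and
   no cast between dimensions occurs. *)
Definition anysing := {n : nat & sing R X n}.
Definition asing n (s : sing R X n) : anysing := existT _ n s.

Definition sing_bd1 (s : anysing) : chains anysing :=
  let: existT n s := s in
  match n return sing R X n -> chains anysing with
  | 0 => fun _ => 0
  | n'.+1 => fun s => \sum_(l < n'.+2) cell (asing (sing_face l s)) *~ (-1) ^+ l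
  end s.
Definition sing_bd := extend sing_bd1.

Section Realize.
Variables (m : nat) (s : sing R X m).

(** The empty word goes to zero, which turns the augmented formal boundary into the
   singular one. *)
Definition realize1 (w : seq (simplex R m)) : chains anysing :=
  if size w is n.+1 then cell (asing (s \o @aff R m n w)) else 0.
Definition realize := extend realize1.

Lemma realize1E n (w : seq (simplex R m)) : size w = n.+1 ->
  realize1 w = cell (asing (s \o @aff R m n w)).
Proof. by rewrite /realize1 => ->. Qed.

Lemma sing_bd_realize1 w : sing_bd (realize1 w) = realize (formal_bd1 w).
Proof.
case e : (size w) => [|[|n]].
- by rewrite (size0nil e) /= /realize raddf0 /realize1 /= /sing_bd raddf0.
- by rewrite (realize1E e); case: w e => // a [].
rewrite (realize1E e) formal_bd1E /realize raddf_sum e; apply: eq_bigr => l _.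
rewrite raddfMz /= extend_cellE (@realize1E n) ?size_delete ?e //; congr (cell (asing _) *~ _).
by apply/continuousEP => p /=; rewrite aff_face.
Qed.

Lemma sing_bd_realize x : is_chain x -> sing_bd (realize x) = realize (formal_bd x).
Proof.
by move=> hx; apply: (extend_square hx) => w _; exact: sing_bd_realize1.
Qed.
End Realize.

Lemma realize_aff m n (s : sing R X m) (v : seq (simplex R m)) x :
  is_chain x -> realize (s \o @aff R m n v) x = realize s (formal_push (aff v) x).
Proof.
move=> hx; apply: (extend_square (f := @cell _) hx) => w _.
rewrite !extend_cellE /realize1 size_map.
case e: (size w) => [|k] //; congr (cell (asing _)).
by apply/continuousEP => p /=; rewrite aff_aff.
Qed.

Lemma realize_face n (s : sing R X n.+1) (l : 'I_n.+2) x : is_chain x ->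
  realize (sing_face l s) x = realize s (formal_push (aff (delete l (vertices R n.+1))) x).
Proof.
move=> hx; rewrite -realize_aff //; congr (realize _ x).
by apply/continuousEP => p /=; rewrite simplex_face_aff.
Qed.

Lemma map_face_vertices n (l : 'I_n.+2) :
  map (aff (delete l (vertices R n.+1))) (vertices R n) = delete l (vertices R n.+1).
Proof. by rewrite map_aff_vertices // size_delete size_vertices. Qed.

Definition sing_subdiv1 (s : anysing) : chains anysing :=
  let: existT n s := s in realize s (subdiv1 (@barycenter R n) (vertices R n)).
Definition sing_subdiv := extend sing_subdiv1.

Definition sing_subdiv_htpy1 (s : anysing) : chains anysing :=
  let: existT n s := s in realize s (subdiv_htpy1 (@barycenter R n) (vertices R n)).
Definition sing_subdiv_htpy := extend sing_subdiv_htpy1.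

Lemma is_chain_subdiv1 m w : is_chain (subdiv1 (@barycenter R m) w).
Proof. by apply: is_chain_subdiv (span_cell _ : is_chain (cell w)). Qed.

Lemma is_chain_subdiv_htpy1 m w : is_chain (subdiv_htpy1 (@barycenter R m) w).
Proof. by apply: is_chain_subdiv_htpy (span_cell _ : is_chain (cell w)). Qed.

Lemma realize_cell_vertices n (s : sing R X n) : realize s (cell (vertices R n)) = cell (asing s).
Proof.
rewrite /realize extend_cellE (realize1E s (size_vertices R n)); congr (cell (asing _)).
by apply/continuousEP => p /=; rewrite aff_vertices.
Qed.

Lemma sing_subdiv_realize1 m n (s : sing R X m) (v : seq (simplex R m)) : size v = n.+1 ->
  sing_subdiv1 (asing (s \o @aff R m n v)) = realize s (subdiv1 (@barycenter R m) v).
Proof.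
move=> sv; rewrite /= realize_aff; last exact: is_chain_subdiv1.
congr (realize s _).
by rewrite -(@subdiv1_map _ _ (@barycenter R n) (@barycenter R m)) ?map_aff_vertices // => w;
  exact: aff_barycenter.
Qed.

Lemma sing_subdiv_realize m (s : sing R X m) x : is_chain x ->
  sing_subdiv (realize s x) = realize s (subdiv (@barycenter R m) x).
Proof.
move=> hx; apply: (extend_square hx) => w _.
case e: (size w) => [|n].
  by rewrite (size0nil e) /realize1 /=.
by rewrite (realize1E s e) extend_cellE; exact: sing_subdiv_realize1.
Qed.

Lemma sing_subdiv_htpy_face n (s : sing R X n.+1) (l : 'I_n.+2) :
  sing_subdiv_htpy1 (asing (sing_face l s)) =
    realize s (subdiv_htpy1 (@barycenter R n.+1) (delete l (vertices R n.+1))).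
Proof.
rewrite /= realize_face; last exact: is_chain_subdiv_htpy1.
congr (realize s _).
by rewrite -(@subdiv_htpy1_map _ _ (@barycenter R n) (@barycenter R n.+1)) ?map_face_vertices // => w; exact: aff_barycenter.
Qed.

(** The formal identity on the standard simplex, pushed forward along [s]; naturality
   for the face maps identifies the last term. *)
Lemma sing_bd_sing_subdiv_htpy1 (s : anysing) :
  sing_bd (sing_subdiv_htpy1 s) = cell s - sing_subdiv1 s - sing_subdiv_htpy (sing_bd1 s).
Proof.
case: s => n s; rewrite /= sing_bd_realize; last exact: is_chain_subdiv_htpy1.
rewrite [formal_bd _]formal_bd_subdiv_htpy1 /realize !extend_sub -!/(realize _ _) realize_cell_vertices.
congr (_ - _ - _); case: n s => [|n] s.
  rewrite /vertices enum_ordSl /= enum_ord0 /=.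
  by rewrite /formal_cone raddf0 subr0.
rewrite formal_bd1E /subdiv_htpy /sing_subdiv_htpy /realize !raddf_sum size_vertices;
  apply: eq_bigr => l _.
rewrite !raddfMz /=; congr (_ *~ _); rewrite !extend_cellE; exact/esym/sing_subdiv_htpy_face.
Qed.
End SingularChains.

(** * The mesh of a subdivision and Lebesgue numbers *)

Section Closeness.
Variables (R : realType) (m : nat).
Implicit Types (p q : simplex R m) (w : seq (simplex R m)) (d : R).

Definition close d p q := forall j, `|bary p j - bary q j| <= d.

Lemma closeC d p q : close d p q -> close d q p.
Proof. by move=> h j; rewrite distrC. Qed.

Lemma close_trans d e p q r : close d p q -> close e q r -> close (d + e) p r.
Proof. by move=> h h' j; rewrite (le_trans (ler_distD (bary q j) _ _)) // lerD. Qed.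

Lemma bary_le1 p j : bary p j <= 1.
Proof.
rewrite -(bary_sum1 p) (bigD1 j) //= lerDl sumr_ge0 // => i _; exact: bary_ge0.
Qed.

Lemma close1 p q : close 1 p q.
Proof.
move=> j; have := bary_ge0 p j; have := bary_le1 p j.
by have := bary_ge0 q j; have := bary_le1 q j; rewrite ler_norml => *; lra.
Qed.

Lemma close_aff d q w n (p : simplex R n) : size w = n.+1 ->
  (forall y, y \in w -> close d q y) -> close d q (aff w p).
Proof.
move=> sw h j; rewrite affE -[bary q j]mul1r -(bary_sum1 p) mulr_suml -sumrB.
apply: (le_trans (ler_norm_sum _ _ _)).
rewrite -[d]mul1r -(bary_sum1 p) mulr_suml; apply: ler_sum => i _.
rewrite -mulrBr normrM ger0_norm ?bary_ge0 // ler_wpM2l ?bary_ge0 //.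
by apply: h; rewrite mem_nth // sw.
Qed.

Lemma stable_close d q : stable (@barycenter R m) (close d q).
Proof. by move=> w sw h; apply: close_aff => //; rewrite prednK. Qed.

Definition shrink : R := m%:R / m.+1%:R.

Lemma shrink_ge0 : 0 <= shrink. Proof. by rewrite divr_ge0 ?ler0n. Qed.
Lemma shrink_lt1 : shrink < 1.
Proof. by rewrite ltr_pdivrMr ?ltr0n // mul1r ltr_nat. Qed.

Definition diam_le d w := forall x y, x \in w -> y \in w -> close d x y.

(** The barycenter is the mean of at most [m.+1] vertices, one of which is [y]
   itself. *)
Lemma close_barycenter d w y : 0 <= d -> (size w <= m.+1)%N -> diam_le d w -> y \in w ->
  close (shrink * d) (barycenter w) y.
Proof.
move=> d0 sw dw yw; have w0 : (0 < size w)%N by case: (w) yw.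
move=> j; rewrite affE; set n := (size w).-1.
have sn : size w = n.+1 by rewrite prednK.
under eq_bigr do rewrite centerE.
rewrite -mulr_sumr.
have -> : bary y j = n.+1%:R^-1 * \sum_(i < n.+1) bary y j.
  by rewrite sumr_const card_ord -(mulr_natl (bary y j)) mulrA mulVf ?mul1r // pnatr_eq0.
rewrite -mulrBr -sumrB normrM ger0_norm ?invr_ge0 ?ler0n //.
have iy : (index y w < n.+1)%N by rewrite -sn index_mem.
rewrite (bigD1 (Ordinal iy)) //= nth_index // subrr add0r.
apply: (@le_trans _ _ (n.+1%:R^-1 * (n%:R * d))).
  rewrite ler_wpM2l ?invr_ge0 ?ler0n // (le_trans (ler_norm_sum _ _ _)) //.
  apply: (@le_trans _ _ (\sum_(i < n.+1 | i != Ordinal iy) d)).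
    apply: ler_sum => i _; apply: dw => //; apply: mem_nth; by rewrite sn.
  by rewrite sumr_const -(mulr_natl d) cardC1 card_ord.
rewrite mulrA ler_wpM2r // mulrC /shrink.
have nm : (n <= m)%N by rewrite -ltnS -sn.
rewrite ler_pdivlMr ?ltr0n // mulrAC ler_pdivrMr ?ltr0n // -!natrM ler_nat.
by rewrite !mulnS mulnC leq_add2r.
Qed.

(** The predicate [Q] is there for the induction: closeness to the barycenter
   of the large simplex must persist while its faces are subdivided in turn. *)
Lemma subdiv1_mesh d (Q : simplex R m -> Prop) w : 0 <= d -> stable (@barycenter R m) Q ->
  (size w <= m.+1)%N -> diam_le d w -> (forall y, y \in w -> Q y) ->
  span (fun v => [/\ size v = size w, diam_le (shrink * d) v & forall y, y \in v -> Q y])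
    (subdiv1 (@barycenter R m) w).
Proof.
move=> d0; have [n] := ubnP (size w); elim: n w Q => // n IH [|a w] Q lt sQ sw dw Qw.
  by apply: span_cell.
set w' := a :: w; set b := barycenter w'.
have bQ : Q b by exact: sQ.
have cb y : y \in w' -> close (shrink * d) b y by exact: close_barycenter.
have sQ' : stable (@barycenter R m) (fun y => Q y /\ close (shrink * d) b y).
  by move=> u su h; split; [apply: sQ|apply: stable_close] => // y /h[].
rewrite subdiv1E //; apply: (@span_extend _ _ (fun v => [/\ (size v).+1 = size w',
    diam_le (shrink * d) v & forall y, y \in v -> Q y /\ close (shrink * d) b y])).
  move=> v [sv dv hv]; apply: span_cell; split=> [|x y|y].
  - by rewrite /= sv.
  - have bb : close (shrink * d) b b by move=> j; rewrite subrr normr0 mulr_ge0 // shrink_ge0.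
    rewrite !inE => /orP[/eqP->|xv] /orP[/eqP->|yv] //.
    + by have [] := hv y yv.
    + by apply: closeC; have [] := hv x xv.
    + exact: dv.
  - by rewrite inE => /orP[/eqP->//|/hv[]].
apply: span_extend (formal_bd1_span _) => v [sv vw].
rewrite -sv; apply: (subspan _ (IH v _ _ sQ' _ _ _)).
- by move=> u [su du hu]; split=> //; rewrite su.
- by rewrite -ltnS sv.
- by rewrite ltnW // sv.
- by move=> x y /vw xw /vw yw; exact: dw.
- by move=> y /vw yw; split; [exact: Qw|exact: cb].
Qed.

Lemma iter_subdiv_mesh N : span (fun v => size v = m.+1 /\ diam_le (shrink ^+ N) v)
  (iter N (subdiv (@barycenter R m)) (cell (vertices R m))).
Proof.
elim: N => [|N IH] /=.
  by apply: span_cell; split; [exact: size_vertices|move=> x y _ _; exact: close1].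
apply: span_extend IH => v [sv dv].
have := @subdiv1_mesh (shrink ^+ N) (fun _ => True) v; rewrite -exprS => h.
apply: subspan (h _ _ _ dv _) => //; last by rewrite sv.
- by move=> u [-> du _].
- by rewrite exprn_ge0 // shrink_ge0.
Qed.

Lemma shrink_cvg (e : R) : 0 < e -> exists N, shrink ^+ N <= e.
Proof.
move=> e0; have : `|shrink| < 1 by rewrite ger0_norm ?shrink_ge0 // shrink_lt1.
move=> /(@cvg_expr R) /cvgrPdist_le /(_ _ e0) [N _ /(_ N)] /=.
rewrite leqnn sub0r normrN ger0_norm ?exprn_ge0 ?shrink_ge0 // => /(_ isT) h.
by exists N.
Qed.
End Closeness.

Section Lebesgue.
Variables (R : realType) (m : nat).

Lemma nbhs_close (p : simplex R m) e : 0 < e -> nbhs p (close e p).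
Proof.
move=> e0; apply: (@filter_forall _ _ (fun j q => `|bary p j - bary q j| <= e) (nbhs p)) => j.
have /cvgrPdist_le/(_ _ e0) := @bary_continuous R m j p; exact.
Qed.

Lemma close_nbhs (p : simplex R m) A : nbhs p A ->
  exists2 e, 0 < e & forall q, close e p q -> A q.
Proof.
rewrite nbhsE => -[_ [[B oB <-] Bp] BA].
have /nbhs_ballP[e /= e0 eB] : nbhs (val p) B by apply: open_nbhs_nbhs.
exists (e / 2); first by rewrite divr_gt0.
move=> q h; apply: BA; apply: eB; split=> // i j; rewrite [i]ord1.
rewrite /ball /=; apply: (le_lt_trans (h j)).
by rewrite ltr_pdivrMr // ltr_pMr // ltr1n.
Qed.

Lemma simplex_set_compact : compact (@simplex_set R m).
Proof.
have cI : compact [set v : 'rV[R]_m.+1 | forall i, v ord0 i \in `[0 : R, 1]].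
  apply: (@rV_compact _ _ (fun=> `[0 : R, 1]%classic)) => _; exact: segment_compact.
apply: subclosed_compact cI _ => [|p hp i]; last first.
  have hs : p \in @simplex_set R m by exact: mem_set.
  pose p' : simplex R m := exist _ p hs.
  by rewrite in_itv /=; apply/andP; split; [exact: (bary_ge0 p')|exact: (bary_le1 p')].
have -> : @simplex_set R m = (\bigcap_i ((fun p : 'rV[R]_m.+1 => p 0 i) @^-1` [set x | 0 <= x]))
    `&` ((fun p : 'rV[R]_m.+1 => \sum_i p 0 i) @^-1` [set 1]).
  by apply/seteqP; split=> p [h1 h2]; split=> // i; [move=> _|]; exact: h1.
apply: closedI.
  apply: closed_bigI => i _.
  have /continuous_closedP : continuous (fun p : 'rV[R]_m.+1 => p 0 i) by exact: coord_continuous.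
  by apply; exact: closed_ge.
have /continuous_closedP : continuous (fun p : 'rV[R]_m.+1 => \sum_i p 0 i : R).
  apply: (continuous_big (op := +%R)); first exact: add_continuous.
  by move=> i _; exact: coord_continuous.
by apply; exact: closed_eq.
Qed.

Lemma simplex_compact : compact [set: simplex R m].
Proof.
move=> F FF _; have FS : (val @ F) (@simplex_set R m).
  by apply: (@filterS _ F _ setT) => [p _ /=|]; [exact: set_mem (valP p)|exact: filterT].
have [p [Sp cp]] := simplex_set_compact (fmap_proper_filter _ FF) FS.
pose p' : simplex R m := exist _ p (mem_set Sp).
exists p'; split=> // A B FA; rewrite nbhsE => -[_ [[C oC <-] Cp] CB].
have [||q [[a Aa <-] Ca]] := cp (val @` A) C.
- by apply: (@filterS _ F _ A) => // a Aa; exists a.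
- exact: open_nbhs_nbhs.
by exists a; split=> //; exact: CB.
Qed.

(** A radius that works at a point works, once halved, near that point; compactness
   makes it uniform. *)
Lemma lebesgue_number (X : topologicalType) (J : Type) (V : J -> opens X) (s : sing R X m) :
  (forall p, (\bigcup_j V j) (s p)) ->
  exists2 e : R, 0 < e & forall p, exists j, forall q, close e p q -> opens_set (V j) (s q).
Proof.
move=> Vc.
pose P (e : R) p := exists j, forall q, close e p q -> opens_set (V j) (s q).
have cov : \forall e \near (0 : R)^'+, [set: simplex R m] `<=` P e.
  apply: ((compact_near_coveringP _).1 simplex_compact) => p _.
  have [j _ Vj] := Vc p.
  have /close_nbhs[e e0 he] : nbhs p (s @^-1` V j).
    have cs : {for p, continuous s} by exact: cts_fun.
    by apply: cs; apply: open_nbhs_nbhs; split=> //; exact: opens_open.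
  have e20 : 0 < e / 2 by rewrite divr_gt0.
  exists (close (e / 2) p, [set x : R | x <= e / 2]).
    split; first exact: nbhs_close.
    exact: nbhs_right_le.
  move=> [q x] [/= pq xe]; exists j => r qr; apply: he => //.
  rewrite [e]splitr; apply: close_trans pq _ => i.
  exact: le_trans (qr i) xe.
have pos : \forall e \near (0 : R)^'+, 0 < e by exact: nbhs_right_gt.
have [e [he e0]] := @filter_ex _ _ (at_right_proper_filter (0 : R)) _ (filterI cov pos).
by exists e => // p; exact: he.
Qed.
End Lebesgue.

(** * Small simplices *)

Section SmallSimplices.
Variables (R : realType) (X : topologicalType).
Notation anysing := (anysing R X).
Notation sing_bd := (@sing_bd R X).
Notation sing_subdiv_htpy := (@sing_subdiv_htpy R X).
Notation sing_subdiv := (@sing_subdiv R X).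

Lemma sing_face_face n (s : sing R X n.+2) (i j : 'I_n.+2) : (i <= j)%N ->
  sing_face i (sing_face (lift ord0 j) s) =
  sing_face j (sing_face (widen_ord (leqnSn n.+2) i) s).
Proof.
move=> ij; apply/continuousEP => p; rewrite /sing_face /= !simplex_map_comp.
by congr (s (simplex_map _ _)); apply/funext => m; exact: lift_lift.
Qed.

Lemma sing_bd_sing_bd1 (s : anysing) : sing_bd (sing_bd1 s) = 0.
Proof.
case: s => -[|[|n]] s; rewrite /= ?raddf0 //.
  rewrite /sing_bd raddf_sum big1 // => l _.
  by rewrite raddfMz /= extend_cellE mul0rz.
rewrite -[RHS](@alternating_sum2 (chains anysing) n.+2
  (fun l m => cell (asing (sing_face m (sing_face l s))))).
  by rewrite /sing_bd raddf_sum; apply: eq_bigr => l _; rewrite raddfMz.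
by move=> i j ij; rewrite sing_face_face.
Qed.

Lemma sing_bd_sing_bd x : is_chain x -> sing_bd (sing_bd x) = 0.
Proof.
move=> hx; rewrite /sing_bd [LHS]extend_extend.
by apply: extend0 hx => s _; exact: sing_bd_sing_bd1.
Qed.

Lemma sing_bd_sing_subdiv_htpy x : is_chain x ->
  sing_bd (sing_subdiv_htpy x) = x - sing_subdiv x - sing_subdiv_htpy (sing_bd x).
Proof.
elim=> [|s _|u v _ hu _ hv]; last 2 first.
- exact: sing_bd_sing_subdiv_htpy1.
- rewrite /sing_bd /sing_subdiv_htpy /sing_subdiv !extend_sub -!/(sing_subdiv_htpy _) -!/(sing_subdiv _) -!/(sing_bd _) hu hv.
  by rewrite [LHS]subrBB [X in X - _ = _]subrBB.
by rewrite /sing_bd /sing_subdiv_htpy /sing_subdiv !raddf0 !subr0.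
Qed.

(** Families of simplices closed under reparametrisation are preserved by faces and
   by subdivision. *)
Definition hereditary (S : anysing -> Prop) := forall m n (s : sing R X m)
  (g : continuousType (simplex R n) (simplex R m)), S (asing s) -> S (asing (s \o g)).

Section Hereditary.
Variable S : anysing -> Prop.
Hypothesis hS : hereditary S.

Lemma span_realize m (s : sing R X m) x : S (asing s) -> is_chain x -> span S (realize s x).
Proof.
move=> Ss; apply: span_extend => w _; rewrite /realize1.
case: (size w) => [|n]; [exact: span0|apply: span_cell; exact: hS].
Qed.

Lemma span_sing_subdiv x : span S x -> span S (sing_subdiv x).
Proof.
by apply: span_extend => -[n s] Ss; apply: span_realize => //; exact: is_chain_subdiv1.
Qed.

Lemma span_sing_subdiv_htpy x : span S x -> span S (sing_subdiv_htpy x).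
Proof.
by apply: span_extend => -[n s] Ss; apply: span_realize => //; exact: is_chain_subdiv_htpy1.
Qed.

Lemma span_sing_bd1 s : S s -> span S (sing_bd1 s).
Proof.
case: s => -[|n] s Ss /=; first exact: span0.
by apply: span_sum => l; apply: span_sign; apply: span_cell; exact: hS.
Qed.

Lemma span_sing_bd x : span S x -> span S (sing_bd x).
Proof. by apply: span_extend; exact: span_sing_bd1. Qed.
End Hereditary.

Lemma is_chain_sing_bd x : is_chain x -> is_chain (sing_bd x).
Proof. by apply: span_sing_bd. Qed.

Lemma sing_bd_sing_subdiv x : is_chain x -> sing_bd (sing_subdiv x) = sing_subdiv (sing_bd x).
Proof.
move=> hx; have e y : is_chain y ->
  sing_subdiv y = y - sing_subdiv_htpy (sing_bd y) - sing_bd (sing_subdiv_htpy y).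
  by move=> hy; rewrite (sing_bd_sing_subdiv_htpy hy) [y - sing_subdiv y - _]addrAC subKr.
rewrite (e x hx) (e (sing_bd x)); last exact: is_chain_sing_bd.
rewrite /sing_bd !extend_sub -!/(sing_bd _) !sing_bd_sing_bd //; last exact: span_sing_subdiv_htpy.
by rewrite /sing_subdiv_htpy raddf0 !subr0.
Qed.

Lemma subspan_is_chain S x : span S x -> is_chain (x : chains anysing).
Proof. exact: subspan. Qed.

Variables (J : Type) (V : J -> opens X).

Definition carried (A : set X) (s : anysing) := forall p, A (projT2 s p).

Definition small (s : anysing) := exists j, carried (V j) s.

Lemma hereditary_carried A : hereditary (carried A).
Proof. by move=> m n s g h p; exact: h. Qed.

Lemma hereditary_small : hereditary small.
Proof. by move=> m n s g [j h]; exists j => p; exact: h. Qed.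

Definition union := \bigcup_j opens_set (V j).

Lemma iter_sing_subdiv_realize N m (s : sing R X m) x : is_chain x ->
  iter N sing_subdiv (realize s x) = realize s (iter N (subdiv (@barycenter R m)) x).
Proof.
elim: N x => // N IH x hx; rewrite !iterSr sing_subdiv_realize // IH //.
exact: is_chain_subdiv.
Qed.

Lemma iter_sing_subdiv_small1 (s : anysing) : carried union s ->
  exists N, span small (iter N sing_subdiv (cell s)).
Proof.
case: s => m s hs; have [e e0 he] := @lebesgue_number R m X J V s hs.
have [N eN] := shrink_cvg m e0.
exists N; rewrite -[existT _ _ _]/(asing s) -realize_cell_vertices iter_sing_subdiv_realize;
  last first.
  exact: span_cell.
apply: span_extend (iter_subdiv_mesh R m N) => v [sv dv].
rewrite (realize1E s sv); apply: span_cell.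
have [j hj] := he (nth (corner R m) v 0).
exists j => p /=; apply: hj; apply: close_aff => // y yv i.
by apply: (le_trans _ eN); apply: dv => //; apply: mem_nth; rewrite sv.
Qed.

Lemma iter_sing_subdiv_span S N x : hereditary S -> span S x -> span S (iter N sing_subdiv x).
Proof. by move=> hS hx; elim: N => //= N IH; exact: span_sing_subdiv. Qed.

Lemma iter_sing_subdiv_sub N x y :
  iter N sing_subdiv (x - y) = iter N sing_subdiv x - iter N sing_subdiv y.
Proof. by elim: N => //= N ->. Qed.

Lemma iter_sing_subdiv_small x : span (carried union) x ->
  exists N, span small (iter N sing_subdiv x).
Proof.
elim=> [|s hs|u v _ [M hM] _ [N hN]].
- by exists 0%N; exact: span0.
- exact: iter_sing_subdiv_small1.
exists (M + N)%N; rewrite iter_sing_subdiv_sub; apply: spanB.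
  by rewrite addnC iterD; apply: iter_sing_subdiv_span => //; exact: hereditary_small.
by rewrite iterD; apply: iter_sing_subdiv_span => //; exact: hereditary_small.
Qed.

(** An iterated subdivision of [x] is small.  It is homotopic to the identity
   by operators that preserve small chains, so that the error terms coming from the
   small boundary of [x] are small. *)
Lemma small_relative_acyclic x : span (carried union) x -> span small (sing_bd x) ->
  exists2 y, span (carried union) y & span small (x - sing_bd y).
Proof.
move=> hx asing; have [N hN] := iter_sing_subdiv_small hx.
suff [y hy sy] : exists2 y, span (carried union) y & span small (x - iter N sing_subdiv x - sing_bd y).
  by exists y => //; have := spanD sy hN; rewrite addrAC subrK.
elim: N {hN} => [|N [y hy IH]].
  by exists 0; [exact: span0|rewrite /sing_bd raddf0 subrr subr0; exact: span0].
set z := iter N sing_subdiv x in IH *.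
have hz : span (carried union) z by apply: iter_sing_subdiv_span => //; exact: hereditary_carried.
have sbdz : sing_bd z = iter N sing_subdiv (sing_bd x).
  rewrite /z; elim: N {z IH hz} => //= N <-; rewrite sing_bd_sing_subdiv //.
  by apply: subspan_is_chain (iter_sing_subdiv_span _ _ hx); exact: hereditary_carried.
exists (y + sing_subdiv_htpy z).
  by apply: spanD => //; apply: span_sing_subdiv_htpy => //; exact: hereditary_carried.
rewrite /= -/z [sing_bd (y + _)]extend_add -!/(sing_bd _) sing_bd_sing_subdiv_htpy;
  last exact: subspan_is_chain hz.
have -> : x - sing_subdiv z - (sing_bd y + (z - sing_subdiv z - sing_subdiv_htpy (sing_bd z))) =
    (x - z - sing_bd y) + sing_subdiv_htpy (sing_bd z).
  rewrite [z - _ - _]addrAC [sing_bd y + _]addrA opprB subrKA.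
  by rewrite opprD opprB !addrA [LHS]addrAC [x - sing_bd y - z]addrAC.
apply: spanD => //; apply: span_sing_subdiv_htpy; first exact: hereditary_small.
by rewrite sbdz; apply: iter_sing_subdiv_span => //; exact: hereditary_small.
Qed.
End SmallSimplices.

(** * Cochains that vanish on small simplices *)

Section SmallContraction.
Variables (R : realType) (X : topologicalType) (J : Type) (V : J -> opens X).
Hypothesis V_cover : \bigcup_j V j = [set: X].
Notation anysing := (anysing R X).
Notation sing_bd := (@sing_bd R X).

(** Zero on small simplices, so that the contraction kills small chains. *)
Definition relative_filling (s : anysing) (x : chains anysing) : chains anysing :=
  if pselect (small V s) then 0 else
  xget 0 [set y | is_chain y /\ span (small V) (x - sing_bd y)].

(** Chains modulo small chains form an acyclic free complex, hence a contractible
   one.  The contraction is chosen on the simplices, in order of dimension. *)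
Fixpoint small_htpy_rec n : sing R X n -> chains anysing :=
  match n return sing R X n -> chains anysing with
  | 0 => fun s => relative_filling (asing s) (cell (asing s))
  | n'.+1 => fun s => relative_filling (asing s) (cell (asing s) -
      \sum_(l < n'.+2) small_htpy_rec (sing_face l s) *~ (-1) ^+ l)
  end.

Definition small_htpy1 (s : anysing) := small_htpy_rec (projT2 s).
Definition small_htpy := extend small_htpy1.

Lemma small_htpy1E (s : anysing) :
  small_htpy1 s = relative_filling s (cell s - small_htpy (sing_bd1 s)).
Proof.
case: s => -[|n] s; rewrite /small_htpy1 /=; first by rewrite /small_htpy raddf0 subr0.
by congr (relative_filling _ (_ - _)); rewrite /small_htpy raddf_sum; apply: eq_bigr => l _;
  rewrite raddfMz.
Qed.

Lemma small_htpy1_small s : small V s -> small_htpy1 s = 0.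
Proof. by move=> h; rewrite small_htpy1E /relative_filling; case: pselect. Qed.

Lemma small_htpy_small x : span (small V) x -> small_htpy x = 0.
Proof. exact: (extend0 small_htpy1_small). Qed.

Lemma sing_bd1_dim s : span (fun t => (projT1 t).+1 = projT1 s) (sing_bd1 s : chains anysing).
Proof.
case: s => -[|n] s /=; first exact: span0.
by apply: span_sum => l; apply: span_sign; exact: span_cell.
Qed.

Lemma sing_bd1_dim0 s : projT1 s = 0%N -> sing_bd1 s = 0 :> chains anysing.
Proof. by case: s => -[]. Qed.

Lemma carried_all (s : anysing) : carried (union V) s.
Proof. by move=> p; rewrite /union V_cover. Qed.

(** By induction, the chain to be filled is closed modulo small chains. *)
Lemma small_htpy1P s : is_chain (small_htpy1 s) /\
  span (small V) (cell s - small_htpy (sing_bd1 s) - sing_bd (small_htpy1 s)).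
Proof.
move: s; suff : forall n s, projT1 s = n -> is_chain (small_htpy1 s) /\
    span (small V) (cell s - small_htpy (sing_bd1 s) - sing_bd (small_htpy1 s)).
  by move=> h s; exact: (h _ s erefl).
elim=> [|n IH] s es; rewrite small_htpy1E /relative_filling; case: pselect => [sm|nsm] /=.
- split; first exact: span0.
  rewrite (@small_htpy_small (sing_bd1 s)); last exact: (span_sing_bd1 (@hereditary_small _ _ _ V)).
  by rewrite /sing_bd raddf0 !subr0; exact: span_cell.
- have -> : sing_bd1 s = 0 by exact: sing_bd1_dim0.
  rewrite /small_htpy raddf0 subr0.
  have [||y yc ys] := @small_relative_acyclic R X J V (cell s).
  + by apply: span_cell; exact: carried_all.
  + rewrite /sing_bd extend_cellE; have -> : sing_bd1 s = 0 by exact: sing_bd1_dim0.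
  + exact: span0.
  apply: (xgetPex 0 (P := [set y | is_chain y /\ span (small V) (cell s - sing_bd y)])).
  by exists y; split=> //; exact: subspan yc.
- split; first exact: span0.
  rewrite (@small_htpy_small (sing_bd1 s)); last exact: (span_sing_bd1 (@hereditary_small _ _ _ V)).
  by rewrite /sing_bd raddf0 !subr0; exact: span_cell.
set x := cell s - _.
have dims := sing_bd1_dim s; rewrite es in dims.
have IHe : span (small V) (sing_bd1 s - small_htpy (sing_bd (sing_bd1 s)) - sing_bd (small_htpy (sing_bd1 s))).
  have -> : sing_bd1 s - small_htpy (sing_bd (sing_bd1 s)) - sing_bd (small_htpy (sing_bd1 s)) =
      extend (fun t => cell t - small_htpy (sing_bd1 t) - sing_bd (small_htpy1 t)) (sing_bd1 s).
    by rewrite !(extendB _ _ dims).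
  by apply: span_extend dims => t [et]; have [] := IH t et.
have chD : is_chain (small_htpy (sing_bd1 s)).
  by apply: span_extend dims => t [et]; have [] := IH t et.
apply: (xgetPex 0 (P := [set y | is_chain y /\ span (small V) (x - sing_bd y)])).
have [||y yc ys] := @small_relative_acyclic R X J V x.
- apply: spanB; first by apply: span_cell; exact: carried_all.
  by apply: subspan chD => t _; exact: carried_all.
- by move: IHe; rewrite sing_bd_sing_bd1 /small_htpy raddf0 subr0 /x /sing_bd extend_sub.
by exists y; split=> //; exact: subspan yc.
Qed.

Variable k : nat.
Variable alpha : singular_complex R X k.
Hypothesis alpha_closed : dif (singular_complex R X) alpha = 0.

(** Makes it possible to evaluate [alpha] on chains that carry no degree. *)
Definition total_cochain (s : anysing) : int := spread alpha (projT1 s) (projT2 s).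

Lemma total_cochain_asing (s : sing R X k) : total_cochain (asing s) = alpha s.
Proof. by rewrite /total_cochain spreadE. Qed.

Lemma chain0 (x : chains anysing) : is_chain x -> x (fun _ => 0) = 0.
Proof. by elim=> // u v _ hu _ hv; rewrite !fctE hu hv subr0. Qed.

Lemma total_cochain_sing_bd1 s : sing_bd1 s total_cochain = 0.
Proof.
case: s => -[|n] s //=; have := @spread_closed _ k alpha n alpha_closed.
move=> /(congr1 (fun f : sing_cochain R X n.+1 => f s)) /= h.
transitivity (- (sing_dif (spread alpha n) s)); last by rewrite h oppr0.
by rewrite /sing_dif opprK eval_signed_sum.
Qed.

Lemma total_cochain_sing_bd x : is_chain x -> sing_bd x total_cochain = 0.
Proof.
move=> hx; rewrite /sing_bd /extend; under eq_fun do rewrite total_cochain_sing_bd1.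
exact: chain0.
Qed.

Hypothesis alpha_small : forall s, small V (asing s) -> alpha s = 0.

Lemma total_cochain_small x : span (small V) x -> x total_cochain = 0.
Proof.
elim=> // [[n s]|u v _ hu _ hv]; last by rewrite !fctE hu hv subr0.
move=> h; rewrite /cell /total_cochain /=; move: s h.
exact: (@spread_elim _ (fun n (a : singular_complex R X n) =>
  forall s, small V (asing s) -> a s = 0)).
Qed.

(** In the contraction identity, a closed cochain that vanishes on small chains
   kills the small error and the boundary. *)
Lemma total_cochain_small_htpy s : total_cochain s = small_htpy (sing_bd1 s) total_cochain.
Proof.
have [hc /total_cochain_small] := small_htpy1P s.
by rewrite !fctE (total_cochain_sing_bd hc) subr0 => /eqP; rewrite subr_eq0 => /eqP.
Qed.
End SmallContraction.

Lemma small_kernel0 (R : realType) (X : topologicalType) (J : Type) (V : J -> opens X)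
    (V_cover : \bigcup_j V j = [set: X]) (alpha : singular_complex R X 0) :
  dif (singular_complex R X) alpha = 0 ->
  (forall s, small V (asing s) -> alpha s = 0) -> alpha = 0.
Proof.
move=> ac asm; apply/funext => s.
rewrite -total_cochain_asing (total_cochain_small_htpy V_cover ac asm) /=.
by rewrite /small_htpy raddf0.
Qed.

(** Composition with the contraction is a primitive.  It vanishes on small
   simplices because the contraction does. *)
Lemma small_kernel (R : realType) (X : topologicalType) (J : Type) (V : J -> opens X)
    (V_cover : \bigcup_j V j = [set: X]) k (alpha : singular_complex R X k.+1) :
  dif (singular_complex R X) alpha = 0 ->
  (forall s, small V (asing s) -> alpha s = 0) ->
  exists2 beta : singular_complex R X k, (forall s, small V (asing s) -> beta s = 0) &
    alpha = dif (singular_complex R X) beta.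
Proof.
move=> ac asm; exists (fun s => - small_htpy1 V (asing s) (total_cochain alpha)).
  by move=> s /small_htpy1_small ->; rewrite oppr0.
apply/funext => s; rewrite -total_cochain_asing (total_cochain_small_htpy V_cover ac asm) /=.
rewrite /sing_dif /small_htpy /extend eval_signed_sum -sumrN.
by apply: eq_bigr => l _; rewrite mulNrz opprK.
Qed.

(** * Cones *)

Section FaceCoordinates.
Variables (R : realType) (n : nat).

Lemma bary_face_lift (l : 'I_n.+2) (p : simplex R n) i :
  bary (simplex_map (lift l) p) (lift l i) = bary p i.
Proof.
by rewrite simplex_mapE (big_pred1 i) // => j /=; rewrite (inj_eq lift_inj).
Qed.

Lemma bary_face_self (l : 'I_n.+2) (p : simplex R n) :
  bary (simplex_map (lift l) p) l = 0.
Proof.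
by rewrite simplex_mapE big_pred0 // => i; rewrite eq_sym; apply: negbTE; exact: neq_lift.
Qed.

Lemma lift_lift_ord0 (l : 'I_n.+2) : lift (lift ord0 l) ord0 = ord0 :> 'I_n.+3.
Proof. exact: val_inj. Qed.

Lemma lift_lift_lift (l : 'I_n.+2) (i : 'I_n.+1) :
  lift (lift ord0 l) (lift ord0 i) = lift ord0 (lift l i) :> 'I_n.+3.
Proof. by apply: val_inj; rewrite /= /bump /= !add1n ltnS addnS. Qed.
End FaceCoordinates.

Section Cone.
Variables (R : realType).

Section Rest.
Variable n : nat.
Implicit Types p : simplex R n.+1.

(** The mass of the face opposite to the apex, kept at least 1/2 so that dividing by
   it is continuous at the apex. *)
Definition opp_mass p : R := Num.max (1 - bary p ord0) 2^-1.

Lemma opp_mass_gt0 p : 0 < opp_mass p.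
Proof. by rewrite lt_max; apply/orP; right; rewrite invr_gt0. Qed.

Fact rest_subproof p :
  (\row_i ((bary p (lift ord0 i) +
    (if i == ord0 then opp_mass p - (1 - bary p ord0) else 0)) / opp_mass p))
  \in @simplex_set R n.
Proof.
apply/mem_set; split=> [i|].
  rewrite mxE mulr_ge0 ?invr_ge0 ?(ltW (opp_mass_gt0 p)) // addr_ge0 ?bary_ge0 //.
  by case: eqP => // _; rewrite subr_ge0 le_max lexx.
under eq_bigr do rewrite mxE.
rewrite -mulr_suml big_split /= -big_mkcond big_pred1_eq.
have := bary_sum1 p; rewrite big_ord_recl => /(canRL (addKr _)) ->.
rewrite addrC [- _ + 1]addrC subrK mulfV // gt_eqF //; exact: opp_mass_gt0.
Qed.

(** The projection from the apex onto the opposite face.  Where the mass is truncated,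
   the deficit is put on the vertex 0; there the cone is constant, so this
   choice does not show in it. *)
Definition rest p : simplex R n := exist (fun q => q \in @simplex_set R n) _ (rest_subproof p).

Lemma restE p i : bary (rest p) i = (bary p (lift ord0 i) +
  (if i == ord0 then opp_mass p - (1 - bary p ord0) else 0)) / opp_mass p.
Proof. by rewrite {1}/bary /= mxE. Qed.

Lemma restE_low p i : bary p ord0 <= 2^-1 ->
  bary (rest p) i = bary p (lift ord0 i) / (1 - bary p ord0).
Proof.
move=> h; rewrite restE.
have -> : opp_mass p = 1 - bary p ord0 by apply/max_idPl; lra.
by rewrite subrr; case: eqP; rewrite addr0.
Qed.

Lemma opp_mass_continuous : continuous opp_mass.
Proof.
have c1 : continuous (fun p : simplex R n.+1 => 1 - bary p ord0).
  move=> p; apply: (@cvgB _ R^o);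
    [exact: nbhs_filter|exact: (@cst_continuous (simplex R n.+1) R^o)|exact: bary_continuous].
move=> p; apply: (@continuous_max R (simplex R n.+1) (fun p => 1 - bary p ord0) (fun=> 2^-1) p).
  exact: c1.
exact: (@cst_continuous (simplex R n.+1) R^o).
Qed.

Lemma rest_continuous : continuous rest.
Proof.
apply: simplex_continuous => i.
under [X in continuous X]eq_fun do rewrite restE.
move=> p; apply: (@cvgM _ _ _ (nbhs_filter p)); last first.
  apply: cvgV; [by rewrite gt_eqF // opp_mass_gt0|exact: opp_mass_continuous].
apply: (@cvgD _ R^o); first exact: bary_continuous.
case: eqP => _; last exact: (@cst_continuous (simplex R n.+1) R^o).
apply: (@cvgB _ R^o); first exact: opp_mass_continuous.
apply: (@cvgB _ R^o); last exact: bary_continuous.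
exact: (@cst_continuous (simplex R n.+1) R^o).
Qed.
End Rest.

Fact clamp_unit_subproof (t : R) : clamp t \in (`[0, 1]%classic : set R).
Proof. by rewrite inE /= in_itv /= clamp_ge0 clamp_le1. Qed.

Definition clamp_unit (t : R) : unit_interval R := exist _ (clamp t) (clamp_unit_subproof t).

Lemma clamp_unit_continuous : continuous clamp_unit.
Proof. apply: set_type_continuous; exact: clamp_continuous. Qed.

Lemma clamp_unit_0 : clamp_unit 0 = I0 R.
Proof. by apply: val_inj; rewrite /= /clamp maxxx (min_idPr ler01). Qed.

Lemma clamp_unit_ge1 t : 1 <= t -> clamp_unit t = I1 R.
Proof.
move=> h; apply: val_inj; rewrite /= /clamp (max_idPr (le_trans ler01 h)).
exact: min_idPl.
Qed.

Variable Y : topologicalType.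
Variables (H : continuousType (Y * unit_interval R)%type Y) (y : Y).
Hypothesis H0 : forall z, H (z, I0 R) = z.
Hypothesis H1 : forall z, H (z, I1 R) = y.

Section ConeSimplex.
Variables (n : nat) (s : sing R Y n).

(** The null homotopy runs at double speed and has reached its end wherever the
   projection [rest] is truncated. *)
Definition cone_fun (p : simplex R n.+1) : Y := H (s (rest p), clamp_unit (2 * bary p ord0)).

Fact cone_continuous : continuous cone_fun.
Proof.
move=> p; apply: (@continuous_comp _ _ _
  (fun p : simplex R n.+1 => (s (rest p), clamp_unit (2 * bary p ord0))) H); last exact: cts_fun.
have c1 : {for p, continuous (fun p => s (rest p))}.
  by apply: (@continuous_comp _ _ _ (@rest n) s); [exact: rest_continuous|exact: cts_fun].
have c2 : {for p, continuous (fun p : simplex R n.+1 => clamp_unit (2 * bary p ord0))}.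
  apply: (@continuous_comp _ _ _ (fun p : simplex R n.+1 => 2 * bary p ord0) clamp_unit);
    last exact: clamp_unit_continuous.
  apply: (@cvgM _ _ _ (nbhs_filter p)); last exact: bary_continuous.
  exact: (@cst_continuous (simplex R n.+1) R^o).
exact: (@cvg_pair _ _ _ _ _ _ (nbhs_filter p) (nbhs_filter _) (nbhs_filter _) _ _ c1 c2).
Qed.
HB.instance Definition _ :=
  isContinuous.Build (simplex R n.+1) Y cone_fun cone_continuous.

Definition cone : sing R Y n.+1 := cone_fun.

Lemma coneE p : cone p = H (s (rest p), clamp_unit (2 * bary p ord0)). Proof. by []. Qed.

Lemma cone_high p : 2^-1 <= bary p ord0 -> cone p = y.
Proof. by move=> h; rewrite coneE clamp_unit_ge1 ?H1 //; lra. Qed.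
End ConeSimplex.

Definition apex : sing R Y 0 := cst y.

Lemma cone_face0 n (s : sing R Y n) : sing_face ord0 (cone s) = s.
Proof.
apply/continuousEP => p; rewrite [LHS]coneE bary_face_self mulr0 clamp_unit_0 H0.
congr (s _); apply: bary_inj => i.
by rewrite restE_low bary_face_self ?invr_ge0 // subr0 divr1 bary_face_lift.
Qed.

Lemma cone_faceS n (s : sing R Y n.+1) (l : 'I_n.+2) :
  sing_face (lift ord0 l) (cone s) = cone (sing_face l s).
Proof.
apply/continuousEP => p; rewrite [LHS]/=; set p' := simplex_map _ p.
have e0 : bary p' ord0 = bary p ord0.
  by rewrite -[in LHS](lift_lift_ord0 l) bary_face_lift.
case: (leP 2^-1 (bary p ord0)) => [h|/ltW h].
  by rewrite -!/(cone _ _) !cone_high // e0.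
rewrite [LHS]coneE [RHS]coneE e0; congr (H (s _, _)).
apply: bary_inj => j; rewrite restE_low e0 // /p' simplex_mapE.
transitivity (\sum_(i | lift l i == j) bary (rest p) i); last exact/esym/simplex_mapE.
under [RHS]eq_bigr do rewrite restE_low //.
rewrite -mulr_suml; congr (_ / _).
rewrite [LHS]big_mkcond big_ord_recl lift_lift_ord0 /= add0r -big_mkcond.
by apply: eq_bigl => i; rewrite lift_lift_lift (inj_eq lift_inj).
Qed.

Lemma cone_face_apex (s : sing R Y 0) : sing_face (lift ord0 ord0) (cone s) = apex.
Proof.
apply/continuousEP => p.
have e : bary (simplex_map (lift (lift ord0 ord0)) p) ord0 = 1.
  have {2}-> : ord0 = lift (lift ord0 ord0) ord0 :> 'I_2 by exact: val_inj.
  by rewrite bary_face_lift -(bary_sum1 p) big_ord1.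
apply: (@cone_high _ s (simplex_map (lift (lift ord0 ord0)) p)).
by rewrite e invf_le1 // ler1n.
Qed.

(** Among the faces of a cone are its base and the cones over the faces of the base,
   so evaluation on cones contracts the cochains. *)
Lemma cone_exact n (c : sing_cochain R Y n.+1) : sing_dif c = 0 ->
  exists h : sing_cochain R Y n, c = sing_dif h.
Proof.
move=> hc; exists (fun s => - c (cone s)); apply/funext => s.
have := congr1 (fun b : sing_cochain R Y n.+2 => b (cone s)) hc.
rewrite /sing_dif /= => /eqP; rewrite oppr_eq0 big_ord_recl expr0 mulr1z cone_face0.
rewrite addr_eq0 => /eqP ->; congr (- _); apply: eq_bigr => l _.
by rewrite cone_faceS /= /bump /= add1n exprS mulN1r mulrNz mulNrz.
Qed.

Lemma cone_const (c : sing_cochain R Y 0) s : sing_dif c = 0 -> c s = c apex.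
Proof.
move=> hc; have := congr1 (fun b : sing_cochain R Y 1 => b (cone s)) hc.
rewrite /sing_dif /= => /eqP; rewrite oppr_eq0 big_ord_recl big_ord1 cone_face0.
by rewrite cone_face_apex /= /bump /= expr0 expr1 mulrNz subr_eq0 => /eqP.
Qed.
End Cone.

(** * Acyclic sets *)

Section SpanI.
Variables (A : Type) (S T : A -> Prop).

Definition select1 (a : A) : chains A := if pselect (S a) then cell a else 0.

(** Discarding the cells outside [S] leaves [x] unchanged, and it does not
   enlarge the support in [T]. *)
Lemma spanI x : span S x -> span T x -> span (fun a => S a /\ T a) x.
Proof.
move=> hS hT; have -> : x = extend select1 x.
  rewrite -[LHS]extend_cell; apply: eq_extend hS => a Sa.
  by rewrite /select1; case: pselect.
apply: span_extend hT => a Ta; rewrite /select1; case: pselect => [Sa|_] /=.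
  exact: span_cell.
exact: span0.
Qed.
End SpanI.

Section Acyclic.
Variables (R : realType) (X : topologicalType).
Notation anysing := (anysing R X).
Notation sing_bd := (@sing_bd R X).

Definition unit_cochain (s : anysing) : int := (projT1 s == 0%N)%:Z.
Definition aug (x : chains anysing) : int := x unit_cochain.

Fact aug_zmod : zmod_morphism aug. Proof. by []. Qed.
HB.instance Definition _ := GRing.isZmodMorphism.Build (chains anysing) int aug aug_zmod.

Lemma aug_sing_bd1 s : aug (sing_bd1 s) = 0.
Proof.
case: s => -[|[|n]] s //; rewrite /aug /sing_bd1 eval_signed_sum.
  by rewrite big_ord_recl big_ord1 /cell /unit_cochain /= expr0 expr1 mulrNz subrr.
by rewrite big1 // => l _; rewrite mul0rz.
Qed.

Lemma aug_sing_bd x : is_chain x -> aug (sing_bd x) = 0.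
Proof.
elim=> [|s _|u v _ hu _ hv]; [by rewrite /sing_bd raddf0|exact: aug_sing_bd1|].
by rewrite /sing_bd extend_sub raddfB /= hu hv subrr.
Qed.

Definition point (x : X) : anysing := asing (cst x : sing R X 0).

Lemma aug_point x : aug (cell (point x)) = 1. Proof. by []. Qed.

(** Vanishing of reduced singular homology, in all degrees at once. *)
Definition acyclic (A : set X) := A !=set0 /\
  forall z, span (carried A) z -> sing_bd z = 0 -> aug z = 0 ->
  exists2 y, span (carried A) y & sing_bd y = z.

Section Contractible.
Variable A : set X.

Definition corestrict n (s : sing R X n) (h : carried A (asing s)) (p : simplex R n) : set_type A :=
  exist _ (s p) (mem_set (h p)).

Fact corestrict_continuous n s (h : carried A (@asing R X n s)) : continuous (corestrict h).
Proof. by apply: set_type_continuous; exact: cts_fun. Qed.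
HB.instance Definition _ n s h := isContinuous.Build (simplex R n) (set_type A)
  (@corestrict n s h) (@corestrict_continuous n s h).

Definition to_sub n (s : sing R X n) (h : carried A (asing s)) : sing R (set_type A) n :=
  corestrict h.

Definition of_sub n (s : sing R (set_type A) n) : sing R X n := @sub_val X A \o s.

Lemma to_subK n (s : sing R X n) (h : carried A (asing s)) : of_sub (to_sub h) = s.
Proof. exact/continuousEP. Qed.

Lemma of_subK n (s : sing R (set_type A) n) (h : carried A (asing (of_sub s))) : to_sub h = s.
Proof. by apply/continuousEP => p; exact: val_inj. Qed.

Lemma carried_of_sub n (s : sing R (set_type A) n) : carried A (asing (of_sub s)).
Proof. by move=> p; exact: set_mem (valP (s p)). Qed.

Lemma of_sub_face n (s : sing R (set_type A) n.+1) l :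
  of_sub (sing_face l s) = sing_face l (of_sub s).
Proof. exact/continuousEP. Qed.

(** Coning with the null homotopy contracts the chains onto the point where it
   ends. *)
Lemma contractible_acyclic : contractible R (set_type A) -> acyclic A.
Proof.
move=> [y [H hH]]; have H0 z : H (z, I0 R) = z by have [] := hH z.
have H1 z : H (z, I1 R) = y by have [] := hH z.
split; first by exists (val y); exact: set_mem (valP y).
pose k1 (s : anysing) : chains anysing := if pselect (carried A (asing (projT2 s))) is left h
  then cell (asing (of_sub (cone H (to_sub h)))) else 0.
have k1E n (s : sing R (set_type A) n) : k1 (asing (of_sub s)) = cell (asing (of_sub (cone H s))).
  rewrite /k1; case: pselect => [h|[]]; last exact: carried_of_sub.
  by rewrite of_subK.
pose pt := cell (point (val y)).
have key s : carried A s -> sing_bd (k1 s) = cell s - extend k1 (sing_bd1 s) - pt *~ aug (cell s).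
  case: s => n s hs; rewrite -(to_subK hs); move: (to_sub hs) => {hs}s.
  rewrite -[existT _ _ _]/(asing (of_sub s)) k1E [LHS]extend_cellE /=.
  rewrite big_ord_recl expr0 mulr1z -of_sub_face (cone_face0 H0) -addrA; congr (_ + _).
  case: n s => [|n] s.
    rewrite big_ord1 -of_sub_face (cone_face_apex H1) expr1 mulrNz mulr1z raddf0 sub0r mulr1z.
    by congr (- cell (asing _)); exact/continuousEP.
  rewrite mulr0z subr0 raddf_sum -sumrN; apply: eq_bigr => l _.
  rewrite -of_sub_face (cone_faceS H1) raddfMz /= extend_cellE -of_sub_face k1E.
  by rewrite /bump /= add1n exprS mulN1r mulrNz.
have keyx x : span (carried A) x ->
    sing_bd (extend k1 x) = x - extend k1 (sing_bd x) - pt *~ aug x.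
  elim=> [|s hs|u v _ hu _ hv]; last 2 first.
  - exact: key.
  - have sB a b : sing_bd (a - b) = sing_bd a - sing_bd b by [].
    have kB a b : extend k1 (a - b) = extend k1 a - extend k1 b by [].
    have aB a b : aug (a - b) = aug a - aug b by [].
    rewrite !(kB, sB, aB) hu hv mulrzBr.
    by rewrite [LHS]subrBB [X in X - _ = _]subrBB.
  by rewrite -[RHS]/(0 - 0 - pt *~ 0) mulr0z !subr0.
move=> z hz bz az; exists (extend k1 z).
  apply: span_extend hz => -[n s] hs; rewrite -(to_subK hs).
  rewrite -[existT _ _ _]/(asing (of_sub (to_sub hs))) k1E; apply: span_cell.
  exact: carried_of_sub.
by rewrite keyx // bz az mulr0z subr0 [extend k1 0]raddf0 subr0.
Qed.
End Contractible.

Lemma sing_bdB x y : sing_bd (x - y) = sing_bd x - sing_bd y. Proof. by []. Qed.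
Lemma sing_bdD x y : sing_bd (x + y) = sing_bd x + sing_bd y. Proof. by []. Qed.

Lemma span_carriedS (A B : set X) (x : chains anysing) : A `<=` B -> span (carried A) x ->
  span (carried B) x.
Proof. by move=> AB; apply: subspan => s h p; exact/AB/h. Qed.

Lemma carried_chain A (x : chains anysing) : span (carried A) x -> is_chain x.
Proof. exact: subspan. Qed.

(** Mayer-Vietoris on chains.  After subdivision the cycle is [a + b] with [a] and
   [b] in the two pieces.  Their common boundary is filled by [w] in the
   intersection, and [a - w], [b + w] are filled in the pieces. *)
Lemma acyclicU (A B : set X) : open A -> open B ->
  acyclic A -> acyclic B -> acyclic (A `&` B) -> acyclic (A `|` B).
Proof.
move=> oA oB [[a0 Aa0] hA] [_ hB] [[p [Ap Bp]] hAB]; split; first by exists a0; left.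
move=> z hz bz az.
pose V (i : bool) : opens X := if i then Opens oA else Opens oB.
have uV : A `|` B = union V.
  apply/seteqP; split=> [x [h|h]|x [[] _ h]]; [by exists true|by exists false|by left|by right].
have [||y hy sy] := @small_relative_acyclic R X bool V z.
- by rewrite -uV.
- by rewrite bz; exact: span0.
set x := z - sing_bd y in sy.
have bx : sing_bd x = 0.
  by rewrite /x sing_bdB bz sing_bd_sing_bd ?subrr //; exact: carried_chain hy.
have ax : aug x = 0 by rewrite /x raddfB /= az aug_sing_bd ?subrr //; exact: carried_chain hy.
have [a [b [ha hb exy]]] : exists a b,
    [/\ span (carried A) a, span (carried B) b & x = a + b].
  elim: sy {bx ax} => [|s [[] h]|u v _ [a [b [ha hb ->]]] _ [a' [b' [ha' hb' ->]]]].
  - by exists 0, 0; rewrite addr0; split=> //; exact: span0.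
  - by exists (cell s), 0; rewrite addr0; split=> //; [exact: span_cell|exact: span0].
  - by exists 0, (cell s); rewrite add0r; split=> //; [exact: span0|exact: span_cell].
  - exists (a - a'), (b - b'); split; [exact: spanB|exact: spanB|exact: subrDD].
have eab : sing_bd a = - sing_bd b.
  by apply/eqP; rewrite -addr_eq0 -sing_bdD -exy bx.
have hc : span (carried (A `&` B)) (sing_bd a).
  apply: (@subspan _ (fun s => carried A s /\ carried B s)).
    by move=> s [h1 h2] q; split; [exact: h1|exact: h2].
  apply: spanI; first by apply: span_sing_bd => //; exact: hereditary_carried.
  by rewrite eab; apply: spanN; apply: span_sing_bd => //; exact: hereditary_carried.
have [||w hw bw] := hAB (sing_bd a) hc.
- by rewrite sing_bd_sing_bd //; exact: carried_chain ha.
- by rewrite aug_sing_bd //; exact: carried_chain ha.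
(* A multiple of a point of the intersection moves the augmentation to zero on
   both pieces. *)
pose e := aug a - aug w; pose q := cell (point p) *~ e.
have bq : sing_bd q = 0 by rewrite /q /sing_bd raddfMz /= mul0rz.
have aq : aug q = e by rewrite /q raddfMz /= aug_point intz.
have hq (C : set X) : C p -> span (carried C) q.
  by move=> Cp; apply: span_mulz; apply: span_cell.
have [|||u hu bu] := hA (a - w - q).
- apply: spanB; last exact: hq.
  by apply: spanB => //; apply: span_carriedS hw => ? [].
- by rewrite !sing_bdB bq bw subr0 subrr.
- by rewrite (_ : aug _ = aug a - aug w - aug q) // aq subrr.
have [|||v hv bv] := hB (b + w + q).
- apply: spanD; last exact: hq.
  by apply: spanD => //; apply: span_carriedS hw => ? [].
- by rewrite !sing_bdD bq bw addr0 eab subrr.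
- rewrite (_ : aug _ = aug b + aug w + aug q) // aq /e -addrA [aug w + _]addrC subrK.
  by rewrite addrC -ax exy.
exists (y + u + v).
  apply: spanD; last by apply: span_carriedS hv => ? ?; right.
  apply: spanD; first by rewrite uV.
  by apply: span_carriedS hu => ? ?; left.
rewrite !sing_bdD bu bv -addrA.
have -> : a - w - q + (b + w + q) = x.
  by rewrite exy -[b + w + q]addrA -[a - w - q]addrA -opprD addrACA addNr addr0.
by rewrite /x addrC subrK.
Qed.

Section Cover.
Variables (I : eqType) (U : I -> opens X).

Definition meets (t : seq I) := [set x | forall j, j \in t -> opens_set (U j) x].
Definition joins (t : seq I) := [set x | exists2 j, j \in t & opens_set (U j) x].

Lemma open_joins t : open (joins t).
Proof.
have -> : joins t = \bigcup_(j in [set j | j \in t]) opens_set (U j).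
  by apply/seteqP; split=> x [j jt h]; exists j.
by apply: bigcup_open => j _; exact: opens_open.
Qed.

(** The open set [W] is there for the induction, whose hypothesis has to apply to the
   intersection of the first member with the union of the others. *)
Lemma acyclic_joins (W : set X) (t : seq I) : open W -> t != [::] ->
  (forall r, subseq r t -> r != [::] -> acyclic (W `&` meets r)) ->
  acyclic (W `&` joins t).
Proof.
elim: t W => [//|j t IH] W oW _ h.
have ej : W `&` meets [:: j] = W `&` U j.
  apply/seteqP; split=> x [Wx hx]; split=> //; first by apply: hx; rewrite inE.
  by move=> i; rewrite inE => /eqP ->.
have aj : acyclic (W `&` U j) by rewrite -ej; apply: h => //=; rewrite eqxx sub0seq.
case: (eqVneq t [::]) => [t0|t0].
  have -> // : W `&` joins (j :: t) = W `&` U j.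
  rewrite t0; apply/seteqP; split=> x [Wx hx]; split=> //.
    by case: hx => i; rewrite inE => /eqP ->.
  by exists j; rewrite ?inE.
have -> : W `&` joins (j :: t) = (W `&` U j) `|` (W `&` joins t).
  apply/seteqP; split=> [x [Wx [i]]|x [[Wx h1]|[Wx [i it h1]]]].
  - by rewrite inE => /orP[/eqP->|it] h1; [left|right; split=> //; exists i].
  - by split=> //; exists j; rewrite ?inE ?eqxx.
  - by split=> //; exists i; rewrite // inE it orbT.
have oj : open (W `&` U j) by apply: openI => //; exact: opens_open.
apply: acyclicU => //.
- by apply: openI => //; exact: open_joins.
- apply: IH => // r rt r0; apply: h => //.
  exact: subseq_trans rt (subseq_cons _ _).
have -> : (W `&` U j) `&` (W `&` joins t) = (W `&` U j) `&` joins t.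
  by apply/seteqP; split=> [x [[? ?] [_ ?]]|x [[? ?] ?]]; do !split.
apply: IH => // r rt r0.
have -> : W `&` U j `&` meets r = W `&` meets (j :: r).
  apply/seteqP; split=> [x [[Wx jx] hx]|x [Wx hx]].
    by split=> // i; rewrite inE => /orP[/eqP->//|]; exact: hx.
  by split; [split=> //; apply: hx; rewrite inE eqxx|move=> i ir; apply: hx; rewrite inE ir orbT].
by apply: h => //=; rewrite eqxx.
Qed.
End Cover.
End Acyclic.

(** * Paracompact spaces *)

Lemma near_finite (T : topologicalType) (x : T) (K : Type) (D : set K) (P : K -> T -> Prop) :
  finite_set D -> (forall k, D k -> \forall z \near x, P k z) ->
  \forall z \near x, forall k, D k -> P k z.
Proof.
elim/Pchoice: K => K in D P *; move=> /finite_seqP[s ->].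
elim: s => [|k s IH] h; first by apply: filterE.
have h1 : \forall z \near x, P k z by apply: h; rewrite /= inE eqxx.
have h2 : \forall z \near x, forall k, [set` s] k -> P k z.
  by apply: IH => k' /= k's; apply: h; rewrite /= inE k's orbT.
apply: filterS2 h1 h2 => z Pk Ps k' /=.
by rewrite inE => /orP[/eqP->//|]; exact: Ps.
Qed.

Lemma nbhs_open2 (T : topologicalType) (x : T) (N : set T) (P : T -> Prop) :
  nbhs x N -> (\forall z \near x, P z) ->
  exists2 O : set T, open_nbhs x O & forall z, O z -> N z /\ P z.
Proof.
move=> Nx Px; have : nbhs x (N `&` [set z | P z]) by exact: filterI.
by rewrite nbhsE => -[O hO OS]; exists O.
Qed.

Section Paracompact.
Variables (X : topologicalType).
Hypothesis X_paracompact : paracompact X.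

(** Cover [X] by [V] and by neighbourhoods of the points outside [V] that are
   separated from [x].  Only finitely many members of a locally finite refinement
   come near [x], and intersecting the corresponding neighbourhoods of [x]
   gives [O]. *)
Lemma paracompact_regular (V : opens X) x : opens_set V x ->
  exists2 O : opens X, opens_set O x & closure O `<=` V.
Proof.
move=> Vx; have [/= hX cX] := X_paracompact.
have sep y : exists PQ : opens X * opens X,
    ~ opens_set V y -> [/\ opens_set PQ.1 y, opens_set PQ.2 x & PQ.1 `&` PQ.2 = set0].
  case: (pselect (opens_set V y)) => [Vy|nVy]; first by exists (V, V).
  have yx : y != x by apply/eqP => e; apply: nVy; rewrite e.
  move: hX; rewrite open_hausdorff => /(_ _ _ yx)[[A B] /= [/set_mem Ay /set_mem Bx]].
  by move=> [oA oB /eqP AB]; exists (Opens oA, Opens oB).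
have /choice[PQ hPQ] := sep.
pose F (j : option X) := if j is Some y then (if pselect (opens_set V y) then V else (PQ y).1) else V.
have Fc : \bigcup_j F j = [set: X].
  apply/seteqP; split=> // y _; exists (Some y) => //=.
  by case: pselect => // nVy; have [] := hPQ y nVy.
have [K [W [Wc Wr Wf]]] := cX _ F Fc.
have /choice[q hq] : forall k, exists q, ~ (W k `<=` V) ->
    W k `<=` (PQ q).1 /\ ~ opens_set V q.
  move=> k; have [[y|] /= h] := Wr k.
    by move: h; case: pselect => [Vy|nVy] h; exists y.
  by exists x.
have [N Nx Nf] := Wf x.
have nW : \forall z \near x, forall k, [set k | W k `&` N !=set0] k ->
    ~ (W k `<=` V) -> opens_set (PQ (q k)).2 z.
  apply: near_finite => // k _; case: (pselect (W k `<=` V)) => [h|h].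
    by apply: filterE.
  have [_ nVq] := hq k h; have [_ Qx _] := hPQ _ nVq.
  have : nbhs x (PQ (q k)).2 by apply: open_nbhs_nbhs; split=> //; exact: opens_open.
  by apply: filterS => z ? _.
have [O [oO Ox] OV] : exists2 O : set X, open_nbhs x O & forall z, O z -> N z /\
    forall k, [set k | W k `&` N !=set0] k -> ~ (W k `<=` V) -> opens_set (PQ (q k)).2 z.
  exact: nbhs_open2 Nx nW.
exists (Opens oO) => // z clz.
(* A point of the closure outside V lies in a member that is not contained in V;
   that member would meet O, which is separated from it. *)
apply: contrapT => nVz.
have [k _ Wkz] : (\bigcup_k W k) z by rewrite Wc.
have [u [/= Ou Wu]] : O `&` W k !=set0.
  by apply: clz; apply: open_nbhs_nbhs; split=> //; exact: opens_open.
have bad : ~ (W k `<=` V) by move=> /(_ _ Wkz).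
have [Nu /(_ k)] := OV u Ou; move=> /(_ _ bad) Q.
have [WP nVq] := hq k bad; have [_ _ PQ0] := hPQ _ nVq.
have : ((PQ (q k)).1 `&` (PQ (q k)).2) u.
  by split; [exact: WP|apply: Q; exists u].
by rewrite PQ0.
Qed.

(** A discontinuous partition of unity.  The cover is first shrunk to one with
   closures inside the [V j] and then refined by a locally finite one, [tau]
   being any choice of a member at each point.  Near [x] only the members with [x] in
   their closure are then chosen. *)
Lemma paracompact_selector (J : Type) (V : J -> opens X) : \bigcup_j V j = [set: X] ->
  exists tau : X -> J, forall x, exists N : opens X,
    [/\ opens_set N x, finite_set (tau @` N) & forall z, opens_set N z -> N `<=` V (tau z)].
Proof.
move=> Vc; have /choice[jO hjO] : forall x, exists jO : J * opens X,
    opens_set jO.2 x /\ closure jO.2 `<=` V jO.1.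
  move=> x; have [j _ Vx] : (\bigcup_j V j) x by rewrite Vc.
  by have [O Ox clO] := paracompact_regular Vx; exists (j, O).
have Oc : \bigcup_x (jO x).2 = [set: X].
  by apply/seteqP; split=> // x _; exists x => //; have [] := hjO x.
have [K [W [Wc Wr Wf]]] := X_paracompact.2 _ _ Oc.
have /choice[p hp] := Wr.
have clW k : closure (W k) `<=` V (jO (p k)).1.
  by apply: subset_trans (hjO (p k)).2; apply: closure_subset; exact: hp.
have /choice[kappa hk] : forall x, exists k, opens_set (W k) x.
  move=> x; have [k _ Wx] : (\bigcup_k W k) x by rewrite Wc.
  by exists k.
exists (fun x => (jO (p (kappa x))).1) => x.
have [N Nx Nf] := Wf x.
have nW : \forall z \near x, forall k, [set k | W k `&` N !=set0] k ->
    if pselect (closure (W k) x) then opens_set (V (jO (p k)).1) z else ~ closure (W k) z.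
  apply: near_finite => // k _; case: pselect => [h|h] /=.
    by apply: open_nbhs_nbhs; split; [exact: opens_open|exact: clW].
  have := @closed_closure _ (W k); rewrite -openC => oC.
  by apply: open_nbhs_nbhs; split.
have [O [oO Ox] OV] : exists2 O : set X, open_nbhs x O & forall z, O z -> N z /\
    forall k, [set k | W k `&` N !=set0] k ->
    if pselect (closure (W k) x) then opens_set (V (jO (p k)).1) z else ~ closure (W k) z.
  exact: nbhs_open2 Nx nW.
have meet z : O z -> [set k | W k `&` N !=set0] (kappa z).
  by move=> /OV[Nz _]; exists z; split.
exists (Opens oO); split=> //.
  apply: (@sub_finite_set _ _ ((fun k => (jO (p k)).1) @` [set k | W k `&` N !=set0])).
    by move=> _ [z Oz <-]; exists (kappa z) => //; exact: meet.
  exact: finite_image.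
move=> z /= Oz u Ou; have mz := meet z Oz.
have [_ /(_ _ mz)] := OV z Oz; have [_ /(_ _ mz)] := OV u Ou.
case: pselect => //= _ _ []; exact: subset_closure.
Qed.
End Paracompact.

(** * Cochains on sequences of indices *)

Section OrderedCochains.
Variables (d : Order.disp_t) (I : orderType d) (M : zmodType).
Implicit Types (c e : seq I -> M) (w : seq I).

(** The Cech differential, on sequences of indices instead of simplices of the nerve:
   inserting and deleting indices needs no side condition there. *)
Fixpoint seq_cob c w : M := if w is a :: w' then c w' - seq_cob (fun v => c (a :: v)) w' else 0.

(** Prepending [j], as it reads on increasing sequences for alternating cochains:
   [j] moves to its place at the cost of a sign, and a repetition gives zero. *)
Fixpoint seq_cone (j : I) c w : M :=
  if w is a :: w' then
    if (j < a)%O then c (j :: w) else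
    if j == a then 0 else - seq_cone j (fun v => c (a :: v)) w'
  else c [:: j].

Lemma seq_cobE c w : seq_cob c w = \sum_(l < size w) c (delete l w) *~ (-1) ^+ l.
Proof.
elim: w c => [|a w IH] c /=; first by rewrite big_ord0.
rewrite big_ord_recl expr0 mulr1z IH -sumrN; congr (_ + _).
by apply: eq_bigr => l _; rewrite /= /bump /= add1n exprS mulN1r mulrNz.
Qed.

Lemma seq_cob0 w : seq_cob (fun _ => 0) w = 0.
Proof. by elim: w => //= a w ->; rewrite subr0. Qed.

Lemma seq_cobN c w : seq_cob (fun v => - c v) w = - seq_cob c w.
Proof. by elim: w c => [|a w IH] c /=; rewrite ?oppr0 // IH opprB opprK addrC. Qed.

Lemma seq_coneB j c e w : seq_cone j (fun v => c v - e v) w = seq_cone j c w - seq_cone j e w.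
Proof.
elim: w c e => //= a w IH c e; case: ifP => // _; case: ifP => // _; first by rewrite subr0.
by rewrite IH opprB opprK addrC.
Qed.

Lemma seq_cone_head j c w : sorted <%O (j :: w) -> seq_cone j c w = c (j :: w).
Proof. by case: w => //= b w /andP[-> _]. Qed.

(** The contraction of Cech cochains available where [U j] is the whole space; it
   is applied at a single point or simplex of [U j]. *)
Lemma seq_cone_homotopy j c w : sorted <%O w ->
  seq_cone j (seq_cob c) w + seq_cob (seq_cone j c) w = c w.
Proof.
elim: w c => [|a w IH] c; first by rewrite /= subr0 addr0.
move=> sw; have sw' : sorted <%O w := path_sorted sw.
have step v : seq_cob c (a :: v) = c v - seq_cob (fun u => c (a :: u)) v by [].
case: (ltgtP j a) => ja.
- have h : seq_cone j c w = c (j :: w).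
    apply: seq_cone_head => //; case: w sw {IH sw'} => //= b w /andP[ab ->].
    by rewrite (lt_trans ja ab).
  rewrite {1}/seq_cone ja [seq_cob (seq_cone j c) _]/= h /= ja.
  by rewrite subrK.
- have ja' : (j < a)%O = false by rewrite ltNge (ltW ja).
  have ja'' : (j == a) = false by apply/negbTE; rewrite gt_eqF.
  rewrite /= ja' ja'' seq_cobN opprK.
  transitivity (seq_cone j (seq_cob (fun v => c (a :: v))) w + seq_cob (seq_cone j (fun v => c (a :: v))) w);
    last exact: IH.
  by rewrite seq_coneB opprB addrA subrK.
- rewrite -{}ja in sw step *; rewrite /= ltxx eqxx add0r seq_cob0 subr0.
  exact: seq_cone_head.
Qed.

Lemma seq_cone_eq0 j e w : sorted <%O w ->
  (forall v, sorted <%O v -> size v = (size w).+1 -> {subset v <= j :: w} -> e v = 0) ->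
  seq_cone j e w = 0.
Proof.
elim: w e => [|a w IH] e sw h; first by apply: h.
rewrite /=; case: ifP => ja.
  by apply: h => //=; rewrite ja.
case: eqP => // /eqP ne; rewrite IH ?oppr0 //; first exact: path_sorted sw.
move=> v sv zv vs; apply: h => //=; last 2 first.
- by rewrite zv.
- move=> b; rewrite !inE => /orP[->|/vs]; rewrite ?orbT //.
  by rewrite inE => /orP[->|->]; rewrite ?orbT.
rewrite path_min_sorted //; apply/allP => b /vs.
rewrite inE => /orP[/eqP->|bw]; first by rewrite lt_neqAle eq_sym ne leNgt ja.
by have /allP := order_path_min lt_trans sw; exact.
Qed.
End OrderedCochains.

Section IndexSequences.
Variables (X : topologicalType) (d : Order.disp_t) (I : orderType d) (U : I -> opens X).

Definition vertex_seq k (i : nsimplex U k) : seq I := [seq i l | l <- enum 'I_k.+1].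

Lemma size_vertex_seq k (i : nsimplex U k) : size (vertex_seq i) = k.+1.
Proof. by rewrite size_map size_enum_ord. Qed.

Lemma nth_vertex_seq k (i : nsimplex U k) x0 (l : 'I_k.+1) : nth x0 (vertex_seq i) l = i l.
Proof. by rewrite (nth_map ord0) ?size_enum_ord // nth_ord_enum. Qed.

Lemma sorted_vertex_seq k (i : nsimplex U k) : sorted <%O (vertex_seq i).
Proof.
apply: (@path.homo_sorted _ _ i (fun l m : 'I_k.+1 => (l < m)%N) <%O); last first.
  by have := iota_ltn_sorted 0 k.+1; rewrite -val_enum_ord sorted_map.
by move=> l m; exact: vtx_lt.
Qed.

Lemma vertex_seq_inj k (i j : nsimplex U k) : vertex_seq i = vertex_seq j -> i = j.
Proof.
move=> e; apply: nsimplexP; apply/funext => l.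
by rewrite -(nth_vertex_seq i (i l)) e nth_vertex_seq.
Qed.

Lemma vertex_seq_nface k (i : nsimplex U k.+1) l : vertex_seq (nface l i) = delete l (vertex_seq i).
Proof.
have x0 := i ord0; apply: (@eq_from_nth _ x0); rewrite size_vertex_seq;
  first by rewrite size_delete size_vertex_seq.
move=> m lt; rewrite nth_delete (nth_vertex_seq (nface l i) _ (Ordinal lt)).
by rewrite -[bump l m]/(nat_of_ord (lift l (Ordinal lt))) nth_vertex_seq.
Qed.

Lemma ninter_meets k (i : nsimplex U k) : opens_set (ninter i) = meets U (vertex_seq i).
Proof.
apply/seteqP; split=> [x h j /mapP[l _ ->]|x h l _]; first exact: h.
by apply: h; apply/mapP; exists l; rewrite ?mem_enum.
Qed.

Lemma vertex_seq_exists k (w : seq I) : sorted <%O w -> size w = k.+1 -> meets U w !=set0 ->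
  exists i : nsimplex U k, vertex_seq i = w.
Proof.
case: w => // x0 w sw zw [x hx]; set w' := x0 :: w in sw zw hx *.
pose v (l : 'I_k.+1) := nth x0 w' l.
have vin l : v l \in w' by rewrite mem_nth // zw.
have vlt (l m : 'I_k.+1) : (l < m)%N -> (v l < v m)%O.
  move=> lm; apply: (@sorted_ltn_nth _ _ lt_trans x0 w' sw) => //; rewrite inE zw; exact: ltn_ord.
have vint : finite_inter U v !=set0 by exists x => l _; exact: hx.
exists (NSimplex vlt vint); apply: (@eq_from_nth _ x0); rewrite size_vertex_seq ?zw // => m lt.
by rewrite (nth_vertex_seq _ _ (Ordinal lt)).
Qed.

Section Valuation.
Variables (F : presheaf X) (M : zmodType) (P : opens X -> Prop).
Hypothesis P_mono : forall V W : opens X, V `<=` W -> P V -> P W.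
Variable ev : forall V : opens X, P V -> F V -> M.
Hypothesis ev_zmod : forall V p, zmod_morphism (@ev V p).
Hypothesis ev_res : forall (V W : opens X) (h : W `<=` V) p q s,
  @ev W p (res F h s) = @ev V q s.

HB.instance Definition _ V p := GRing.isZmodMorphism.Build (F V) M (@ev V p) (@ev_zmod V p).

(** A Cech cochain evaluated at one simplex or point, and extended by zero to a
   cochain on sequences with values in a fixed group.  [P] holds for the open sets
   on which the evaluation is possible. *)
Definition cochain_val a (c : cech_cochain U F a) (w : seq I) : M :=
  if pselect (exists i : nsimplex U a, vertex_seq i = w /\ P (ninter i)) is left h
  then ev (svalP (cid h)).2 (c (sval (cid h))) else 0.

Lemma cochain_valE a (c : cech_cochain U F a) (i : nsimplex U a) (p : P (ninter i)) :
  cochain_val c (vertex_seq i) = ev p (c i).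
Proof.
rewrite /cochain_val; case: pselect => [h|[]]; last by exists i.
move: (svalP (cid h)).2 (svalP (cid h)).1; move: (sval (cid h)) => i' p' /vertex_seq_inj e.
case: i / e p {h} => p; by congr (ev _ _); exact: Prop_irrelevance.
Qed.

Lemma cochain_val0 a w : cochain_val (0 : cech_cochain U F a) w = 0.
Proof. by rewrite /cochain_val; case: pselect => // h; rewrite dprod0 raddf0. Qed.

Lemma cochain_val_dif a (c : cech_cochain U F a) (i : nsimplex U a.+1) (p : P (ninter i)) :
  cochain_val (cech_dif c) (vertex_seq i) = seq_cob (cochain_val c) (vertex_seq i).
Proof.
rewrite (cochain_valE _ p) seq_cobE size_vertex_seq raddf_sum; apply: eq_bigr => l _.
rewrite raddfMz /= -vertex_seq_nface; congr (_ *~ _).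
have q : P (ninter (nface l i)) by exact: P_mono (@ninter_face _ _ _ _ _ l i) p.
by rewrite (cochain_valE _ q); exact: ev_res.
Qed.

(** The term of [seq_cone_homotopy] that involves the differential of [c] vanishes,
   since [ev] is possible on the intersections for all sequences over which it runs. *)
Lemma cochain_val_cone a (c : cech_cochain U F a) (i : nsimplex U a) j :
  cech_dif c = 0 -> P (opensI (ninter i) (U j)) -> opensI (ninter i) (U j) !=set0 ->
  cochain_val c (vertex_seq i) = seq_cob (seq_cone j (cochain_val c)) (vertex_seq i).
Proof.
move=> cc p [x [ix jx]]; rewrite -[LHS](seq_cone_homotopy j _ (sorted_vertex_seq i)).
rewrite seq_cone_eq0 ?add0r ?sorted_vertex_seq // => v sv; rewrite size_vertex_seq => zv vs.
have sub y : opens_set (ninter i) y -> opens_set (U j) y -> meets U v y.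
  rewrite ninter_meets => iy jy b /vs; rewrite inE => /orP[/eqP->//|]; exact: iy.
have vx : meets U v !=set0 by exists x; exact: sub.
have [i' ei'] := vertex_seq_exists sv zv vx.
have p' : P (ninter i').
  by apply: P_mono p => y [iy jy]; rewrite ninter_meets ei'; exact: sub.
by rewrite -ei' -(cochain_val_dif c p') cc cochain_val0.
Qed.
End Valuation.
End IndexSequences.

(** * Rows: singular cochains and locally represented sections *)

Section Rows.
Variables (R : realType) (X : topologicalType).
Variables (d : Order.disp_t) (I : orderType d) (U : I -> opens X).

Lemma sing_nonempty n (s : sing R X n) (V : opens X) : carried V (asing s) -> V !=set0.
Proof. by move=> h; exists (s (corner R n)); exact: h. Qed.

Section SingularRows.
Variable b : nat.
Notation F := (sing_presheaf R X b).

Definition sing_ev (s : sing R X b) (V : opens X) (p : carried V (asing s)) (c : F V) : int :=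
  c (to_sub p).

Fact sing_ev_zmod s V p : zmod_morphism (@sing_ev s V p). Proof. by []. Qed.

Fact sing_ev_res s (V W : opens X) (h : W `<=` V) p q c :
  @sing_ev s W p (res F h c) = @sing_ev s V q c.
Proof. by congr (c _); apply/continuousEP => z; exact: val_inj. Qed.

Fact carried_mono (s : sing R X b) (V W : opens X) :
  V `<=` W -> carried V (asing s) -> carried W (asing s).
Proof. by move=> VW h p; exact/VW/h. Qed.

Definition sing_val a (c : cech_cochain U F a) (s : sing R X b) := cochain_val (@sing_ev s) c.

Lemma sing_valE a (c : cech_cochain U F a) (i : nsimplex U a)
    (s : sing R (set_type (ninter i)) b) :
  sing_val c (of_sub s) (vertex_seq i) = c i s.
Proof.
by rewrite /sing_val (cochain_valE _ _ (@carried_of_sub _ _ _ _ s)) /sing_ev of_subK.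
Qed.

(** The contraction is chosen separately for each singular simplex, by inserting
   any index whose member contains it. *)
Definition sing_row_htpy a (c : cech_cochain U F a) (s : sing R X b) (w : seq I) : int :=
  if pselect (exists j, carried (U j) (asing s)) is left e
  then seq_cone (sval (cid e)) (sing_val c s) w else 0.

Lemma sing_row_htpyP a (c : cech_cochain U F a) (i : nsimplex U a)
    (s : sing R (set_type (ninter i)) b) :
  cech_dif c = 0 -> c i s = seq_cob (sing_row_htpy c (of_sub s)) (vertex_seq i).
Proof.
move=> cc; have ci := @carried_of_sub _ _ _ _ s; rewrite -sing_valE /sing_row_htpy.
case: pselect => [e|[]]; last by exists (i ord0) => p;
  exact: (@ninter_cover _ _ _ U _ i ord0 _ (ci p)).
move: (svalP (cid e)); move: (sval (cid e)) => j cj.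
have pij : carried (opensI (ninter i) (U j)) (asing (of_sub s)).
  by move=> p; split; [exact: ci|exact: cj].
apply: (cochain_val_cone (@carried_mono _) (@sing_ev_zmod _) (@sing_ev_res _) cc pij).
exact: sing_nonempty pij.
Qed.

Lemma sing_row_exact a (c : cech_cochain U F a.+1) : cech_dif c = 0 ->
  exists h : cech_cochain U F a, c = cech_dif h.
Proof.
move=> cc; exists (fun i s => sing_row_htpy c (of_sub s) (vertex_seq i)).
set h : cech_cochain U F a := fun i => _.
apply: dprodP => i; apply/funext => s; rewrite (sing_row_htpyP s cc) -[RHS]sing_valE.
have ci := @carried_of_sub _ _ _ _ s.
rewrite [RHS](cochain_val_dif (@carried_mono _) (@sing_ev_zmod _) (@sing_ev_res _) _ ci).
rewrite !seq_cobE size_vertex_seq; apply: eq_bigr => l _; rewrite -vertex_seq_nface; congr (_ *~ _).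
have cl : carried (ninter (nface l i)) (asing (of_sub s)).
  by apply: carried_mono ci; exact: ninter_face.
rewrite (cochain_valE _ _ cl) /sing_ev /h; congr (sing_row_htpy _ _ _).
by apply/continuousEP.
Qed.

(** At the empty sequence the contraction glues compatible cochains. *)
Lemma sing_row_onto (c : cech_cochain U F 0) : cech_dif c = 0 ->
  exists alpha : sing R X b -> int, forall i s, c i s = alpha (of_sub s).
Proof.
move=> cc; exists (fun s => sing_row_htpy c s [::]) => i s.
rewrite (sing_row_htpyP s cc) seq_cobE size_vertex_seq big_ord1 expr0 mulr1z.
by case: (vertex_seq i) (size_vertex_seq i) => // x [].
Qed.
End SingularRows.

Section LocallyRepresented.
Variable G : presheaf X.

(** The sheaf condition at [x] for a family of germs over the whole space.  A section
   over a smaller open set is extended by zero, and sections with different domains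
   can be added. *)
Definition locally_represented (x : X) (g : forall y, stalk G y) :=
  exists (N : opens X) (r : G N), opens_set N x /\ forall y : set_type N, g (val y) = germ y r.

Lemma locally_represented0 x : locally_represented x (fun y => 0).
Proof. by exists (opensT X), 0; split=> // y; rewrite raddf0. Qed.

Lemma locally_representedB x g h : locally_represented x g -> locally_represented x h ->
  locally_represented x (fun y => g y - h y).
Proof.
move=> [N [r [Nx gr]]] [M [t [Mx ht]]].
exists (opensI N M), (res G (@opensIl _ N M) r - res G (@opensIr _ N M) t); split=> // y.
by rewrite raddfB /= !germ_res -(gr (incl (@opensIl _ N M) y)) -(ht (incl (@opensIr _ N M) y)).
Qed.

Lemma locally_representedN x g : locally_represented x g ->
  locally_represented x (fun y => - g y).
Proof.
move=> h; have [N [r [Nx hr]]] := locally_representedB (locally_represented0 x) h.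
by exists N, r; split=> // y; rewrite -hr sub0r.
Qed.

Lemma locally_represented_ext x g h (N : opens X) : opens_set N x ->
  (forall y, opens_set N y -> g y = h y) ->
  locally_represented x g -> locally_represented x h.
Proof.
move=> Nx gh [M [r [Mx gr]]].
exists (opensI N M), (res G (@opensIr _ N M) r); split=> // y.
by rewrite germ_res -(gr (incl (@opensIr _ N M) y)) /= gh //; have /set_mem[] := valP y.
Qed.

Lemma locally_representedD x g h : locally_represented x g -> locally_represented x h ->
  locally_represented x (fun y => g y + h y).
Proof.
move=> hg /locally_representedN hh.
apply: (@locally_represented_ext _ (fun y => g y - - h y) _ (opensT X)) => // [y _|].
  by rewrite opprK.
exact: locally_representedB.
Qed.

Lemma locally_represented_sum x (J : eqType) (r : seq J) (g : J -> forall y, stalk G y) :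
  (forall j, j \in r -> locally_represented x (g j)) ->
  locally_represented x (fun y => \sum_(j <- r) g j y).
Proof.
elim: r => [|j r IH] h.
  apply: (@locally_represented_ext _ (fun y => 0) _ (opensT X)) => // [y _|].
    by rewrite big_nil.
  exact: locally_represented0.
apply: (@locally_represented_ext _ (fun y => g j y + \sum_(j <- r) g j y) _ (opensT X)) => // [y _|].
  by rewrite big_cons.
apply: locally_representedD; first by apply: h; rewrite inE eqxx.
by apply: IH => k kr; apply: h; rewrite inE kr orbT.
Qed.

Lemma locally_represented_map (eta : presheaf_map G G) x g : locally_represented x g ->
  locally_represented x (fun y => stalk_map eta (g y)).
Proof.
move=> [N [r [Nx gr]]]; exists N, (eta N r); split=> // y.
by rewrite gr stalk_map_germ.
Qed.

Lemma locally_represented_section (V : opens X) (s : sheafify G V) x (Vx : opens_set V x)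
    (g : forall y, stalk G y) :
  (forall y (Vy : opens_set V y), g y = ss_val s (exist _ y (mem_set Vy))) ->
  locally_represented x g.
Proof.
move=> gs; have /is_sheaf_sectionP/(_ (exist _ x (mem_set Vx))) := ss_valP s.
move=> [W [hW [t [Wx e]]]]; exists W, t; split=> // -[y yW]; rewrite -e.
by rewrite (gs _ (hW _ (set_mem yW))); exact: (dprod_irr (ss_val s)).
Qed.

Lemma locally_represented_is_section (V : opens X) (g : forall y, stalk G y) :
  (forall x, opens_set V x -> locally_represented x g) ->
  ((fun x => g (val x)) : dprod (fun x : set_type V => stalk G (val x)))
    \in @is_sheaf_section X G V.
Proof.
move=> h; apply/is_sheaf_sectionP => x; have [N [r [Nx gr]]] := h _ (set_mem (valP x)).
exists (opensI V N), (@opensIl _ V N), (res G (@opensIr _ V N) r); split.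
  by split=> //; exact: set_mem (valP x).
by move=> y; rewrite germ_res -gr.
Qed.

Definition stalk_ev x (V : opens X) (p : opens_set V x) (s : sheafify G V) : stalk G x :=
  ss_val s (exist _ x (mem_set p)).

Fact stalk_ev_zmod x V p : zmod_morphism (@stalk_ev x V p). Proof. by []. Qed.

Fact stalk_ev_res x (V W : opens X) (h : W `<=` V) p q s :
  @stalk_ev x W p (res (sheafify G) h s) = @stalk_ev x V q s.
Proof. exact: (dprod_irr (ss_val s)). Qed.

Fact point_mono x (V W : opens X) : V `<=` W -> opens_set V x -> opens_set W x.
Proof. exact. Qed.

Definition stalk_val a (c : cech_cochain U (sheafify G) a) x := cochain_val (@stalk_ev x) c.

Lemma stalk_valE a (c : cech_cochain U (sheafify G) a) (i : nsimplex U a)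
    (x : set_type (ninter i)) : stalk_val c (val x) (vertex_seq i) = ss_val (c i) x.
Proof.
rewrite /stalk_val (cochain_valE _ _ (set_mem (valP x))).
by case: x => x px; exact: (dprod_irr (ss_val (c i))).
Qed.

Lemma stalk_val_represented a (c : cech_cochain U (sheafify G) a) x w :
  meets U w x -> locally_represented x (fun y => stalk_val c y w).
Proof.
move=> mx; case: (pselect (exists i : nsimplex U a, vertex_seq i = w)) => [[i ei]|nw].
  rewrite -ei in mx *; rewrite -ninter_meets in mx.
  apply: (locally_represented_section (s := c i) mx) => y Vy.
  by rewrite -(stalk_valE c (exist _ y (mem_set Vy))).
apply: (@locally_represented_ext _ (fun y => 0) _ (opensT X)) => // [y _|].
  rewrite /stalk_val /cochain_val; case: pselect => //= h; exfalso.
  by case: h => i [e _]; apply: nw; exists i.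
exact: locally_represented0.
Qed.

Lemma seq_cone_represented x j (c : forall y, seq I -> stalk G y) w :
  opens_set (U j) x -> meets U w x ->
  (forall v, meets U v x -> locally_represented x (fun y => c y v)) ->
  locally_represented x (fun y => seq_cone j (c y) w).
Proof.
move=> jx; elim: w c => [|a w IH] c mw h /=.
  by apply: h => k; rewrite inE => /eqP ->.
case: (j < a)%O.
  by apply: h => k; rewrite !inE => /orP[/eqP->//|kw]; apply: mw; rewrite inE.
case: (j == a); first exact: locally_represented0.
apply/locally_representedN/IH => [k kw|v mv]; first by apply: mw; rewrite inE kw orbT.
apply: h => k; rewrite inE => /orP[/eqP->|]; last exact: mv.
by apply: mw; rewrite inE eqxx.
Qed.
End LocallyRepresented.
End Rows.

(** * Rows: sheafified cochains *)

Lemma germ_restrict (X : topologicalType) (F : presheaf X) (V W : opens X) (h : W `<=` V) y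
    (Vy : opens_set V y) (Wy : opens_set W y) (t : F V) :
  germ (exist _ y (mem_set Vy)) t = germ (exist _ y (mem_set Wy)) (res F h t) :> stalk F y.
Proof.
rewrite germ_res; congr (\pi_(stalk F y) (GermRep _ t)); exact: Prop_irrelevance.
Qed.

Section Cut.
Variables (R : realType) (X : topologicalType) (b : nat) (I : eqType) (tau : X -> I).
Notation G := (sing_presheaf R X b).

(** Keeps the simplices whose base corner is assigned to [j].  Restriction
   preserves corners, so these operators act on the presheaf, as a
   partition of unity. *)
Definition cut_fun (j : I) (V : opens X) (c : G V) : G V :=
  fun s => if tau (val (s (corner R b))) == j then c s else 0.

Fact cut_fun_zmod j V : zmod_morphism (@cut_fun j V).
Proof.
by move=> c e; apply/funext => s; rewrite /cut_fun !fctE; case: eqP; rewrite ?subr0.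
Qed.
HB.instance Definition _ j V :=
  GRing.isZmodMorphism.Build (G V) (G V) (@cut_fun j V) (@cut_fun_zmod j V).

Fact cut_res j (V W : opens X) (h : W `<=` V) (c : G V) :
  cut_fun j (res G h c) = res G h (cut_fun j c).
Proof. by []. Qed.

Definition cut (j : I) : presheaf_map G G :=
  @PresheafMap X G G (fun V => @cut_fun j V) (@cut_res j).

Lemma cut_vanish j (O : opens X) y (g : stalk G y) : opens_set O y ->
  (forall z, opens_set O z -> tau z != j) -> stalk_map (cut j) g = 0.
Proof.
move=> Oy Oj; have [V [Vy [t ->]]] := germ_surj g.
rewrite (germ_restrict (@opensIl _ V O) Vy (conj Vy Oy)).
have e := stalk_map_germ (cut j)
  (exist (fun z => z \in opens_set (opensI V O)) y (mem_set (conj Vy Oy)))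
  (res G (@opensIl _ V O) t).
rewrite [LHS]e; rewrite (_ : cut j _ _ = 0) ?raddf0 //.
apply/funext => s; rewrite /= /cut_fun ifN //.
by apply: Oj; have /set_mem[] := valP (s (corner R b)).
Qed.

Lemma cut_sum (A : seq I) (O : opens X) y (g : stalk G y) : uniq A -> opens_set O y ->
  (forall z, opens_set O z -> tau z \in A) -> \sum_(j <- A) stalk_map (cut j) g = g.
Proof.
move=> uA Oy OA; have [V [Vy [t ->]]] := germ_surj g.
rewrite (germ_restrict (@opensIl _ V O) Vy (conj Vy Oy)).
set x' : set_type (opensI V O) := exist _ y _; set t' := res G _ t.
transitivity (germ x' (\sum_(j <- A) cut j _ t')).
  rewrite raddf_sum; apply: eq_bigr => j _; exact: (stalk_map_germ (cut j) x' t').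
congr (germ x' _); apply/funext => s.
rewrite (big_morph (fun f : G (opensI V O) => f s) (id1 := 0) (op1 := +%R)) //.
have tA : tau (val (s (corner R b))) \in A.
  by apply: OA; have /set_mem[] := valP (s (corner R b)).
rewrite (bigD1_seq _ tA uA) /= {1}/cut_fun eqxx big1 ?addr0 // => j jt.
by rewrite /cut_fun eq_sym (negPf jt).
Qed.

(** Lets the finite set of indices vary from point to point. *)
Lemma eq_cut_sum (A B : seq I) (O : opens X) y (g : I -> stalk G y) : uniq A -> uniq B ->
  opens_set O y -> (forall z, opens_set O z -> tau z \in A) ->
  (forall z, opens_set O z -> tau z \in B) ->
  \sum_(j <- A) stalk_map (cut j) (g j) = \sum_(j <- B) stalk_map (cut j) (g j).
Proof.
move=> uA uB Oy OA OB.
have drop (C D : seq I) : (forall z, opens_set O z -> tau z \in D) ->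
    \sum_(j <- C) stalk_map (cut j) (g j) =
      \sum_(j <- [seq j <- C | j \in D]) stalk_map (cut j) (g j).
  move=> OD; rewrite big_filter [LHS](bigID (mem D)) /= [X in _ + X]big1 ?addr0 // => j jD.
  apply: (cut_vanish _ Oy) => z Oz; apply: contraNneq jD => <-; exact: OD.
rewrite (drop A B OB) (drop B A OA); apply: perm_big.
by apply: uniq_perm; rewrite ?filter_uniq // => j; rewrite !mem_filter andbC.
Qed.
End Cut.

Section SheafRows.
Variables (R : realType) (X : topologicalType).
Hypothesis X_paracompact : paracompact X.
Variable b : nat.
Notation G := (sing_presheaf R X b).

Section Rows.
Variables (d : Order.disp_t) (I : orderType d) (U : I -> opens X).
Hypothesis U_cover : \bigcup_i U i = [set: X].

Lemma stalk_val_cone a (c : cech_cochain U (sheafify G) a) (i : nsimplex U a) x j :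
  cech_dif c = 0 -> opens_set (ninter i) x -> opens_set (U j) x ->
  stalk_val c x (vertex_seq i) = seq_cob (seq_cone j (stalk_val c x)) (vertex_seq i).
Proof.
move=> cc ix jx; apply: (cochain_val_cone (@point_mono _ x) (@stalk_ev_zmod _ _ x)
  (@stalk_ev_res _ _ x) cc) => //.
by exists x.
Qed.

(** The contraction of the Cech complex of a fine sheaf: insert [j], cut by
   [tau = j], and sum over [j].  Near a point the sum is finite, and its terms are
   sections because a neighbourhood lies in each of the [U j] involved. *)
Lemma sheaf_row_exact a (c : cech_cochain U (sheafify G) a.+1) : cech_dif c = 0 ->
  exists h : cech_cochain U (sheafify G) a, c = cech_dif h.
Proof.
move=> cc; have [tau htau] := paracompact_selector X_paracompact U_cover.
have /choice[NA hNA] : forall x, exists NA : opens X * seq I, [/\ opens_set NA.1 x,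
    uniq NA.2, forall z, opens_set NA.1 z -> tau z \in NA.2 &
    forall j, j \in NA.2 -> NA.1 `<=` U j].
  move=> x; have [N [Nx /finite_seqP[s es] NU]] := htau x.
  exists (N, undup s); split=> /=; [by []|exact: undup_uniq|move=> z Nz|move=> j].
    have : (tau @` N) (tau z) by exists z.
    by rewrite es /= mem_undup.
  rewrite mem_undup => js; have : [set` s] j by [].
  by rewrite -es => -[z Nz <-]; exact: NU.
pose A x := (NA x).2.
(* The list [A y] contains the values of [tau] near [y]. *)
pose H (w : seq I) y := \sum_(j <- A y) stalk_map (cut R b tau j) (seq_cone j (stalk_val c y) w).
(* Near [x] the sum can be taken over the fixed list [A x]. *)
have Hrep (i : nsimplex U a) x : opens_set (ninter i) x -> locally_represented x (H (vertex_seq i)).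
  move=> ix; have [Nx uA NAx AU] := hNA x.
  apply: (@locally_represented_ext _ _ _ (fun y => \sum_(j <- A x)
      stalk_map (cut R b tau j) (seq_cone j (stalk_val c y) (vertex_seq i))) _ (NA x).1) => // [y Ny|].
    have [My uB MBy _] := hNA y.
    by apply: (@eq_cut_sum _ _ _ _ _ _ _ (opensI (NA x).1 (NA y).1)) => // z [z1 z2];
      [exact: NAx|exact: MBy].
  apply: locally_represented_sum => j jA; apply: locally_represented_map.
  apply: (@seq_cone_represented _ _ _ U G x j (fun y => stalk_val c y)).
  - by apply: AU jA _ Nx.
  - by rewrite -ninter_meets.
  - by move=> v mv; exact: stalk_val_represented.
pose h : cech_cochain U (sheafify G) a :=
  fun i => SheafSection (locally_represented_is_section (fun x => @Hrep i x)).
exists h; apply: dprodP => i; apply: sheaf_sectionP => x.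
rewrite -[LHS]stalk_valE -[RHS]stalk_valE.
have ix : opens_set (ninter i) (val x) := set_mem (valP x).
move: (val x) ix => {}x ix.
rewrite [RHS](cochain_val_dif (@point_mono _ x) (@stalk_ev_zmod _ _ x) (@stalk_ev_res _ _ x) _ ix).
have [Nx uA NAx AU] := hNA x.
transitivity (\sum_(j <- A x) stalk_map (cut R b tau j) (stalk_val c x (vertex_seq i))).
  by rewrite (cut_sum _ uA Nx NAx).
transitivity (seq_cob (fun w => H w x) (vertex_seq i)); last first.
  have E l : H (vertex_seq (nface l i)) x =
    cochain_val (@stalk_ev _ G x) h (vertex_seq (nface l i)).
    have il : opens_set (ninter (nface l i)) x by exact: ninter_face.
    by rewrite (cochain_valE _ _ il).
  rewrite [LHS]seq_cobE [RHS]seq_cobE size_vertex_seq; apply: eq_bigr => l _.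
  by rewrite -vertex_seq_nface E.
rewrite seq_cobE size_vertex_seq /H.
under [RHS]eq_bigr do rewrite mulrz_suml.
rewrite exchange_big /=; apply: eq_big_seq => j jA.
have jx : opens_set (U j) x by apply: AU jA _ Nx.
rewrite (stalk_val_cone cc ix jx) seq_cobE size_vertex_seq raddf_sum.
by apply: eq_bigr => l _; rewrite raddfMz.
Qed.

(** A cocycle is a family of sections that agree on the overlaps. *)
Lemma sheaf_row_onto (c : cech_cochain U (sheafify G) 0) : cech_dif c = 0 ->
  exists t : sheafify G (opensT X), c = fun i => res (sheafify G) (opens_subT (U := ninter i)) t.
Proof.
move=> cc; have /choice[jf hjf] : forall x, exists j, opens_set (U j) x.
  by move=> x; have [j _ jx] : (\bigcup_i U i) x by [rewrite U_cover]; exists j.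
have indep (i : nsimplex U 0) x j : opens_set (ninter i) x -> opens_set (U j) x ->
    stalk_val c x (vertex_seq i) = stalk_val c x [:: j].
  move=> ix jx; rewrite (stalk_val_cone cc ix jx) seq_cobE size_vertex_seq big_ord1 expr0 mulr1z.
  by case: (vertex_seq i) (size_vertex_seq i) => // k [].
pose g y := stalk_val c y [:: jf y].
have grep x : opens_set (opensT X) x -> locally_represented x g.
  move=> _; apply: (@locally_represented_ext _ _ _ (fun y => stalk_val c y [:: jf x]) _ (U (jf x))).
  - exact: hjf.
  - move=> y jy; have [i ei] : exists i : nsimplex U 0, vertex_seq i = [:: jf x].
      by apply: vertex_seq_exists => //; exists y => k; rewrite inE => /eqP ->.
    rewrite -ei; apply: indep; last exact: hjf.
    by rewrite ninter_meets ei => k; rewrite inE => /eqP ->.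
  - by apply: stalk_val_represented => k; rewrite inE => /eqP ->; exact: hjf.
exists (SheafSection (locally_represented_is_section grep)).
apply: dprodP => i; apply: sheaf_sectionP => x; rewrite -[LHS]stalk_valE /=.
apply: indep; [exact: set_mem (valP x)|exact: hjf].
Qed.
End Rows.

(** The value of [alpha] on [s] is read off from the local representative selected
   by [tau] at the base corner of [s].  Near a point only finitely many
   representatives occur, and they agree on a common neighbourhood since they
   have the same germ. *)
Lemma sheafification_onto (t : sheafify G (opensT X)) :
  exists alpha : singular_complex R X b, t = sheafification_fun alpha.
Proof.
have /is_sheaf_sectionP ht := ss_valP t.
have /choice[Vr hVr] : forall x, exists Vr : {V : opens X & G V}, opens_set (projT1 Vr) x /\
    forall y (Vy : opens_set (projT1 Vr) y),
    ss_val t (exist _ y (mem_set (I : opens_set (opensT X) y))) =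
    germ (exist _ y (mem_set Vy)) (projT2 Vr) :> stalk G y.
  move=> x; have [V [hV [r [Vx e]]]] := ht (exist _ x (mem_set I)).
  exists (existT _ V r); split=> // y Vy; rewrite -e; exact: (dprod_irr (ss_val t)).
pose V x := projT1 (Vr x); pose r x : G (V x) := projT2 (Vr x).
have Vc : \bigcup_x V x = [set: X].
  by apply/seteqP; split=> // x _; exists x => //; have [] := hVr x.
have [tau htau] := paracompact_selector X_paracompact Vc.
pose alpha (s : sing R X b) : int := let x := tau (s (corner R b)) in
  if pselect (carried (V x) (asing s)) is left h then r x (to_sub h) else 0.
exists alpha; apply: sheaf_sectionP => -[x xT].
have [N [Nx Nf NV]] := htau x.
pose j0 := tau x.
have NV0 : N `<=` V j0 by exact: NV.
(* For each of the finitely many values j near x, a neighbourhood of x on which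
   the representatives selected by j and by x agree. *)
have /choice[W hW] : forall j, exists W : opens X, (tau @` N) j -> opens_set W x /\
    exists (h : W `<=` V j) (h0 : W `<=` V j0), res G h (r j) = res G h0 (r j0).
  move=> j; case: (pselect ((tau @` N) j)) => [[z Nz jz]|nj]; last by exists N.
  have jx : opens_set (V j) x by rewrite -jz; exact: NV.
  have [_ /(_ _ jx) e1] := hVr j; have [_ /(_ _ (NV0 x Nx)) e2] := hVr j0.
  have /stalk_eqP[W [h [h0 [Wx e]]]] := etrans (esym e1) e2.
  by exists W => _; split=> //; exists h, h0.
have near_W : \forall z \near x, forall j, (tau @` N) j -> opens_set (W j) z.
  apply: near_finite => // j jN; have [Wx _] := hW j jN.
  by apply: open_nbhs_nbhs; split=> //; exact: opens_open.
have Nn : nbhs x N by apply: open_nbhs_nbhs; split=> //; exact: opens_open.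
have [O [oO Ox] OP] := nbhs_open2 Nn near_W.
pose O' := Opens oO.
have ON : O' `<=` N by move=> z /OP[].
have OT : O' `<=` opensT X by [].
have ON0 : O' `<=` V j0 by move=> z /ON; exact: NV0.
have [_ /(_ _ (NV0 x Nx)) e2] := hVr j0.
transitivity (germ (exist _ x (mem_set (NV0 x Nx : opens_set (V j0) x))) (r j0) : stalk G x).
  by rewrite -e2; exact: (dprod_irr (ss_val t)).
rewrite (germ_restrict ON0 _ (Ox : opens_set O' x)) /=.
transitivity (germ (exist _ x (mem_set (I : opens_set (opensT X) x)))
  (@sing_pull R _ _ (@sub_val X setT) b alpha : G (opensT X)) : stalk G x); last first.
  congr (\pi_(stalk G x) (GermRep _ _)); exact: Prop_irrelevance.
rewrite (germ_restrict OT _ (Ox : opens_set O' x)).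
suff E : res G ON0 (r j0) =
    res G OT (@sing_pull R _ _ (@sub_val X setT) b alpha : G (opensT X)) by rewrite E.
apply/funext => s; transitivity (alpha (of_sub s)); last first.
  by congr alpha; exact/continuousEP.
set s' := of_sub s; have cO : carried O' (asing s') := @carried_of_sub _ _ _ _ s.
rewrite /alpha.
have jN : (tau @` N) (tau (s' (corner R b))).
  by exists (s' (corner R b)) => //; apply: ON; exact: cO.
have [Wx [h [h0 e]]] := hW _ jN.
case: pselect => [hs|[]]; last first.
  by move=> p; apply: (h); have [_ Wp] := OP _ (cO p); exact: Wp.
have OW : O' `<=` W (tau (s' (corner R b))) by move=> z /OP[_]; exact.
have := congr1 (fun f : G O' => f s) (congr1 (res G OW) e).
rewrite !(res_res _ _ ON0) (res_res _ _ (subset_trans OW h)) => e'.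
rewrite -e'; congr (r _ _); apply/continuousEP => p; exact: val_inj.
Qed.
End SheafRows.

(** * The comparison maps are quasi-isomorphisms *)

Section CohomologyMaps.
Variables (C D E : cochain_complex) (k : nat).

Lemma cohomology_map_comp (f : chain_map C D) (g : chain_map D E) (h : chain_map C E) :
  (forall x, h k x = g k (f k x)) ->
  forall c, cohomology_map h (k := k) c = cohomology_map g (cohomology_map f c).
Proof.
move=> e; elim/cohomology_ind => z; rewrite !cohomology_mapE; congr cohomology_class.
by apply: val_inj; exact: e.
Qed.
End CohomologyMaps.

Lemma bijective_cancel_right (A B C : Type) (f : A -> B) (g : B -> C) (h : A -> C) :
  (forall x, h x = g (f x)) -> bijective f -> bijective h -> bijective g.
Proof.
move=> e bf bh; have [f' fK f'K] := bf.
apply: (@eq_bij _ _ (h \o f')); last by move=> y; rewrite /= e f'K.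
apply: bij_comp => //; exact: Bijective f'K fK.
Qed.

Lemma bijective_compE (A B C : Type) (f : A -> B) (g : B -> C) (h : A -> C) :
  (forall x, h x = g (f x)) -> bijective f -> bijective g -> bijective h.
Proof. by move=> e bf bg; apply: (@eq_bij _ _ (g \o f)); [exact: bij_comp|]. Qed.

Section DoubleComplexes.
Variables (R : realType) (X : topologicalType).
Variables (d : Order.disp_t) (I : orderType d) (U : I -> opens X).

Notation Epre := (cech_double U (sing_presheaf_complex R X)).
Notation E := (cech_double U (sheaf_sing_complex R X)).
Notation unit b := (sheaf_unit (sing_presheaf R X b)).

Definition tot_unit_fun n (f : tot Epre n) : tot E n :=
  fun p => cech_map (unit (ad2 p)) (f p).

Fact tot_unit_zmod n : zmod_morphism (@tot_unit_fun n).
Proof. by move=> f g; apply: dprodP => p; rewrite /tot_unit_fun !dprodD !dprodN raddfB. Qed.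
HB.instance Definition _ n :=
  GRing.isZmodMorphism.Build (tot Epre n) (tot E n) (@tot_unit_fun n) (@tot_unit_zmod n).

Fact cech_unit_dv a b (c : Epre a b) :
  cech_map (unit b.+1) (dv Epre c) = dv E (cech_map (unit b) c).
Proof. by apply: dprodP => i; exact/esym/sheafify_map_unit. Qed.

Fact tot_unit_dif n (f : tot Epre n) : tot_unit_fun (tot_dif f) = tot_dif (tot_unit_fun f).
Proof.
apply: dprodP => -[a b e]; rewrite /tot_unit_fun /tot_dif /= raddfD raddfMz /=.
congr (_ + _ *~ _).
  by case: a e => [|a] e /=; rewrite ?raddf0 // cech_map_dif.
by case: b e => [|b] e /=; rewrite ?raddf0 // cech_unit_dv.
Qed.

Definition tot_unit : chain_map (total_complex Epre) (total_complex E) :=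
  @ChainMap (total_complex Epre) (total_complex E) (fun n => @tot_unit_fun n) tot_unit_dif.

Definition sing_restrict b (alpha : singular_complex R X b) : Epre 0 b :=
  fun i s => alpha (of_sub s).

Arguments sing_restrict {b} alpha i _.

Fact sing_restrict_zmod b : zmod_morphism (@sing_restrict b).
Proof. by []. Qed.
HB.instance Definition _ b := GRing.isZmodMorphism.Build
  (singular_complex R X b) (Epre 0 b) (@sing_restrict b) (@sing_restrict_zmod b).

Fact sing_restrict_dif b (alpha : singular_complex R X b) :
  sing_restrict (dif (singular_complex R X) alpha) = dv Epre (sing_restrict alpha).
Proof.
apply: dprodP => i; apply/funext => s; rewrite /= /sing_restrict /cech_map /= /sing_dif.
by congr (- _); apply: eq_bigr => l _; rewrite of_sub_face.
Qed.

Fact sing_restrict_dh b (alpha : singular_complex R X b) : dh Epre (sing_restrict alpha) = 0.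
Proof.
apply: dprodP => i; rewrite dprod0 /= /cech_dif big_ord_recl big_ord1 expr0 expr1 mulrNz.
apply/eqP; rewrite subr_eq0; apply/eqP; apply/funext => s.
by congr (alpha _); exact/continuousEP.
Qed.

Definition phi_pre : chain_map (singular_complex R X) (total_complex Epre) :=
  @aug_v Epre (singular_complex R X) (fun b => @sing_restrict b)
    sing_restrict_dif sing_restrict_dh.

Definition sheaf_restrict b : {additive singular_complex R X b -> E 0 b} :=
  @cech_restrict _ _ _ U (sheaf_sing_complex R X) b \o @sheafification_fun R X b.

Fact sheaf_restrict_dif b (alpha : singular_complex R X b) :
  sheaf_restrict b.+1 (dif (singular_complex R X) alpha) = dv E (sheaf_restrict b alpha).
Proof. by rewrite /sheaf_restrict /= sheafification_dif cech_restrict_dif. Qed.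

Fact sheaf_restrict_dh b (alpha : singular_complex R X b) : dh E (sheaf_restrict b alpha) = 0.
Proof. exact: cech_restrict_dh. Qed.

Definition phi_sing : chain_map (singular_complex R X) (total_complex E) :=
  @aug_v E (singular_complex R X) sheaf_restrict sheaf_restrict_dif sheaf_restrict_dh.

Lemma sheaf_restrictE b (alpha : singular_complex R X b) :
  sheaf_restrict b alpha = cech_map (unit b) (sing_restrict alpha).
Proof.
apply: dprodP => i; rewrite /= /cech_restrict /sheafification_fun /cech_map.
rewrite -[LHS]sheaf_unit_res; congr (unit b _ _).
by apply/funext => s; congr (alpha _); exact/continuousEP.
Qed.

Lemma phi_sing_pre k (x : singular_complex R X k) : phi_sing k x = tot_unit k (phi_pre k x).
Proof.
apply: dprodP => -[[|a] b e] /=; rewrite /tot_unit_fun /=; last by rewrite raddf0.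
exact: sheaf_restrictE.
Qed.

Lemma phi_sing_phi k (x : singular_complex R X k) :
  phi_sing k x = cech_phi U (sheaf_sing_complex R X) k (sheafification R X k x).
Proof.
apply: dprodP => -[[|a] b e] //=.
by rewrite /sheaf_restrict /=; case: k / e x.
Qed.

Fact constant_cochain_res (V W : opens X) (h : W `<=` V) (s : constant_sheaf X V) :
  @constant_cochain X R W (res (constant_sheaf X) h s) =
  res (sing_presheaf R X 0) h (@constant_cochain X R V s).
Proof. by []. Qed.

Definition constant_pre : presheaf_map (constant_sheaf X) (sing_presheaf_complex R X 0) :=
  @PresheafMap X (constant_sheaf X) (sing_presheaf R X 0)
    (fun V => @constant_cochain X R V) constant_cochain_res.

Fact constant_pre_dif V s : pc_dif (sing_presheaf_complex R X) 0 V (constant_pre V s) = 0.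
Proof. exact: constant_cochain_dif. Qed.

Definition psi_pre : chain_map (cech_complex U (constant_sheaf X)) (total_complex Epre) :=
  cech_psi U constant_pre_dif.

Lemma psi_sheaf_pre k (x : cech_complex U (constant_sheaf X) k) :
  cech_psi U (@constant_unit_dif X R) k x = tot_unit k (psi_pre k x).
Proof.
apply: dprodP => -[a [|b] e] /=; rewrite /tot_unit_fun /= ?raddf0 //.
Qed.

Section Bijective.
Hypothesis U_good : good_open_cover R U.
Hypothesis X_paracompact : paracompact X.
Let U_cover : \bigcup_i U i = [set: X] := U_good.1.

(** The cone operator of the contractible intersections makes the columns exact. *)
Lemma psi_pre_bijective k : bijective (cohomology_map psi_pre (k := k)).
Proof.
have con a (i : nsimplex U a) : exists (y : set_type (ninter i))
    (H : continuousType (set_type (ninter i) * unit_interval R)%type (set_type (ninter i))),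
    (forall z, H (z, I0 R) = z) /\ (forall z, H (z, I1 R) = y).
  have [y [H hH]] := U_good.2 _ i.
  by exists y, H; split=> z; have [] := hH z.
apply: aug_h_bijective => [a b x xc|a x xc|a x xc].
- have /dependent_choice_fun[h hh] : forall i : nsimplex U a,
      exists h : sing_presheaf R X b (ninter i), x i = sing_dif h.
    move=> i; have [y [H [H0 H1]]] := con a i.
    apply: (cone_exact H0 H1); exact: (congr1 (fun f : Epre a b.+2 => f i) xc).
  by exists h; apply: dprodP => i; rewrite hh.
- have /dependent_choice_fun[n hn] : forall i : nsimplex U a,
      exists n : int, forall s, x i s = n.
    move=> i; have [y [H [H0 H1]]] := con a i.
    exists (x i (apex R y)) => s; apply: (cone_const H0 H1).
    exact: (congr1 (fun f : Epre a 1 => f i) xc).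
  exists (fun i => integer_section (ninter i) (n i)).
  by apply: dprodP => i; apply/funext => s; rewrite hn.
- apply: dprodP => i; apply: val_inj; apply/funext => z.
  have := congr1 (fun f : Epre a 0 => f i (cst z : sing R (set_type (ninter i)) 0)) xc.
  by [].
Qed.

Lemma sing_restrict_eq0 b (alpha : singular_complex R X b) :
  sing_restrict alpha = 0 <-> forall s, small U (asing s) -> alpha s = 0.
Proof.
split=> [h s [j js]|h].
  have [i ei] : exists i : nsimplex U 0, vertex_seq i = [:: j].
    apply: vertex_seq_exists => //; have [x jx] := sing_nonempty js.
    by exists x => k; rewrite inE => /eqP ->.
  have si : carried (ninter i) (asing s).
    by rewrite ninter_meets ei => p k; rewrite inE => /eqP ->; exact: js.
  have := congr1 (fun f : Epre 0 b => f i (to_sub si)) h.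
  by rewrite /sing_restrict to_subK.
apply: dprodP => i; apply/funext => s; apply: h; exists (i ord0) => p.
exact: (@ninter_cover _ _ _ U _ i ord0 _ (@carried_of_sub _ _ _ _ s p)).
Qed.

(** The rows are exact, and the cochains that restrict to zero, those vanishing on
   small simplices, form an acyclic complex. *)
Lemma phi_pre_bijective k : bijective (cohomology_map phi_pre (k := k)).
Proof.
apply: aug_v_bijective => [a b x xc|b x xc|x x0 xc|b x x0 xc].
- exact: sing_row_exact.
- have [alpha ha] := sing_row_onto xc; exists alpha.
  by apply: dprodP => i; apply/funext => s; rewrite ha.
- apply: (small_kernel0 U_cover xc); exact/sing_restrict_eq0.
- have [beta hb e] := small_kernel U_cover xc ((sing_restrict_eq0 x).1 x0).
  by exists beta => //; exact/sing_restrict_eq0.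
Qed.

(** A cochain with zero germs vanishes on the simplices in some neighbourhood of each
   point, and these neighbourhoods form the cover. *)
Lemma sheaf_restrict_eq0 b (alpha : singular_complex R X b) :
  sheaf_restrict b alpha = 0 -> exists V : X -> opens X,
    \bigcup_x V x = [set: X] /\ forall s, small V (asing s) -> alpha s = 0.
Proof.
move=> h; have /choice[V hV] : forall x, exists V : opens X, opens_set V x /\
    forall s, carried V (asing s) -> alpha s = 0.
  move=> x; have [j _ jx] : (\bigcup_i U i) x by rewrite U_cover.
  have [i ei] : exists i : nsimplex U 0, vertex_seq i = [:: j].
    by apply: vertex_seq_exists => //; exists x => k; rewrite inE => /eqP ->.
  have ix : opens_set (ninter i) x by rewrite ninter_meets ei => k; rewrite inE => /eqP ->.
  have := congr1 (fun f : E 0 b => ss_val (f i) (exist _ x (mem_set ix))) h.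
  rewrite sheaf_restrictE => e.
  have /stalk_eqP[W [hW [h0 [Wx eW]]]] : germ (exist _ x (mem_set ix)) (sing_restrict alpha i) =
    germ (exist _ x (mem_set ix)) (0 : sing_presheaf R X b (ninter i)) by rewrite raddf0; exact: e.
  exists W; split=> // s Ws.
  have e0 : res (sing_presheaf R X b) hW (sing_restrict alpha i) = 0.
    by rewrite -(raddf0 (res (sing_presheaf R X b) h0)); exact: eW.
  transitivity (res (sing_presheaf R X b) hW (sing_restrict alpha i) (to_sub Ws)).
    by congr (alpha _); exact/continuousEP.
  by rewrite e0.
exists V; split; last by move=> s [x hx]; exact: (hV x).2 hx.
by apply/seteqP; split=> // x _; exists x => //; exact: (hV x).1.
Qed.

Lemma sheaf_restrict0 b (alpha : singular_complex R X b) (V : X -> opens X) :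
  \bigcup_x V x = [set: X] -> (forall s, small V (asing s) -> alpha s = 0) ->
  sheaf_restrict b alpha = 0.
Proof.
move=> Vc hV; rewrite sheaf_restrictE; apply: dprodP => i; apply: sheaf_sectionP => -[x xi] /=.
have ix : opens_set (ninter i) x := set_mem xi.
have [y _ yx] : (\bigcup_x V x) x by rewrite Vc.
rewrite (bool_irrelevance xi (mem_set ix)).
transitivity (germ (exist _ x (mem_set ix)) (sing_restrict alpha i)); first by [].
rewrite (germ_restrict (@opensIl _ (ninter i) (V y)) ix (conj ix yx)).
rewrite (_ : res _ _ _ = 0) ?raddf0 //.
apply/funext => s; apply: hV; exists y => p /=.
by have /set_mem[] := valP (s p).
Qed.

(** As for [phi_pre_bijective], but a cochain in the kernel vanishes on the small
   simplices of a cover that depends on it. *)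
Lemma phi_sing_bijective k : bijective (cohomology_map phi_sing (k := k)).
Proof.
apply: aug_v_bijective => [a b x xc|b x xc|x x0 xc|b x x0 xc].
- exact: (sheaf_row_exact X_paracompact U_cover).
- have [t ->] := sheaf_row_onto U_cover xc; have [alpha ->] := sheafification_onto X_paracompact t.
  by exists alpha.
- have [V [Vc hV]] := sheaf_restrict_eq0 x0; exact: (small_kernel0 Vc xc).
- have [V [Vc hV]] := sheaf_restrict_eq0 x0.
  have [beta hb e] := small_kernel Vc xc hV.
  by exists beta => //; exact: sheaf_restrict0 hb.
Qed.

Lemma cech_restrict_inj b (t : sheaf_sing_complex R X b (opensT X)) :
  @cech_restrict _ _ _ U (sheaf_sing_complex R X) b t = 0 -> t = 0.
Proof.
move=> h; apply: sheaf_sectionP => -[x xT].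
have [j _ jx] : (\bigcup_i U i) x by rewrite U_cover.
have [i ei] : exists i : nsimplex U 0, vertex_seq i = [:: j].
  by apply: vertex_seq_exists => //; exists x => k; rewrite inE => /eqP ->.
have ix : opens_set (ninter i) x by rewrite ninter_meets ei => k; rewrite inE => /eqP ->.
have := congr1 (fun f : E 0 b => ss_val (f i) (exist _ x (mem_set ix))) h.
by move=> /= e; rewrite -[RHS]e; exact: (dprod_irr (ss_val t)).
Qed.

Lemma phi_bijective k : bijective (@phi_bar R X d I U k).
Proof.
apply: aug_v_bijective => [a b x xc|b x xc|x x0 xc|b x x0 xc].
- exact: (sheaf_row_exact X_paracompact U_cover).
- by have [t ->] := sheaf_row_onto U_cover xc; exists t.
- exact: cech_restrict_inj x0.
- by exists 0; rewrite raddf0 // (cech_restrict_inj x0).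
Qed.

Lemma tot_unit_bijective k : bijective (cohomology_map tot_unit (k := k)).
Proof.
apply: bijective_cancel_right (phi_pre_bijective k) (phi_sing_bijective k).
apply: cohomology_map_comp; exact: phi_sing_pre.
Qed.

(** The detour through presheaf cochains is what avoids the columns of sheafified
   cochains, whose exactness would call for paracompact intersections. *)
Lemma psi_bijective k : bijective (@psi_bar R X d I U k).
Proof.
apply: bijective_compE (psi_pre_bijective k) (tot_unit_bijective k).
apply: cohomology_map_comp; exact: psi_sheaf_pre.
Qed.
End Bijective.
End DoubleComplexes.

(** * Simplices of the space against simplices of the nerve *)

Section Carrier.
Variables (R : realType) (X : topologicalType).
Variables (d : Order.disp_t) (I : orderType d) (U : I -> opens X).
Hypothesis U_good : good_open_cover R U.
Notation anysing := (anysing R X).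
Notation sing_bd := (@sing_bd R X).
Notation aug := (@aug R X).

(** A multiple of a point normalises the augmentation, on which the next step of a
   recursive filling depends. *)
Lemma acyclic_normalized (A : set X) (z : chains anysing) : acyclic R A ->
  span (carried A) z -> sing_bd z = 0 -> aug z = 0 ->
  exists y, [/\ span (carried A) y, sing_bd y = z & aug y = 0].
Proof.
move=> [[p Ap] hA] hz bz az; have [y hy by_] := hA z hz bz az.
exists (y - cell (point R p) *~ aug y); split.
- by apply: spanB => //; apply: span_mulz; apply: span_cell.
- by rewrite sing_bdB by_ /sing_bd raddfMz /= mul0rz subr0.
- by rewrite raddfB raddfMz /= aug_point intz subrr.
Qed.

(** The intersections of the members indexed by vertices of [i] contain [ninter i],
   so they are non-empty, hence contractible. *)
Lemma acyclic_star k (i : nsimplex U k) : acyclic R (joins U (vertex_seq i)).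
Proof.
rewrite -(setTI (joins _ _)); apply: acyclic_joins => [||t ti t0].
- exact: openT.
- by rewrite -size_eq0 size_vertex_seq.
rewrite setTI; have t_sorted : sorted <%O t := subseq_sorted lt_trans ti (sorted_vertex_seq i).
have [x] := vtx_inter i; rewrite -/(opens_set (ninter i) x) ninter_meets => hx.
case zt: (size t) t0 => [|m] t0; first by rewrite (size0nil zt) in t0.
have [j ej] : exists j : nsimplex U m, vertex_seq j = t.
  by apply: vertex_seq_exists => //; exists x => l /(mem_subseq ti); exact: hx.
rewrite -ej -ninter_meets; apply: contractible_acyclic; exact: U_good.2.
Qed.

Variable iota : continuousType (nerve U R) X.
Hypothesis iota_respects : respects_cover iota.

(** Evaluating a cochain on the values of such a function gives an element of the
   double complex of presheaf cochains. *)
Definition bicochain a b : zmodType := nsimplex U a -> sing R X b -> chains anysing.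

Definition nerve_dif a b (f : bicochain a b) : bicochain a.+1 b :=
  fun i s => \sum_(l < a.+2) f (nface l i) s *~ (-1) ^+ l.

(** The sign is [(-1) ^+ a] of the total complex times the minus sign in
   [sing_dif]. *)
Definition face_dif a b (f : bicochain a b) : bicochain a b.+1 :=
  fun i s => (\sum_(l < b.+2) f i (sing_face l s) *~ (-1) ^+ l) *~ (-1) ^+ a.+1.

Fact nerve_dif_zmod a b : zmod_morphism (@nerve_dif a b).
Proof.
move=> f g; apply/funext => i; apply/funext => s.
transitivity (\sum_(l < a.+2) (f (nface l i) s - g (nface l i) s) *~ (-1) ^+ l); first by [].
by under eq_bigr do rewrite mulrzBl; rewrite sumrB.
Qed.
HB.instance Definition _ a b := GRing.isZmodMorphism.Build (bicochain a b) (bicochain a.+1 b)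
  (@nerve_dif a b) (@nerve_dif_zmod a b).

Fact face_dif_zmod a b : zmod_morphism (@face_dif a b).
Proof.
move=> f g; apply/funext => i; apply/funext => s.
transitivity ((\sum_(l < b.+2) (f i (sing_face l s) - g i (sing_face l s)) *~ (-1) ^+ l)
  *~ (-1) ^+ a.+1); first by [].
by under eq_bigr do rewrite mulrzBl; rewrite sumrB mulrzBl.
Qed.
HB.instance Definition _ a b := GRing.isZmodMorphism.Build (bicochain a b) (bicochain a b.+1)
  (@face_dif a b) (@face_dif_zmod a b).

Lemma nerve_dif_dif a b (f : bicochain a b) : nerve_dif (nerve_dif f) = 0.
Proof.
apply/funext => i; apply/funext => s.
rewrite -[RHS](@alternating_sum2 (chains anysing) a.+2
  (fun l m => f (nface m (nface l i)) s)) //.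
by move=> l m lm; rewrite nface_nface.
Qed.

Lemma face_dif_dif a b (f : bicochain a b) : face_dif (face_dif f) = 0.
Proof.
apply/funext => i; apply/funext => s; rewrite /face_dif.
under eq_bigr do rewrite mulrzAC.
rewrite -mulrz_suml (@alternating_sum2 (chains anysing) b.+2
    (fun l m => f i (sing_face m (sing_face l s)))) ?mul0rz //.
by move=> l m lm; rewrite sing_face_face.
Qed.

Lemma nerve_face_dif a b (f : bicochain a b) :
  nerve_dif (face_dif f) = - face_dif (nerve_dif f).
Proof.
apply/funext => i; apply/funext => s.
transitivity (- face_dif (nerve_dif f) i s); last by [].
rewrite /nerve_dif /face_dif.
under eq_bigr do rewrite mulrzAC mulrz_suml.
have -> : (-1) ^+ a.+2 = - (-1) ^+ a.+1 :> int by rewrite exprS mulN1r.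
rewrite -mulrz_suml exchange_big /= mulrNz opprK; congr (_ *~ _).
by apply: eq_bigr => l _; rewrite mulrz_suml; apply: eq_bigr => m _; rewrite mulrzAC.
Qed.

Definition bicochain_dif := family_dif (fun a b => @nerve_dif a b : {additive bicochain a b -> _})
  (fun a b => @face_dif a b : {additive bicochain a b -> _}).

Arguments bicochain_dif : clear implicits.

(** What separates restriction from the nerve formula: [s] in the column [a = 0],
   the simplex of the nerve in the row [b = 0].  The sign [(-1) ^+ a] is the one for
   which [comparison_closed] holds. *)
Definition comparison : forall a b, bicochain a b := fun a b i s =>
  (if a == 0%N then cell (asing s) else 0) -
  (if b == 0%N then cell (asing (iota \o nerve_simplex (R := R) i)) *~ (-1) ^+ a else 0).

Arguments comparison : clear implicits.

Definition solve a (i : nsimplex U a) (x : chains anysing) : chains anysing :=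
  xget 0 [set y | [/\ span (carried (joins U (vertex_seq i))) y, sing_bd y = x & aug y = 0]].

(** The column [a], given the contribution [L] of the column before it. *)
Fixpoint solve_column a (L : forall b, bicochain a b) b : bicochain a b :=
  match b return bicochain a b with
  | 0 => fun i s => solve i ((L 0%N + 0 - comparison a 0) i s)
  | b'.+1 => fun i s =>
      solve i ((L b'.+1 + face_dif (@solve_column a L b') - comparison a b'.+1) i s)
  end.

Fixpoint homotopy_rec a : forall b, bicochain a b :=
  match a return forall b, bicochain a b with
  | 0 => @solve_column 0 (fun b => 0)
  | a'.+1 => @solve_column a'.+1 (fun b => nerve_dif (@homotopy_rec a' b))
  end.

Definition homotopy : forall a b, bicochain a b := homotopy_rec.

Arguments homotopy : clear implicits.

Arguments solve_column : clear implicits.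
Arguments homotopy_rec : clear implicits.

Lemma homotopyE a b i s :
  homotopy a b i s = solve i ((bicochain_dif homotopy a b - comparison a b) i s).
Proof. by case: a i => [|a] i; case: b s => [|b] s. Qed.

Definition left_sum (F : forall a b, bicochain a b) a b : bicochain a b :=
  match a return bicochain a b with
  | 0 => fun _ _ => 0
  | a'.+1 => fun i s => \sum_(l < a'.+2) F a' b (nface l i) s *~ (-1) ^+ l
  end.

Definition below_sum (F : forall a b, bicochain a b) a b : bicochain a b :=
  match b return bicochain a b with
  | 0 => fun _ _ => 0
  | b'.+1 => fun i s => (\sum_(l < b'.+2) F a b' i (sing_face l s) *~ (-1) ^+ l) *~ (-1) ^+ a.+1
  end.

Arguments left_sum : clear implicits.
Arguments below_sum : clear implicits.

Lemma bicochain_difE F a b i s : bicochain_dif F a b i s = left_sum F a b i s + below_sum F a b i s.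
Proof. by case: a i => [|a] i; case: b s => [|b] s. Qed.

Lemma alternating_const n (x : chains anysing) :
  \sum_(l < n.+2) (if n == 0%N then x else 0) *~ (-1) ^+ l = 0.
Proof.
case: n => [|n] /=; first by rewrite big_ord_recl big_ord1 expr0 expr1 mulrNz subrr.
by rewrite big1 // => l _; rewrite mul0rz.
Qed.

Lemma sing_bd_simplex n (t : sing R X n.+1) :
  sing_bd (cell (asing t)) = \sum_(l < n.+2) cell (asing (sing_face l t)) *~ (-1) ^+ l.
Proof. by []. Qed.

Lemma sing_bd_nerve_simplex n (j : nsimplex U n.+1) :
  sing_bd (cell (asing (iota \o nerve_simplex (R := R) j))) =
  \sum_(l < n.+2) cell (asing (iota \o nerve_simplex (R := R) (nface l j))) *~ (-1) ^+ l.
Proof.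
rewrite sing_bd_simplex; apply: eq_bigr => l _; congr (cell (asing _) *~ _).
by apply/continuousEP => p; rewrite /= nerve_simplex_face.
Qed.

Lemma sing_bdMz x n : sing_bd (x *~ n) = sing_bd x *~ n.
Proof. by rewrite /sing_bd raddfMz. Qed.

Lemma comparison_closed a b i s :
  sing_bd (comparison a b i s) = - bicochain_dif comparison a b i s.
Proof.
rewrite bicochain_difE /comparison; case: a i => [|a] i; case: b s => [|b] s /=.
- by rewrite mulr1z addr0 oppr0.
- rewrite subr0 sing_bd_simplex add0r expr1 mulrN1z opprK.
  under [RHS]eq_bigr do rewrite mulr1z mulrzBl.
  by rewrite sumrB alternating_const subr0.
- rewrite sub0r addr0 -[in LHS]mulrNz sing_bdMz sing_bd_nerve_simplex.
  under [X in _ = - X]eq_bigr do rewrite mulrzBl [_ *~ (-1) ^+ a *~ _]mulrzAC.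
  rewrite sumrB alternating_const sub0r opprK -mulrz_suml.
  by rewrite exprS mulN1r opprK.
- rewrite subr0; under eq_bigr do rewrite subr0.
  under [X in - (_ + X *~ _)]eq_bigr do rewrite sub0r mulNrz.
  rewrite alternating_const sumrN.
  have -> : \sum_(l < b.+2) (if b == 0%N then cell (asing (iota \o nerve_simplex (R := R) i)) *~
      (-1) ^+ a.+1 else 0) *~ (-1) ^+ l = 0 by exact: alternating_const.
  by rewrite oppr0 mul0rz addr0 oppr0.
Qed.

Lemma carried_star_face a (i : nsimplex U a.+1) l :
  joins U (vertex_seq (nface l i)) `<=` joins U (vertex_seq i).
Proof.
move=> x [_ /mapP[m _ ->]] h; exists (i (lift l m)) => //.
by apply/mapP; exists (lift l m); rewrite ?mem_enum.
Qed.

(** The simplex of the nerve lies in the star because [iota] respects the cover. *)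
Lemma comparison_carried a b i (s : sing R X b) : carried (ninter i) (asing s) ->
  span (carried (joins U (vertex_seq i))) (comparison a b i s).
Proof.
move=> si; have star m : i m \in vertex_seq i by apply/mapP; exists m; rewrite ?mem_enum.
apply: spanB; case: eqP => _; try exact: span0.
  apply: span_cell => p; exists (i ord0); first exact: star.
  exact: (@ninter_cover _ _ _ U _ i ord0 _ (si p)).
apply: span_sign; apply: span_cell => p /=.
by have [m _ h] := iota_respects i p; exists (i m); first exact: star.
Qed.

Lemma comparison_aug a b i (s : sing R X b) : aug (comparison a b i s) = 0.
Proof.
rewrite /comparison raddfB /=; case: a i => [|a] i; case: b s => [|b] s //=.
by rewrite raddfMz raddf0 sub0r /aug /cell /unit_cochain /= mul0rz oppr0.
Qed.

Lemma bicochain_difB F G a b :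
  bicochain_dif (fun a b => F a b - G a b) a b = bicochain_dif F a b - bicochain_dif G a b.
Proof.
rewrite /bicochain_dif /family_dif [RHS]subrDD; congr (_ + _).
  by case: a => [|a] /=; rewrite ?subr0 ?raddfB.
by case: b => [|b] /=; rewrite ?subr0 ?raddfB.
Qed.

Lemma bicochain_dif_dif F a b : bicochain_dif (bicochain_dif F) a b = 0.
Proof.
by apply: family_dif_dif => {}a {}b f;
  [exact: nerve_dif_dif|exact: face_dif_dif|exact: nerve_face_dif].
Qed.

Definition good_at a b := forall i s, carried (ninter i) (asing s) ->
  [/\ span (carried (joins U (vertex_seq i))) (homotopy a b i s),
      sing_bd (homotopy a b i s) = (bicochain_dif homotopy a b - comparison a b) i s &
      aug (homotopy a b i s) = 0].

(** At each pair the chain to be filled lies in the star, is closed by the same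
   property on the faces, and has augmentation zero; [acyclic_star] applies. *)
Lemma homotopy_good a b : good_at a b.
Proof.
have step a' b' : (forall a'', a' = a''.+1 -> good_at a'' b') ->
    (forall b'', b' = b''.+1 -> good_at a' b'') -> good_at a' b'.
  move=> {a b} IHa IHb i s si.
  set x := (bicochain_dif homotopy a' b' - comparison a' b') i s.
  have ex : x = left_sum homotopy a' b' i s + below_sum homotopy a' b' i s - comparison a' b' i s.
    by rewrite -bicochain_difE.
  have h1 : span (carried (joins U (vertex_seq i))) x.
    rewrite ex; apply: spanB; last exact: comparison_carried.
    apply: spanD.
      case: a' i s si IHa {IHb x ex} => [|a'] i s si IHa /=; first exact: span0.
      apply: span_sum => l; apply: span_sign.
      have [|h _ _] := IHa _ erefl (nface l i) s.
        by move=> p; apply: ninter_face; exact: si.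
      by apply: span_carriedS h; exact: carried_star_face.
    case: b' s si IHb {IHa x ex} => [|b'] s si IHb /=; first exact: span0.
    apply: span_sign; apply: span_sum => l; apply: span_sign.
    by have [|h _ _] := IHb _ erefl i (sing_face l s); first by move=> p; exact: si.
  have h2 : sing_bd x = 0.
    have main : sing_bd (bicochain_dif homotopy a' b' i s) =
        bicochain_dif (fun a b => bicochain_dif homotopy a b - comparison a b) a' b' i s.
      rewrite !bicochain_difE sing_bdD; congr (_ + _).
        case: a' i s si IHa {IHb x ex h1} => [|a'] i s si IHa //=.
        rewrite /sing_bd raddf_sum; apply: eq_bigr => l _; rewrite raddfMz /=; congr (_ *~ _).
        by have [|_ h _] := IHa _ erefl (nface l i) s;
         first by move=> p; apply: ninter_face; exact: si.
      case: b' s si IHb {IHa x ex h1} => [|b'] s si IHb //=.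
      rewrite /sing_bd raddfMz raddf_sum; congr (_ *~ _).
      apply: eq_bigr => l _; rewrite raddfMz /=; congr (_ *~ _).
      by have [|_ h _] := IHb _ erefl i (sing_face l s); first by move=> p; exact: si.
    rewrite /x [X in sing_bd X](_ : _ = bicochain_dif homotopy a' b' i s - comparison a' b' i s) //.
    rewrite sing_bdB main comparison_closed opprK bicochain_difB bicochain_dif_dif sub0r.
    exact: addNr.
  have h3 : aug x = 0.
    rewrite ex raddfB raddfD /= comparison_aug subr0.
    have -> : aug (left_sum homotopy a' b' i s) = 0.
      case: a' i s si IHa {IHb x ex h1 h2} => [|a'] i s si IHa //=.
      rewrite raddf_sum big1 // => l _; rewrite raddfMz /=.
      have [|_ _ ->] := IHa _ erefl (nface l i) s; last by rewrite mul0rz.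
      by move=> p; apply: ninter_face; exact: si.
    case: b' s si IHb {IHa x ex h1 h2} => [|b'] s si IHb; rewrite ?addr0 // add0r.
    rewrite /= raddfMz raddf_sum big1 ?mul0rz // => l _; rewrite raddfMz /=.
    have [|_ _ ->] := IHb _ erefl i (sing_face l s); last by rewrite mul0rz.
    by move=> p; exact: si.
  have [y hy] := acyclic_normalized (acyclic_star i) h1 h2 h3.
  rewrite homotopyE -/x;
    apply: (xgetPex 0 (P := [set y | [/\ span (carried (joins U (vertex_seq i))) y,
    sing_bd y = x & aug y = 0]])).
  by exists y.
elim: a b => [|a IHa] b; elim: b => [|b IHb].
- by apply: step.
- by apply: step => // _ [<-].
- by apply: step => // _ [<-]; exact: IHa.
- by apply: step => [_ [<-]|_ [<-]]; [exact: IHa|].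
Qed.
End Carrier.

Arguments homotopy {R X d I U} iota a b i _.
Arguments comparison {R X d I U} iota a b i _.
Arguments bicochain_dif {R X d I U} F a b i _ : rename.

(** * The formula *)

Section NerveFormula.
Variables (R : realType) (X : topologicalType).
Variables (d : Order.disp_t) (I : orderType d) (U : I -> opens X).
Hypothesis U_good : good_open_cover R U.
Variable iota : continuousType (nerve U R) X.
Hypothesis iota_respects : respects_cover iota.
Notation Epre := (cech_double U (sing_presheaf_complex R X)).
Notation homotopy := (homotopy iota).
Notation comparison := (comparison iota).

Definition at_simplex b (V : opens X) (s : sing R (set_type V) b)
  (c : sing_presheaf R X b V) : int := c s.

Fact at_simplex_zmod b V s : zmod_morphism (@at_simplex b V s). Proof. by []. Qed.
HB.instance Definition _ b V s := GRing.isZmodMorphism.Build (sing_presheaf R X b V) int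
  (@at_simplex b V s) (@at_simplex_zmod b V s).

Definition at_cell a b (i : nsimplex U a) (s : sing R (set_type (ninter i)) b)
  (c : Epre a b) : int := c i s.

Fact at_cell_zmod a b i s : zmod_morphism (@at_cell a b i s). Proof. by []. Qed.
HB.instance Definition _ a b i s := GRing.isZmodMorphism.Build (Epre a b) int
  (@at_cell a b i s) (@at_cell_zmod a b i s).

Variables (k : nat) (alpha : singular_complex R X k).
Hypothesis alpha_closed : dif (singular_complex R X) alpha = 0.
Notation ahat := (total_cochain alpha).

Definition nerve_homotopy a b : Epre a b :=
  fun i s => eval ahat (homotopy a b i (of_sub s)).

Arguments nerve_homotopy : clear implicits.

(** [alpha] vanishes on boundaries, so evaluating it on the boundary formula for
   the homotopy turns that formula into an equation between cochains. *)
Lemma nerve_homotopy_dif a b (i : nsimplex U a) (s : sing R (set_type (ninter i)) b) :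
  @tot_family_dif Epre nerve_homotopy a b i s = eval ahat (comparison a b i (of_sub s)).
Proof.
have [hs hd _] := homotopy_good U_good iota_respects (@carried_of_sub _ _ _ _ s) (a := a) (b := b).
have /eqP := total_cochain_sing_bd alpha_closed (carried_chain hs).
rewrite hd -[X in X == 0]/(eval ahat (bicochain_dif homotopy a b i (of_sub s) -
  comparison a b i (of_sub s))) raddfB /= subr_eq0 => /eqP <-.
rewrite bicochain_difE raddfD /=.
transitivity (from_left (fun a b => dh Epre (a := a) (b := b)) nerve_homotopy a b i s +
  from_below (@signed_dv Epre) nerve_homotopy a b i s); first by [].
congr (_ + _).
  case: a i s {hs hd} => [|a] i s //=.
  rewrite -[LHS]/(at_simplex s (cech_dif (nerve_homotopy a b) i)) /cech_dif !raddf_sum.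
  apply: eq_bigr => l _; rewrite !raddfMz /=; congr (_ *~ _).
  rewrite /at_simplex /= /nerve_homotopy; congr (eval _ (homotopy a b _ _)).
  exact/continuousEP.
case: b s {hs hd} => [|b] s //=.
rewrite signed_dvE raddfMz raddf_sum /=.
transitivity (at_simplex s (cech_map (sing_presheaf_dif R X b) (nerve_homotopy a b) i) *~ (-1) ^+ a).
  exact: (raddfMz (@at_cell a b.+1 i s)).
rewrite /at_simplex /= /cech_map /= /sing_dif exprS mulN1r mulrNz mulNrz; congr (- (_ *~ _)).
apply: eq_bigr => l _; rewrite raddfMz /=; congr (_ *~ _).
by rewrite /nerve_homotopy of_sub_face.
Qed.

Lemma total_cochain_cast b (e : b = k) (s : sing R X b) :
  ahat (asing s) = cast_deg e alpha s.
Proof. by case: k / e alpha => x; exact: total_cochain_asing. Qed.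

Lemma nerve_cochain_cast a (e : a = k) (i : nsimplex U a) :
  cast_deg e (nerve_cochain iota alpha : cech_complex U (constant_sheaf X) k) i =
  integer_section (ninter i) (ahat (asing (iota \o nerve_simplex (R := R) i))).
Proof.
rewrite (total_cochain_cast e) /=.
by move: (e) alpha; case: k / e => e' alp; rewrite (Prop_irrelevance e' erefl).
Qed.

Definition at_tot (p : antidiagonal k) (i : nsimplex U (ad1 p))
  (s : sing R (set_type (ninter i)) (ad2 p)) (f : tot Epre k) : int := f p i s.

Fact at_tot_zmod p i s : zmod_morphism (@at_tot p i s). Proof. by []. Qed.
HB.instance Definition _ p i s := GRing.isZmodMorphism.Build (tot Epre k) int
  (@at_tot p i s) (@at_tot_zmod p i s).

Lemma phi_psi_homotopy :
  phi_pre R U k alpha - psi_pre R U k (nerve_cochain iota alpha) *~ (-1) ^+ k =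
  @tot_restrict Epre (@tot_family_dif Epre nerve_homotopy) k.
Proof.
apply: dprodP => p; apply: dprodP => i; apply/funext => s.
rewrite -[LHS]/(at_tot s _) raddfB raddfMz /=.
rewrite [RHS]nerve_homotopy_dif raddfB /=.
case: p i s => a b e i s; congr (_ - _); rewrite /at_tot /=.
  case: a e i s => [|a] e i s //=.
  by rewrite /sing_restrict -(total_cochain_cast e).
case: b e i s => [|b] e i s /=; last by rewrite mul0rz.
rewrite /cech_map nerve_cochain_cast raddfMz /=.
by congr (_ *~ (-1) ^+ _); exact/esym/(aug_h_eq e).
Qed.
End NerveFormula.

Lemma coboundary_tot_restrict (K : double_complex) (g : forall a b, K a b) k :
  coboundary (@tot_restrict K (tot_family_dif g) k : total_complex K k).
Proof.
case: k => [|k] /=; last by exists (@tot_restrict K g k); rewrite tot_dif_restrict.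
apply: dprodP => -[[|a] [|b] e] //.
exact: addr0.
Qed.

Lemma cohomology_classMz (C : cochain_complex) k (z : cocycle C k) n :
  cohomology_class z *~ n = cohomology_class (z *~ n).
Proof. by rewrite /cohomology_class -raddfMz. Qed.

Lemma cocycle_valMz (C : cochain_complex) k (z : cocycle C k) n :
  cocycle_val (z *~ n) = cocycle_val z *~ n.
Proof. by rewrite -[LHS]/(val _) raddfMz. Qed.

Lemma phi_pre_nerve (R : realType) (X : topologicalType) (d : Order.disp_t) (I : orderType d)
    (U : I -> opens X) (U_good : good_open_cover R U) (iota : continuousType (nerve U R) X)
    (iota_respects : respects_cover iota) k (alpha : cocycle (singular_complex R X) k) :
  cohomology_map (phi_pre R U) (cohomology_class alpha) =
  cohomology_map (psi_pre R U) (cohomology_class (nerve_cocycle iota alpha) *~ (-1) ^+ k).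
Proof.
rewrite cohomology_classMz !cohomology_mapE; apply/cohomology_classP.
rewrite [X in coboundary X](_ : _ = @tot_restrict (cech_double U (sing_presheaf_complex R X))
  (@tot_family_dif (cech_double U
  (sing_presheaf_complex R X)) (nerve_homotopy iota (cocycle_val alpha))) k).
  exact: coboundary_tot_restrict.
rewrite /= cocycle_valMz raddfMz /=.
apply: (phi_psi_homotopy U_good iota_respects); exact/eqP/(cocycleP alpha).
Qed.

Theorem theorem3 (R : realType) (X : topologicalType)
    (X_slc : semi_locally_contractible R X) (X_paracompact : paracompact X)
    (d : Order.disp_t) (I : orderType d) (U : I -> opens X)
    (U_good : good_open_cover R U)
    (iota : continuousType (nerve U R) X)
    (iota_equiv : homotopy_equivalence R iota)
    (iota_respects : respects_cover iota)
    (k : nat) :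
  [/\ bijective (@phi_bar R X d I U k),
      bijective (@psi_bar R X d I U k) &
      forall alpha : cocycle (singular_complex R X) k,
        sheaf_cohomology_iso (R := R) U
          (cohomology_map (sheafification R X) (cohomology_class alpha)) =
        cohomology_class (nerve_cocycle iota alpha) *~ (-1) ^+ k].
Proof.
have psi_bij := psi_bijective U_good X_paracompact k.
split=> [||alpha]; [exact: phi_bijective U_good X_paracompact k|exact: psi_bij|].
set c := _ *~ _.
have psi_c : psi_bar R c = phi_bar U (cohomology_map (sheafification R X) (cohomology_class alpha)).
  rewrite /psi_bar (cohomology_map_comp (@psi_sheaf_pre R X d I U k)) -phi_pre_nerve //.
  rewrite -(cohomology_map_comp (@phi_sing_pre R X d I U k)).
  exact: (cohomology_map_comp (@phi_sing_phi R X d I U k)).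
rewrite /sheaf_cohomology_iso; apply: (bij_inj psi_bij).
(* The inverse image under [psi_bar] that defines the isomorphism is unique. *)
by rewrite (xgetPex 0 (ex_intro (fun c => psi_bar R c = _) c psi_c)) psi_c.
Qed.
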